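(* Let $k\in(0,1)$, $s_*\in\mathbb{R}$ and let $\kappa,\mu,W_1,W_2$ be the associated objects defined in the context. A curve $\gamma=(\gamma_1,\gamma_2):\mathbb{R}\to\mathbb{H}$ is an orbitlike elastica parametrized by hyperbolic arclength (with curvature function $\kappa$) if and only if for all $s\in\mathbb{R}$ $$\gamma_1(s)=\frac{b_1W_1(s)+b_2W_2(s)+b_3}{a_1W_1(s)+a_2W_2(s)+a_3},\qquad \gamma_2(s)=\frac{1}{\kappa(s)\,(a_1W_1(s)+a_2W_2(s)+a_3)}$$ for some $a_1,a_2,a_3,b_1,b_2,b_3\in\mathbb{R}$ such that $$a_3=\sqrt{a_1^2+a_2^2}>0,\qquad \begin{pmatrix} b_1 \\ b_2 \end{pmatrix}=\frac{b_3}{a_3}\begin{pmatrix} a_1 \\ a_2 \end{pmatrix}+\frac{1}{\sqrt{\mu}\,a_3}\begin{pmatrix} -a_2 \\ a_1 \end{pmatrix}.$$ In this case, with $\phi$ the angle function of $\gamma$ and $\xi^1,\xi^3$ as in the context, one moreover has for all $s\in\mathbb{R}$ \begin{align*} \gamma_2(s)\,(a_1,a_2)^T&=\xi^1(s), \\ \gamma_2(s)\,(b_1,b_2)^T&=\gamma_1(s)\,\xi^1(s)+\gamma_2(s)\,\xi^3(s), \\ \gamma_1(s)&=\frac{b_3}{a_3}+\frac{1}{2\mu a_3}\big(\kappa(s)^2\sin(\phi(s))+2\kappa'(s)\cos(\phi(s))\big), \\ \gamma_2(s)&=\frac{\kappa(s)}{\mu a_3}+\frac{1}{2\mu a_3}\big(2\kappa'(s)\sin(\phi(s))-\kappa(s)^2\cos(\phi(s))\big).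 \end{align*}
   Context: Let $\mathbb{H}=\{(x_1,x_2)\in\mathbb{R}^2: x_2>0\}$ be the hyperbolic plane. A smooth curve $\gamma=(\gamma_1,\gamma_2)$ in $\mathbb{H}$ is parametrized by hyperbolic arclength if $(\gamma_1')^2+(\gamma_2')^2=\gamma_2^2$; its angle function $\phi$ (unique up to $2\pi\mathbb{Z}$) is the smooth function with $\gamma_1'=\gamma_2\cos\phi$, $\gamma_2'=\gamma_2\sin\phi$, and its hyperbolic curvature function is $\phi'+\cos\phi$. For $k\in(0,1)$, $s_*\in\mathbb{R}$ put $$\kappa(s)=\frac{2}{\sqrt{2-k^2}}\,\mathrm{dn}\Big(\frac{s+s_*}{\sqrt{2-k^2}},k\Big),\qquad \mu=\frac{4(1-k^2)}{(2-k^2)^2}.$$ An orbitlike elastica (for these $k,s_*$) is a curve parametrized by hyperbolic arclength with hyperbolic curvature function $\kappa$. Here $\mathrm{sn},\mathrm{cn},\mathrm{dn}$ are Jacobi's elliptic functions with modulus $k$. Definition of $W_1,W_2$. Let $F(l,k)=\int_0^l\frac{dt}{\sqrt{1-t^2}\sqrt{1-k^2t^2}}$, $K(k)=F(1,k)$, $k'=\sqrt{1-k^2}$, $q_k=\exp(-\pi K(k')/K(k))$. For $z\in\mathbb{C}$ let $$\Theta(z,k)=1+2\sum_{n\ge1}(-1)^nq_k^{n^2}\cos\Big(\frac{n\pi z}{K(k)}\Big),\quad H(z,k)=2\sum_{n\ge0}(-1)^nq_k^{(n+1/2)^2}\sin\Big(\frac{(2n+1)\pi z}{2K(k)}\Big),\quad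 \zeta(z,k)=\frac{\partial_z\Theta(z,k)}{\Theta(z,k)}.$$ With $\alpha_k=F(k',k')$ set $w_+(s)=\frac{H(s-i\alpha_k,k)}{\Theta(s,k)}e^{s\zeta(i\alpha_k,k)}$ and define real functions $w_1,w_2:\mathbb{R}\to\mathbb{R}$ by $w_1(s)+iw_2(s)=\frac{\sqrt{1-k^2}}{\operatorname{Im}(w_+(0))}w_+(s)$; they form a fundamental system of $w''+2\,\mathrm{dn}^2(\cdot,k)w=0$. Finally $$W_j(s)=\frac{1}{\sqrt{2-k^2}}\,w_j\Big(-K(k)+\frac{s+s_*}{\sqrt{2-k^2}}\Big)\qquad(j=1,2).$$ Definition of $\xi^1,\xi^3$ (all functions evaluated at $s$): $$\xi^1=\begin{pmatrix} W_1 & W_2 \\ W_1' & W_2' \end{pmatrix}^{-1}\begin{pmatrix} \frac1\kappa-\frac{\kappa}{\mu}-\frac{\kappa'}{\mu}\sin\phi+\frac{\kappa^2}{2\mu}\cos\phi \\ -\frac1\kappa\sin\phi-\frac{\kappa'}{\kappa^2} \end{pmatrix},\qquad \xi^3=\begin{pmatrix} W_1 & W_2 \\ W_1' & W_2' \end{pmatrix}^{-1}\begin{pmatrix} \frac{\kappa^2}{2\mu}\sin\phi+\frac{\kappa'}{\mu}\cos\phi \\ \frac1\kappa\cos\phi \end{pmatrix}.$$ *)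

(* Defs.v *)
From Stdlib Require Import Reals.
From Coquelicot Require Import Coquelicot.
Open Scope R_scope.

(** * Elliptic integrals and Jacobi elliptic functions *)

(* The integral is improper at the upper endpoint when l = 1. *)
Definition ellF (l k : R) : R :=
  RInt_gen (fun t => / (sqrt (1 - t ^ 2) * sqrt (1 - k ^ 2 * t ^ 2)))
    (at_point 0) (at_left l).

Definition ellK (k : R) : R := ellF 1 k.

Definition comod (k : R) : R := sqrt (1 - k ^ 2).

(* [am u k] is the unique real p with
   u = int_0^p dt / sqrt (1 - k^2 sin^2 t); since the integrand is at least 1,
   the right-hand side is an increasing bijection of R for 0 <= k < 1. *)
Definition am (u k : R) : R :=
  iota (fun p : R => RInt (fun t => / sqrt (1 - k ^ 2 * sin t ^ 2)) 0 p = u).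

Definition sn (u k : R) : R := sin (am u k).

Definition dn (u k : R) : R := sqrt (1 - k ^ 2 * sn u k ^ 2).

(** * Complex functions *)

Definition Cexp (z : C) : C :=
  (exp (Re z) * cos (Im z), exp (Re z) * sin (Im z)).

Definition Ccos (z : C) : C := ((Cexp (Ci * z) + Cexp (- (Ci * z))) / 2)%C.

Definition Csin (z : C) : C :=
  ((Cexp (Ci * z) - Cexp (- (Ci * z))) / (2 * Ci))%C.

Definition CSeries (a : nat -> C) : C :=
  (Series (fun n => Re (a n)), Series (fun n => Im (a n))).

(** * Theta functions *)

Definition nome (k : R) : R := exp (- PI * ellK (comod k) / ellK k).

(* The sum over n >= 1 is written with n = m + 1, m >= 0. *)
Definition Theta (z : C) (k : R) : C :=
  (1 + 2 * CSeries (fun m =>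
     RtoC ((-1) ^ S m * nome k ^ (S m * S m))
     * Ccos (RtoC (INR (S m) * PI / ellK k) * z)))%C.

Definition Eta (z : C) (k : R) : C :=
  (2 * CSeries (fun n =>
     RtoC ((-1) ^ n * Rpower (nome k) ((INR n + 1 / 2) ^ 2))
     * Csin (RtoC ((2 * INR n + 1) * PI / (2 * ellK k)) * z)))%C.

Definition zeta (z : C) (k : R) : C :=
  (C_derive (fun y => Theta y k) z / Theta z k)%C.

(** * The functions w_j and W_j *)

Definition alpha (k : R) : R := ellF (comod k) (comod k).

Definition w_plus (k s : R) : C :=
  (Eta (RtoC s - Ci * RtoC (alpha k)) k / Theta (RtoC s) k
   * Cexp (RtoC s * zeta (Ci * RtoC (alpha k)) k))%C.

Definition w_complex (k s : R) : C :=
  (RtoC (sqrt (1 - k ^ 2) / Im (w_plus k 0)) * w_plus k s)%C.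

Definition w1 (k s : R) : R := Re (w_complex k s).
Definition w2 (k s : R) : R := Im (w_complex k s).

Definition W1 (k sstar s : R) : R :=
  / sqrt (2 - k ^ 2) * w1 k (- ellK k + (s + sstar) / sqrt (2 - k ^ 2)).
Definition W2 (k sstar s : R) : R :=
  / sqrt (2 - k ^ 2) * w2 k (- ellK k + (s + sstar) / sqrt (2 - k ^ 2)).

Definition kappa (k sstar s : R) : R :=
  2 / sqrt (2 - k ^ 2) * dn ((s + sstar) / sqrt (2 - k ^ 2)) k.

Definition mu (k : R) : R := 4 * (1 - k ^ 2) / (2 - k ^ 2) ^ 2.

(** * Curves in the hyperbolic plane *)

Definition Hyp : Type := {x : R * R | 0 < snd x}.

Definition coord1 (c : R -> Hyp) (s : R) : R := fst (proj1_sig (c s)).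
Definition coord2 (c : R -> Hyp) (s : R) : R := snd (proj1_sig (c s)).

Definition smooth (f : R -> R) : Prop := forall n x, ex_derive_n f n x.

Definition arclength_curve (c : R -> Hyp) : Prop :=
  smooth (coord1 c) /\ smooth (coord2 c) /\
  forall s, Derive (coord1 c) s ^ 2 + Derive (coord2 c) s ^ 2 = coord2 c s ^ 2.

Definition angle_function (c : R -> Hyp) (phi : R -> R) : Prop :=
  smooth phi /\
  forall s, Derive (coord1 c) s = coord2 c s * cos (phi s) /\
            Derive (coord2 c) s = coord2 c s * sin (phi s).

(* Angle functions differ by constants in 2 PI Z, so the choice of phi is
   immaterial. *)
Definition curvature_function (c : R -> Hyp) (kap : R -> R) : Prop :=
  exists phi, angle_function c phi /\
    forall s, kap s = Derive phi s + cos (phi s).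

Definition orbitlike_elastica (k sstar : R) (c : R -> Hyp) : Prop :=
  arclength_curve c /\ curvature_function c (kappa k sstar).

(** * The vectors xi^1 and xi^3 *)

(* 2x2 matrices are given as pairs of rows. *)
Definition mat2 : Type := ((R * R) * (R * R))%type.

Definition det2 (A : mat2) : R :=
  let '((a, b), (c, d)) := A in a * d - b * c.

Definition inv2 (A : mat2) : mat2 :=
  let '((a, b), (c, d)) := A in
  ((d / det2 A, - b / det2 A), (- c / det2 A, a / det2 A)).

Definition mulmv2 (A : mat2) (v : R * R) : R * R :=
  let '((a, b), (c, d)) := A in
  (a * fst v + b * snd v, c * fst v + d * snd v).

Definition fundamental_matrix (k sstar s : R) : mat2 :=
  ((W1 k sstar s, W2 k sstar s),
   (Derive (W1 k sstar) s, Derive (W2 k sstar) s)).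

Definition xi1 (k sstar : R) (phi : R -> R) (s : R) : R * R :=
  let kap := kappa k sstar s in
  let kap' := Derive (kappa k sstar) s in
  mulmv2 (inv2 (fundamental_matrix k sstar s))
    (1 / kap - kap / mu k - kap' / mu k * sin (phi s)
       + kap ^ 2 / (2 * mu k) * cos (phi s),
     - (1 / kap) * sin (phi s) - kap' / kap ^ 2).

Definition xi3 (k sstar : R) (phi : R -> R) (s : R) : R * R :=
  let kap := kappa k sstar s in
  let kap' := Derive (kappa k sstar) s in
  mulmv2 (inv2 (fundamental_matrix k sstar s))
    (kap ^ 2 / (2 * mu k) * sin (phi s) + kap' / mu k * cos (phi s),
     1 / kap * cos (phi s)).

(** * The explicit parametrization *)

Definition admissible (k a1 a2 a3 b1 b2 b3 : R) : Prop :=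
  a3 = sqrt (a1 ^ 2 + a2 ^ 2) /\ 0 < a3 /\
  b1 = b3 / a3 * a1 + 1 / (sqrt (mu k) * a3) * (- a2) /\
  b2 = b3 / a3 * a2 + 1 / (sqrt (mu k) * a3) * a1.

Definition parametrized (k sstar : R) (c : R -> Hyp)
    (a1 a2 a3 b1 b2 b3 : R) : Prop :=
  forall s,
    coord1 c s = (b1 * W1 k sstar s + b2 * W2 k sstar s + b3)
                 / (a1 * W1 k sstar s + a2 * W2 k sstar s + a3) /\
    coord2 c s = 1 / (kappa k sstar s
                      * (a1 * W1 k sstar s + a2 * W2 k sstar s + a3)).

(* Main.v *)
(** Up to a rotation, which the admissible parameters absorb, the pair (W_1, W_2) is
    determined by two facts: W_1^2 + W_2^2 = 1 - mu / kappa^2 and the Wronskian equals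
    sqrt mu / 2.  Both follow from theta function identities.  With q = exp(-L), the double
    series for theta(x + y) theta(x - y) is resummed along n + m and n - m; this gives the
    addition formula H(x + y) H(x - y) Theta(0)^2 = H(x)^2 Theta(y)^2 - Theta(x)^2 H(y)^2,
    which computes |w|^2 at y = i alpha, while its y-derivative there computes the Wronskian,
    and also the algebraic relations and first order differential equations between the
    quotients of theta functions.  Hence these quotients invert the elliptic integrals along
    the real axis, where the quarter period is C pi / 2, and along the imaginary axis, where it
    is C L / 2; so q is the nome of its modulus, and every modulus is reached by continuity in
    L.  The zeros of the theta
    functions are located by descent along L -> 2 L, the formulas
    theta_3 theta_4 (x | L) = theta_4 (2x | 2L) theta_4 (0 | 2L) and its analogue for theta_1
    moving a zero to ever smaller nomes.

    For the curve put X = kappa' sin phi - kappa^2 cos phi / 2 and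
    Y = kappa^2 sin phi / 2 + kappa' cos phi.  Then (X + kappa) / gamma_2 and
    gamma_1 - Y gamma_2 / (X + kappa) are constant along an elastica; they are mu a_3 and
    b_3 / a_3, and (1 / (kappa gamma_2) - a_3, Y / (sqrt mu kappa gamma_2)) solves the same
    linear system as (W_1, W_2). *)

Require Import Defs.
From Stdlib Require Import Reals.
From Coquelicot Require Import Coquelicot.
From Stdlib Require Import Ranalysis5 Lra Lia ZArith.
Open Scope R_scope.

(** * Sums over the integers *)

(** Norm and Wronskian determine the pair up to a rotation because they are its polar data. The norm
    1 - mu / kappa^2 is positive, since kappa^2 - mu = kappa'^2 + kappa^4 / 4, and the Wronskian
    divided by the squared norm is the angular velocity of W_1 + i W_2, so that only an initial
    angle stays open.

    The number alpha is the point where the elliptic sine of the complementary modulus takes the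
    value k'. This makes the coefficient of sn^2 in |w|^2 equal to k^2, hence |w|^2 + dn^2 constant;
    the shift by K in W_j then turns dn^2 into k'^2 / dn^2. The exponential factor with zeta(i
    alpha) is the rotation that cancels the remaining sn^2 term of the Wronskian.

    The statement is phrased in k, the theta series in L. Modulus and period are therefore first
    introduced as theta constants of L, and only afterwards are [ellK], [am], [nome] and [alpha]
    evaluated at that modulus. *)

Definition Zsum (f : Z -> R) : R :=
  Series (fun n => f (Z.of_nat n) + f (- Z.of_nat n - 1)%Z).

(** Geometric decay is weaker than the Gaussian decay of theta series, but it is stable under sums
    and affine reindexing, and a single bound gives convergence, shifts and interchange of sums. *)
Definition expdec (f : Z -> R) : Prop :=
  exists M r, 0 <= M /\ 0 < r < 1 /\ forall n, Rabs (f n) <= M * r ^ Z.abs_nat n.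

Definition expdec2 (F : Z -> Z -> R) : Prop :=
  exists M r, 0 <= M /\ 0 < r < 1 /\
    forall n m, Rabs (F n m) <= M * (r ^ Z.abs_nat n * r ^ Z.abs_nat m).

Lemma pow_le_antimono (r : R) (m n : nat) :
  0 < r < 1 -> (m <= n)%nat -> r ^ n <= r ^ m.
Proof.
  intros Hr Hmn. replace n with (m + (n - m))%nat by lia.
  rewrite pow_add, <- Rmult_1_r. apply Rmult_le_compat_l; [apply pow_le; lra |].
  rewrite <- (pow1 (n - m)). apply pow_incr; lra.
Qed.

Lemma ex_series_geom_scal (M r : R) : 0 < r < 1 -> ex_series (fun n => M * r ^ n).
Proof.
  intros Hr. apply (ex_series_scal_l M (fun n => r ^ n)). apply ex_series_geom.
  rewrite Rabs_pos_eq; lra.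
Qed.

Lemma Series_geom_scal (M r : R) : 0 < r < 1 -> Series (fun n => M * r ^ n) = M / (1 - r).
Proof.
  intros Hr. rewrite Series_scal_l, Series_geom; [reflexivity |].
  rewrite Rabs_pos_eq; lra.
Qed.

Lemma Series_nonneg (a : nat -> R) : (forall n, 0 <= a n) -> ex_series a -> 0 <= Series a.
Proof.
  intros H Ha. rewrite <- (Rmult_0_l (Series (fun _ => 0))), <- Series_scal_l.
  apply Series_le; [| exact Ha]. intros n. specialize (H n). lra.
Qed.

Lemma Series_eq_0 (a : nat -> R) : (forall n, a n = 0) -> Series a = 0.
Proof.
  intros H. rewrite <- (Rmult_0_l (Series (fun _ => 0))), <- Series_scal_l.
  apply Series_ext. intros n. rewrite H. ring.
Qed.

Lemma ex_series_dom (a : nat -> R) (M r : R) :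
  0 < r < 1 -> (forall n, Rabs (a n) <= M * r ^ n) -> ex_series a.
Proof.
  intros Hr H. apply (ex_series_le a (fun n => M * r ^ n)).
  - exact H.
  - now apply ex_series_geom_scal.
Qed.

Lemma Series_bound_geom (a : nat -> R) (M r : R) :
  0 < r < 1 -> (forall n, Rabs (a n) <= M * r ^ n) -> Rabs (Series a) <= M / (1 - r).
Proof.
  intros Hr H. rewrite <- Series_geom_scal by exact Hr.
  assert (Hx : ex_series (fun n => Rabs (a n))).
  { apply (ex_series_dom _ M r Hr). intros n. rewrite Rabs_Rabsolu. apply H. }
  eapply Rle_trans; [now apply Series_Rabs |].
  apply Series_le; [| now apply ex_series_geom_scal].
  intros n; split; [apply Rabs_pos | apply H].
Qed.

Lemma expdec_term (f : Z -> R) (M r : R) :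
  0 <= M -> 0 < r < 1 -> (forall n, Rabs (f n) <= M * r ^ Z.abs_nat n) ->
  forall n : nat, Rabs (f (Z.of_nat n) + f (- Z.of_nat n - 1)%Z) <= (2 * M) * r ^ n.
Proof.
  intros HM Hr H n. eapply Rle_trans; [apply Rabs_triang |].
  assert (H1 := H (Z.of_nat n)). assert (H2 := H (- Z.of_nat n - 1)%Z).
  replace (Z.abs_nat (Z.of_nat n)) with n in H1 by lia.
  replace (Z.abs_nat (- Z.of_nat n - 1)) with (S n) in H2 by lia.
  assert (r ^ S n <= r ^ n) by (apply pow_le_antimono; [lra | lia]).
  assert (M * r ^ S n <= M * r ^ n) by (apply Rmult_le_compat_l; lra).
  lra.
Qed.

Lemma expdec_ex_series (f : Z -> R) :
  expdec f -> ex_series (fun n => f (Z.of_nat n) + f (- Z.of_nat n - 1)%Z).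
Proof.
  intros (M & r & HM & Hr & H).
  apply (ex_series_dom _ (2 * M) r Hr). now apply expdec_term.
Qed.

Lemma expdec_le (f g : Z -> R) :
  (forall n, Rabs (f n) <= Rabs (g n)) -> expdec g -> expdec f.
Proof.
  intros H (M & r & HM & Hr & Hg). exists M, r. repeat split; try lra.
  intros n. eapply Rle_trans; [apply H | apply Hg].
Qed.

Lemma expdec_ext (f g : Z -> R) : (forall n, f n = g n) -> expdec f -> expdec g.
Proof. intros H. apply expdec_le. intros n; rewrite H; lra. Qed.

Lemma expdec_scal (c : R) (f : Z -> R) : expdec f -> expdec (fun n => c * f n).
Proof.
  intros (M & r & HM & Hr & H). exists (Rabs c * M), r.
  repeat split; try lra.
  - apply Rmult_le_pos; [apply Rabs_pos | lra].
  - intros n. rewrite Rabs_mult, Rmult_assoc.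
    apply Rmult_le_compat_l; [apply Rabs_pos | apply H].
Qed.

Lemma expdec_plus (f g : Z -> R) : expdec f -> expdec g -> expdec (fun n => f n + g n).
Proof.
  intros (M & r & HM & Hr & H) (M' & r' & HM' & Hr' & H').
  exists (M + M'), (Rmax r r'). repeat split; try lra.
  - apply Rlt_le_trans with r; [lra | apply Rmax_l].
  - apply Rmax_lub_lt; lra.
  - intros n. eapply Rle_trans; [apply Rabs_triang |].
    rewrite Rmult_plus_distr_r. apply Rplus_le_compat.
    + eapply Rle_trans; [apply H |]. apply Rmult_le_compat_l; [lra |].
      apply pow_incr. split; [lra | apply Rmax_l].
    + eapply Rle_trans; [apply H' |]. apply Rmult_le_compat_l; [lra |].
      apply pow_incr. split; [lra | apply Rmax_r].
Qed.

Lemma expdec_affine (f : Z -> R) (a b : Z) :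
  (a <> 0)%Z -> expdec f -> expdec (fun n => f (a * n + b)%Z).
Proof.
  intros Ha (M & r & HM & Hr & H).
  (* The constant comes from |n| <= |a n + b| + |b|, valid as a is a nonzero integer. *)
  exists (M * / r ^ Z.abs_nat b), r. repeat split; try lra.
  - apply Rmult_le_pos; [lra |]. left. apply Rinv_0_lt_compat, pow_lt; lra.
  - intros n. eapply Rle_trans; [apply H |].
    rewrite Rmult_assoc. apply Rmult_le_compat_l; [lra |].
    apply Rmult_le_reg_l with (r ^ Z.abs_nat b); [apply pow_lt; lra |].
    rewrite <- Rmult_assoc, Rinv_r, Rmult_1_l by (apply pow_nonzero; lra).
    rewrite <- pow_add. apply pow_le_antimono; [lra |]. nia.
Qed.

Lemma Zsum_ext (f g : Z -> R) : (forall n, f n = g n) -> Zsum f = Zsum g.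
Proof. intros H. apply Series_ext. intros n. now rewrite !H. Qed.

Lemma Zsum_plus (f g : Z -> R) :
  expdec f -> expdec g -> Zsum (fun n => f n + g n) = Zsum f + Zsum g.
Proof.
  intros Hf Hg. unfold Zsum. rewrite <- Series_plus by now apply expdec_ex_series.
  apply Series_ext. intros n. ring.
Qed.

Lemma Zsum_scal (c : R) (f : Z -> R) : Zsum (fun n => c * f n) = c * Zsum f.
Proof.
  unfold Zsum. rewrite <- Series_scal_l. apply Series_ext. intros n. ring.
Qed.

Lemma Zsum_minus (f g : Z -> R) :
  expdec f -> expdec g -> Zsum (fun n => f n - g n) = Zsum f - Zsum g.
Proof.
  intros Hf Hg. replace (Zsum f - Zsum g) with (Zsum f + (-1) * Zsum g) by ring.
  rewrite <- Zsum_scal, <- Zsum_plus; [| exact Hf | now apply expdec_scal].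
  apply Zsum_ext. intros n. ring.
Qed.

Lemma Zsum_le (f g : Z -> R) :
  (forall n, f n <= g n) -> expdec f -> expdec g -> Zsum f <= Zsum g.
Proof.
  intros H Hf Hg. apply Rminus_le. rewrite <- Zsum_minus by assumption.
  apply Ropp_le_cancel. rewrite Ropp_0, <- (Rmult_1_l (Zsum _)), Ropp_mult_distr_l, <- Zsum_scal.
  apply Series_nonneg.
  - intros n. assert (H1 := H (Z.of_nat n)). assert (H2 := H (- Z.of_nat n - 1)%Z). lra.
  - apply (expdec_ex_series (fun n => -(1) * (f n - g n))).
    apply expdec_scal. apply (expdec_plus f (fun n => - g n)); [exact Hf |].
    apply (expdec_ext (fun n => (-1) * g n)); [intros; ring | now apply expdec_scal].
Qed.

Lemma expdec_lim (f : Z -> R) (a b : Z) :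
  (a <> 0)%Z -> expdec f -> is_lim_seq (fun n => f (a * Z.of_nat n + b)%Z) 0.
Proof.
  intros Ha Hf. destruct (expdec_affine f a b Ha Hf) as (M & r & HM & Hr & H).
  apply ex_series_lim_0. apply (ex_series_dom _ M r Hr).
  intros n. specialize (H (Z.of_nat n)). now replace (Z.abs_nat (Z.of_nat n)) with n in H by lia.
Qed.

(** The difference of the two sums telescopes at both ends: its partial sums are f(n + 1) - f(-n -
    1), and both terms tend to 0. *)
Lemma Zsum_shift1 (f : Z -> R) : expdec f -> Zsum (fun n => f (n + 1)%Z) = Zsum f.
Proof.
  intros Hf. apply Rminus_diag_uniq.
  assert (Hf1 : expdec (fun n => f (n + 1)%Z)).
  { apply (expdec_ext (fun n => f (1 * n + 1)%Z)); [intros n; f_equal; lia |].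
    apply expdec_affine; [lia | exact Hf]. }
  rewrite <- Zsum_minus by assumption. unfold Zsum. apply is_series_unique.
  change (is_lim_seq (sum_n (fun n : nat => f (Z.of_nat n + 1)%Z - f (Z.of_nat n)
    + (f (- Z.of_nat n - 1 + 1)%Z - f (- Z.of_nat n - 1)%Z))) 0).
  apply (is_lim_seq_ext (fun n => f (1 * Z.of_nat n + 1)%Z - f (-1 * Z.of_nat n + -1)%Z)).
  - intros n. induction n as [|n IH].
    + rewrite sum_O. simpl. ring.
    + rewrite sum_Sn, <- IH. change plus with Rplus.
      replace (1 * Z.of_nat (S n) + 1)%Z with (Z.of_nat (S n) + 1)%Z by lia.
      replace (-1 * Z.of_nat (S n) + -1)%Z with (- Z.of_nat (S n) - 1)%Z by lia.
      replace (1 * Z.of_nat n + 1)%Z with (Z.of_nat (S n)) by lia.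
      replace (-1 * Z.of_nat n + -1)%Z with (- Z.of_nat (S n) - 1 + 1)%Z by lia.
      simpl. ring.
  - replace (Finite 0) with (Finite (0 - 0)) by (f_equal; ring).
    apply is_lim_seq_minus'; apply expdec_lim; try lia; assumption.
Qed.

Lemma Zsum_shift (f : Z -> R) (a : Z) : expdec f -> Zsum (fun n => f (n + a)%Z) = Zsum f.
Proof.
  assert (Hd : forall f b, expdec f -> expdec (fun n => f (n + b)%Z)).
  { intros g b Hg. apply (expdec_ext (fun n => g (1 * n + b)%Z)); [intros n; f_equal; lia |].
    apply expdec_affine; [lia | exact Hg]. }
  assert (Hn : forall (k : nat) (f : Z -> R), expdec f -> Zsum (fun n => f (n + Z.of_nat k)%Z) = Zsum f).
  { induction k as [|k IH]; intros g Hg.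
    - apply Zsum_ext. intros n. f_equal. lia.
    - rewrite <- (Zsum_shift1 g Hg), <- (IH (fun n => g (n + 1)%Z)) by now apply Hd.
      apply Zsum_ext. intros n. f_equal. lia. }
  intros Hf. destruct (Z.le_ge_cases 0 a) as [Ha|Ha].
  - rewrite <- (Hn (Z.to_nat a) f Hf). apply Zsum_ext. intros n. f_equal. lia.
  - rewrite <- (Hn (Z.to_nat (- a)) (fun n => f (n + a)%Z)) by now apply Hd.
    apply Zsum_ext. intros n. f_equal. lia.
Qed.

(** The reflection followed by a shift by one exchanges the two terms of each pair n, -n - 1. *)
Lemma Zsum_opp (f : Z -> R) : expdec f -> Zsum (fun n => f (- n)%Z) = Zsum f.
Proof.
  intros Hf. rewrite <- (Zsum_shift1 f Hf). apply Series_ext. intros n.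
  rewrite Rplus_comm. f_equal; f_equal; lia.
Qed.

(** The pairing n, -n - 1 in [Zsum] fits half-integer characteristics, where it yields sine series;
    the pairing n, -n here fits characteristic 0 and yields cosine series with an isolated constant
    term. *)
Lemma Zsum_symm (f : Z -> R) :
  expdec f -> Zsum f = f 0%Z + Series (fun n => f (Z.of_nat (S n)) + f (- Z.of_nat (S n))%Z).
Proof.
  intros Hf.
  assert (Hp : ex_series (fun n => f (Z.of_nat n))).
  { destruct Hf as (M & r & HM & Hr & H). apply (ex_series_dom _ M r Hr).
    intros n. specialize (H (Z.of_nat n)). now replace (Z.abs_nat (Z.of_nat n)) with n in H by lia. }
  assert (Hm : ex_series (fun n => f (- Z.of_nat (S n))%Z)).
  { destruct Hf as (M & r & HM & Hr & H). apply (ex_series_dom _ M r Hr).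
    intros n. specialize (H (- Z.of_nat (S n))%Z).
    replace (Z.abs_nat (- Z.of_nat (S n))%Z) with (S n) in H by lia.
    eapply Rle_trans; [apply H |]. apply Rmult_le_compat_l; [lra |].
    apply pow_le_antimono; [lra | lia]. }
  rewrite (Series_plus (fun n => f (Z.of_nat (S n))) (fun n => f (- Z.of_nat (S n))%Z));
    [| apply (ex_series_incr_1 (fun n => f (Z.of_nat n))); exact Hp | exact Hm].
  unfold Zsum.
  rewrite (Series_ext (fun n => f (Z.of_nat n) + f (- Z.of_nat n - 1)%Z)
                      (fun n => f (Z.of_nat n) + f (- Z.of_nat (S n))%Z)).
  - rewrite Series_plus by assumption. rewrite (Series_incr_1 (fun n => f (Z.of_nat n))) by exact Hp.
    simpl Z.of_nat at 1. ring.
  - intros n. do 2 f_equal. lia.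
Qed.

Lemma Series_even_odd (u : nat -> R) :
  ex_series u -> Series u = Series (fun n => u (2 * n)%nat + u (2 * n + 1)%nat).
Proof.
  intros Hu. symmetry. apply is_series_unique.
  apply Series_correct in Hu.
  change (is_lim_seq (sum_n u) (Series u)) in Hu.
  change (is_lim_seq (sum_n (fun n => u (2 * n)%nat + u (2 * n + 1)%nat)) (Series u)).
  apply (is_lim_seq_ext (fun n => sum_n u (2 * n + 1))).
  - induction n as [|n IH].
    + simpl. rewrite sum_Sn, !sum_O. reflexivity.
    + rewrite sum_Sn, <- IH. replace (2 * S n + 1)%nat with (S (S (2 * n + 1))) by lia.
      rewrite !sum_Sn. change plus with Rplus.
      replace (2 * S n)%nat with (S (2 * n + 1)) by lia.
      replace (S (2 * n + 1) + 1)%nat with (S (S (2 * n + 1))) by lia. ring.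
  - apply (is_lim_seq_subseq (sum_n u) (Series u) (fun n => (2 * n + 1)%nat)).
    + apply eventually_subseq. intros n. lia.
    + exact Hu.
Qed.

Lemma Zsum_even_odd (f : Z -> R) :
  expdec f -> Zsum f = Zsum (fun n => f (2 * n)%Z) + Zsum (fun n => f (2 * n + 1)%Z).
Proof.
  intros Hf. rewrite <- Zsum_plus.
  - unfold Zsum at 1. rewrite Series_even_odd by now apply expdec_ex_series.
    apply Series_ext. intros n.
    replace (Z.of_nat (2 * n + 1)) with (2 * Z.of_nat n + 1)%Z by lia.
    replace (Z.of_nat (2 * n)) with (2 * Z.of_nat n)%Z by lia.
    replace (2 * (- Z.of_nat n - 1))%Z with (- (2 * Z.of_nat n + 1) - 1)%Z by lia.
    replace (- (2 * Z.of_nat n + 1) - 1 + 1)%Z with (- (2 * Z.of_nat n) - 1)%Z by lia.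
    ring.
  - apply (expdec_ext (fun n => f (2 * n + 0)%Z)); [intros n; f_equal; lia |].
    apply expdec_affine; [lia | exact Hf].
  - apply expdec_affine; [lia | exact Hf].
Qed.

(** * Interchange and reindexing of double sums *)

Lemma Series_sum_n (a : nat -> nat -> R) (N : nat) :
  (forall n, ex_series (a n)) ->
  ex_series (fun m => sum_n (fun n => a n m) N) /\
  sum_n (fun n => Series (a n)) N = Series (fun m => sum_n (fun n => a n m) N).
Proof.
  intros Ha. induction N as [|N [IH1 IH2]].
  - split.
    + apply (ex_series_ext (a 0%nat)); [intros m; now rewrite sum_O | apply Ha].
    + rewrite sum_O. apply Series_ext. intros m. now rewrite sum_O.
  - assert (E : forall m, sum_n (fun n => a n m) N + a (S N) m = sum_n (fun n => a n m) (S N)).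
    { intros m. now rewrite sum_Sn. }
    split.
    + apply (ex_series_ext _ _ E). now apply (ex_series_plus (fun m => sum_n (fun n => a n m) N)).
    + rewrite sum_Sn, IH2. change plus with Rplus. rewrite <- Series_plus by auto.
      now apply Series_ext.
Qed.

(** The first N + 1 rows can be summed column by column; what they miss is a double tail of size at
    most M r^(N+1) / (1 - r)^2. *)
Lemma Series_swap (a : nat -> nat -> R) (M r : R) :
  0 <= M -> 0 < r < 1 -> (forall n m, Rabs (a n m) <= M * (r ^ n * r ^ m)) ->
  Series (fun n => Series (a n)) = Series (fun m => Series (fun n => a n m)).
Proof.
  intros HM Hr H. apply is_series_unique.
  assert (Hrow : forall n, ex_series (a n)).
  { intros n. apply (ex_series_dom _ (M * r ^ n) r Hr). intros m.
    rewrite Rmult_assoc. apply H. }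
  assert (Hcol : forall m, ex_series (fun n => a n m)).
  { intros m. apply (ex_series_dom _ (M * r ^ m) r Hr). intros n.
    rewrite Rmult_assoc, (Rmult_comm (r ^ m)). apply H. }
  assert (Hcolb : forall m, Rabs (Series (fun n => a n m)) <= (M / (1 - r)) * r ^ m).
  { intros m. replace (M / (1 - r) * r ^ m) with (M * r ^ m / (1 - r)) by (field; lra).
    apply Series_bound_geom; [exact Hr |]. intros n.
    rewrite Rmult_assoc, (Rmult_comm (r ^ m)). apply H. }
  assert (Hcols : ex_series (fun m => Series (fun n => a n m)))
    by (apply (ex_series_dom _ (M / (1 - r)) r Hr); exact Hcolb).
  set (S2 := Series (fun m => Series (fun n => a n m))) in *.
  assert (Hb : forall N, Rabs (sum_n (fun n => Series (a n)) N - S2)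
                         <= M / (1 - r) / (1 - r) * r ^ (S N)).
  { intros N. destruct (Series_sum_n a N Hrow) as [E1 E2]. rewrite E2.
    unfold S2. rewrite <- Series_minus by assumption.
    replace (M / (1 - r) / (1 - r) * r ^ S N) with (M * r ^ S N / (1 - r) / (1 - r)) by (field; lra).
    apply Series_bound_geom; [exact Hr |]. intros m.
    rewrite (Series_incr_n (fun n => a n m) (S N)) by (try lia; apply Hcol).
    simpl Init.Nat.pred. rewrite <- sum_n_Reals.
    match goal with |- Rabs (?x - (?x + ?y)) <= _ => replace (x - (x + y)) with (- y) by ring end.
    rewrite Rabs_Ropp.
    replace (M * r ^ S N / (1 - r) * r ^ m) with (M * r ^ S N * r ^ m / (1 - r)) by (field; lra).
    apply Series_bound_geom; [exact Hr |]. intros k.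
    eapply Rle_trans; [apply H |]. rewrite pow_add. right. ring. }
  change (is_lim_seq (sum_n (fun n => Series (a n))) S2).
  apply is_lim_seq_spec. intros eps.
  assert (HL : is_lim_seq (fun N => M / (1 - r) / (1 - r) * r ^ (S N)) 0).
  { replace (Finite 0) with (Rbar_mult (M / (1 - r) / (1 - r)) 0) by (simpl; f_equal; ring).
    apply is_lim_seq_scal_l. apply (is_lim_seq_incr_1 (fun N => r ^ N)).
    apply is_lim_seq_geom. rewrite Rabs_pos_eq; lra. }
  apply is_lim_seq_spec in HL. destruct (HL eps) as [N0 HN0].
  exists N0. intros N HN. eapply Rle_lt_trans; [apply Hb |].
  specialize (HN0 N HN). rewrite Rminus_0_r in HN0.
  eapply Rle_lt_trans; [apply Rle_abs | exact HN0].
Qed.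

Lemma expdec2_row (F : Z -> Z -> R) (n : Z) : expdec2 F -> expdec (F n).
Proof.
  intros (M & r & HM & Hr & H). exists (M * r ^ Z.abs_nat n), r.
  repeat split; try lra.
  - apply Rmult_le_pos; [lra | apply pow_le; lra].
  - intros m. rewrite Rmult_assoc. apply H.
Qed.

Lemma expdec2_sum (F : Z -> Z -> R) : expdec2 F -> expdec (fun n => Zsum (F n)).
Proof.
  intros (M & r & HM & Hr & H). exists (2 * M / (1 - r)), r.
  repeat split; try lra.
  - apply Rmult_le_pos; [lra |]. left; apply Rinv_0_lt_compat; lra.
  - intros n. replace (2 * M / (1 - r) * r ^ Z.abs_nat n)
      with (2 * (M * r ^ Z.abs_nat n) / (1 - r)) by (field; lra).
    apply Series_bound_geom; [exact Hr |]. apply expdec_term; [| exact Hr |].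
    + apply Rmult_le_pos; [lra | apply pow_le; lra].
    + intros m. rewrite Rmult_assoc. apply H.
Qed.

Lemma expdec2_flip (F : Z -> Z -> R) : expdec2 F -> expdec2 (fun m n => F n m).
Proof.
  intros (M & r & HM & Hr & H). exists M, r. repeat split; try lra.
  intros n m. rewrite (Rmult_comm (r ^ Z.abs_nat n)). apply H.
Qed.

Lemma Zsum_swap (F : Z -> Z -> R) :
  expdec2 F -> Zsum (fun n => Zsum (F n)) = Zsum (fun m => Zsum (fun n => F n m)).
Proof.
  intros HF.
  (* The four sign quadrants are folded into one array over pairs of natural numbers. *)
  set (a := fun n m : nat =>
    F (Z.of_nat n) (Z.of_nat m) + F (Z.of_nat n) (- Z.of_nat m - 1)%Z +
    (F (- Z.of_nat n - 1)%Z (Z.of_nat m) + F (- Z.of_nat n - 1)%Z (- Z.of_nat m - 1)%Z)).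
  transitivity (Series (fun n => Series (a n))).
  - apply Series_ext. intros n. unfold Zsum at 1 2. rewrite <- Series_plus.
    + reflexivity.
    + apply (expdec_ex_series (F _)). now apply expdec2_row.
    + apply (expdec_ex_series (F _)). now apply expdec2_row.
  - transitivity (Series (fun m => Series (fun n => a n m))).
    + destruct HF as (M & r & HM & Hr & H).
      apply (Series_swap _ (4 * M) r); [lra | exact Hr |].
      intros n m. unfold a.
      assert (H1 := H (Z.of_nat n) (Z.of_nat m)).
      assert (H2 := H (Z.of_nat n) (- Z.of_nat m - 1)%Z).
      assert (H3 := H (- Z.of_nat n - 1)%Z (Z.of_nat m)).
      assert (H4 := H (- Z.of_nat n - 1)%Z (- Z.of_nat m - 1)%Z).
      rewrite <- pow_add in H1, H2, H3, H4. rewrite <- pow_add.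
      assert (P : forall j, (n + m <= j)%nat -> M * r ^ j <= M * r ^ (n + m)).
      { intros j Hj. apply Rmult_le_compat_l; [lra |]. apply pow_le_antimono; [lra | lia]. }
      assert (P1 := P (Z.abs_nat (Z.of_nat n) + Z.abs_nat (Z.of_nat m))%nat ltac:(lia)).
      assert (P2 := P (Z.abs_nat (Z.of_nat n) + Z.abs_nat (- Z.of_nat m - 1))%nat ltac:(lia)).
      assert (P3 := P (Z.abs_nat (- Z.of_nat n - 1) + Z.abs_nat (Z.of_nat m))%nat ltac:(lia)).
      assert (P4 := P (Z.abs_nat (- Z.of_nat n - 1) + Z.abs_nat (- Z.of_nat m - 1))%nat ltac:(lia)).
      eapply Rle_trans; [apply Rabs_triang |].
      assert (T1 := Rabs_triang (F (Z.of_nat n) (Z.of_nat m)) (F (Z.of_nat n) (- Z.of_nat m - 1)%Z)).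
      assert (T2 := Rabs_triang (F (- Z.of_nat n - 1)%Z (Z.of_nat m))
                       (F (- Z.of_nat n - 1)%Z (- Z.of_nat m - 1)%Z)).
      lra.
    + apply Series_ext. intros m. unfold Zsum at 1 2. rewrite <- Series_plus.
      * apply Series_ext. intros n. unfold a. ring.
      * apply (expdec_ex_series (fun n => F n _)).
        apply (expdec2_row (fun m n => F n m)). now apply expdec2_flip.
      * apply (expdec_ex_series (fun n => F n _)).
        apply (expdec2_row (fun m n => F n m)). now apply expdec2_flip.
Qed.

(** An integer matrix with entries in {-1, 0, 1} and determinant of absolute value 1 or 2 has an
    inverse with entries of absolute value at most 1. Hence |i| + |j| is at most twice the size of
    the image, which costs a square root in the rate; the offsets e, e' cost a constant factor. *)
Lemma expdec2_reindex (F : Z -> Z -> R) (a b c d e e' : Z) :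
  (Z.abs (a * d - b * c) = 1 \/ Z.abs (a * d - b * c) = 2)%Z ->
  (Z.abs a <= 1 /\ Z.abs b <= 1 /\ Z.abs c <= 1 /\ Z.abs d <= 1)%Z ->
  expdec2 F -> expdec2 (fun i j => F (a * i + b * j + e)%Z (c * i + d * j + e')%Z).
Proof.
  intros Hdet Habs (M & r & HM & Hr & H).
  exists (M * / r ^ (Z.abs_nat e + Z.abs_nat e')), (sqrt r).
  assert (Hs : 0 < sqrt r < 1).
  { split; [apply sqrt_lt_R0; lra |]. rewrite <- sqrt_1. apply sqrt_lt_1; lra. }
  repeat split; try lra.
  - apply Rmult_le_pos; [lra |]. left. apply Rinv_0_lt_compat, pow_lt; lra.
  - intros i j. eapply Rle_trans; [apply H |].
    rewrite Rmult_assoc. apply Rmult_le_compat_l; [lra |].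
    rewrite <- !pow_add.
    apply Rmult_le_reg_l with (r ^ (Z.abs_nat e + Z.abs_nat e')); [apply pow_lt; lra |].
    rewrite <- Rmult_assoc, Rinv_r, Rmult_1_l by (apply pow_nonzero; lra).
    rewrite <- pow_add.
    rewrite <- (sqrt_sqrt r) at 1 by lra.
    replace (sqrt r * sqrt r) with (sqrt r ^ 2) by ring. rewrite <- pow_mult.
    apply pow_le_antimono; [exact Hs |].
    (* With the four entries fixed the inequality is linear up to absolute values, so each case
       falls to [lia]. *)
    assert (Ha : (a = -1 \/ a = 0 \/ a = 1)%Z) by lia.
    assert (Hb : (b = -1 \/ b = 0 \/ b = 1)%Z) by lia.
    assert (Hc : (c = -1 \/ c = 0 \/ c = 1)%Z) by lia.
    assert (Hd : (d = -1 \/ d = 0 \/ d = 1)%Z) by lia.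
    destruct Ha as [-> | [-> | ->]]; destruct Hb as [-> | [-> | ->]];
    destruct Hc as [-> | [-> | ->]]; destruct Hd as [-> | [-> | ->]]; lia.
Qed.

(* With [j = (n + m) / 2] and [i = (n - m) / 2], the sum over all [(n, m)] splits
   according to the parity of [n + m]. *)
Lemma Zsum_sum_diff (F : Z -> Z -> R) :
  expdec2 F ->
  Zsum (fun n => Zsum (fun m => F n m)) =
  Zsum (fun j => Zsum (fun i => F (j + i) (j - i))%Z) +
  Zsum (fun j => Zsum (fun i => F (j + i + 1) (j - i))%Z).
Proof.
  intros HF.
  assert (HG : expdec2 (fun n p => F n (p - n)%Z)).
  { destruct (expdec2_reindex F 1 0 (-1) 1 0 0 ltac:(lia) ltac:(lia) HF) as (M & r & HM & Hr & H).
    exists M, r. repeat split; try lra. intros n m. specialize (H n m).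
    now replace (F n (m - n)%Z) with (F (1 * n + 0 * m + 0) (-1 * n + 1 * m + 0))%Z by (f_equal; lia). }
  assert (HG' := expdec2_flip _ HG).
  transitivity (Zsum (fun n => Zsum (fun p => F n (p - n)%Z))).
  { apply Zsum_ext. intros n. symmetry. apply (Zsum_shift (F n) (- n)).
    now apply expdec2_row. }
  rewrite Zsum_swap by exact HG.
  rewrite (Zsum_even_odd (fun p => Zsum (fun n => F n (p - n)%Z))) by now apply (expdec2_sum (fun p n => F n (p - n)%Z)).
  f_equal.
  - apply Zsum_ext. intros j.
    rewrite <- (Zsum_shift (fun n => F n (2 * j - n)%Z) j) by now apply (expdec2_row (fun p n => F n (p - n)%Z)).
    apply Zsum_ext. intros i. f_equal; lia.
  - apply Zsum_ext. intros j.
    rewrite <- (Zsum_shift (fun n => F n (2 * j + 1 - n)%Z) (j + 1)) by now apply (expdec2_row (fun p n => F n (p - n)%Z)).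
    apply Zsum_ext. intros i. f_equal; lia.
Qed.

(** * Complex sums and the complex exponential *)

Definition CZsum (f : Z -> C) : C := (Zsum (fun n => Re (f n)), Zsum (fun n => Im (f n))).

Definition Cexpdec (f : Z -> C) : Prop := expdec (fun n => Cmod (f n)).

Lemma C_ext (a b : C) : Re a = Re b -> Im a = Im b -> a = b.
Proof. destruct a, b; simpl; intros; congruence. Qed.

Lemma Re_mult (a b : C) : Re (a * b)%C = Re a * Re b - Im a * Im b.
Proof. reflexivity. Qed.

Lemma Im_mult (a b : C) : Im (a * b)%C = Re a * Im b + Im a * Re b.
Proof. reflexivity. Qed.

Lemma Im_le_Cmod (c : C) : Rabs (Im c) <= Cmod c.
Proof. eapply Rle_trans; [apply Rmax_r | apply Rmax_Cmod]. Qed.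

Lemma Cmod_le_Re_Im (c : C) : Cmod c <= Rabs (Re c) + Rabs (Im c).
Proof.
  replace c with (RtoC (Re c) + Ci * RtoC (Im c))%C at 1 by (apply C_ext; simpl; ring).
  eapply Rle_trans; [apply Cmod_triangle |].
  rewrite Cmod_mult, !Cmod_R, Cmod_Ci. lra.
Qed.

Lemma Cexpdec_Re (f : Z -> C) : Cexpdec f -> expdec (fun n => Re (f n)).
Proof.
  apply expdec_le. intros n. rewrite (Rabs_pos_eq (Cmod _)) by apply Cmod_ge_0. apply re_le_Cmod.
Qed.

Lemma Cexpdec_Im (f : Z -> C) : Cexpdec f -> expdec (fun n => Im (f n)).
Proof.
  apply expdec_le. intros n. rewrite (Rabs_pos_eq (Cmod _)) by apply Cmod_ge_0. apply Im_le_Cmod.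
Qed.

Lemma CZsum_ext (f g : Z -> C) : (forall n, f n = g n) -> CZsum f = CZsum g.
Proof. intros H. unfold CZsum. f_equal; apply Zsum_ext; intros n; now rewrite H. Qed.

Lemma CZsum_plus (f g : Z -> C) :
  Cexpdec f -> Cexpdec g -> CZsum (fun n => f n + g n)%C = (CZsum f + CZsum g)%C.
Proof.
  intros Hf Hg. apply C_ext; simpl.
  - apply (Zsum_plus (fun n => Re (f n)) (fun n => Re (g n))); now apply Cexpdec_Re.
  - apply (Zsum_plus (fun n => Im (f n)) (fun n => Im (g n))); now apply Cexpdec_Im.
Qed.

Lemma CZsum_scal (c : C) (f : Z -> C) : Cexpdec f -> CZsum (fun n => c * f n)%C = (c * CZsum f)%C.
Proof.
  intros Hf. assert (Hr := Cexpdec_Re f Hf). assert (Hi := Cexpdec_Im f Hf).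
  apply C_ext.
  - rewrite Re_mult. simpl. rewrite <- !Zsum_scal, <- Zsum_minus by now apply expdec_scal.
    apply Zsum_ext. intros n. reflexivity.
  - rewrite Im_mult. simpl. rewrite <- !Zsum_scal, <- Zsum_plus by now apply expdec_scal.
    apply Zsum_ext. intros n. reflexivity.
Qed.

Lemma CZsum_scal_r (c : C) (f : Z -> C) : Cexpdec f -> CZsum (fun n => f n * c)%C = (CZsum f * c)%C.
Proof.
  intros Hf. rewrite Cmult_comm, <- CZsum_scal by exact Hf.
  apply CZsum_ext. intros n. apply Cmult_comm.
Qed.

Lemma CZsum_shift (f : Z -> C) (a : Z) : Cexpdec f -> CZsum (fun n => f (n + a)%Z) = CZsum f.
Proof.
  intros Hf. apply C_ext; simpl.
  - apply (Zsum_shift (fun n => Re (f n))). now apply Cexpdec_Re.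
  - apply (Zsum_shift (fun n => Im (f n))). now apply Cexpdec_Im.
Qed.

Lemma CZsum_opp (f : Z -> C) : Cexpdec f -> CZsum (fun n => f (- n)%Z) = CZsum f.
Proof.
  intros Hf. apply C_ext; simpl.
  - apply (Zsum_opp (fun n => Re (f n))). now apply Cexpdec_Re.
  - apply (Zsum_opp (fun n => Im (f n))). now apply Cexpdec_Im.
Qed.

Lemma Cexpdec_scal (c : C) (f : Z -> C) : Cexpdec f -> Cexpdec (fun n => c * f n)%C.
Proof.
  intros H. apply (expdec_ext (fun n => Cmod c * Cmod (f n))).
  - intros n. symmetry. apply Cmod_mult.
  - now apply expdec_scal.
Qed.

Lemma Cexpdec_plus (f g : Z -> C) : Cexpdec f -> Cexpdec g -> Cexpdec (fun n => f n + g n)%C.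
Proof.
  intros Hf Hg. eapply expdec_le; [| apply (expdec_plus _ _ Hf Hg)].
  intros n. rewrite !Rabs_pos_eq.
  - apply Cmod_triangle.
  - apply Rplus_le_le_0_compat; apply Cmod_ge_0.
  - apply Cmod_ge_0.
Qed.

Lemma Zsum_abs_le (f g : Z -> R) :
  (forall n, Rabs (f n) <= g n) -> expdec g -> Rabs (Zsum f) <= Zsum g.
Proof.
  intros H Hg.
  assert (Hf : expdec f).
  { apply (expdec_le f g); [| exact Hg]. intros n.
    rewrite (Rabs_pos_eq (g n)); [apply H |]. eapply Rle_trans; [apply Rabs_pos | apply H]. }
  apply Rabs_le. split.
  - replace (- Zsum g) with (Zsum (fun n => (-1) * g n)) by (rewrite Zsum_scal; ring).
    apply Zsum_le; [| now apply expdec_scal | exact Hf].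
    intros n. specialize (H n). apply Rabs_le_between in H. lra.
  - apply Zsum_le; [| exact Hf | exact Hg].
    intros n. specialize (H n). apply Rabs_le_between in H. lra.
Qed.

(** The factor 2 comes from bounding real and imaginary parts separately. *)
Lemma CZsum_bound (f : Z -> C) (g : Z -> R) :
  (forall n, Cmod (f n) <= g n) -> expdec g -> Cmod (CZsum f) <= 2 * Zsum g.
Proof.
  intros H Hg. eapply Rle_trans; [apply Cmod_le_Re_Im |].
  replace (2 * Zsum g) with (Zsum g + Zsum g) by ring. apply Rplus_le_compat; simpl.
  - apply Zsum_abs_le; [| exact Hg]. intros n. eapply Rle_trans; [apply re_le_Cmod | apply H].
  - apply Zsum_abs_le; [| exact Hg]. intros n. eapply Rle_trans; [apply Im_le_Cmod | apply H].
Qed.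

Lemma expdec2_mult (f g : Z -> R) : expdec f -> expdec g -> expdec2 (fun n m => f n * g m).
Proof.
  intros (M & r & HM & Hr & H) (M' & r' & HM' & Hr' & H').
  exists (M * M'), (Rmax r r').
  assert (Hle : r <= Rmax r r') by apply Rmax_l.
  assert (Hle' : r' <= Rmax r r') by apply Rmax_r.
  repeat split.
  - now apply Rmult_le_pos.
  - lra.
  - apply Rmax_lub_lt; lra.
  - intros n m. rewrite Rabs_mult.
    replace (M * M' * (Rmax r r' ^ Z.abs_nat n * Rmax r r' ^ Z.abs_nat m))
      with ((M * Rmax r r' ^ Z.abs_nat n) * (M' * Rmax r r' ^ Z.abs_nat m)) by ring.
    apply Rmult_le_compat; try apply Rabs_pos.
    + eapply Rle_trans; [apply H |]. apply Rmult_le_compat_l; [lra |]. apply pow_incr; lra.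
    + eapply Rle_trans; [apply H' |]. apply Rmult_le_compat_l; [lra |]. apply pow_incr; lra.
Qed.

Lemma CZsum_sum_diff (f g : Z -> C) :
  Cexpdec f -> Cexpdec g ->
  (CZsum f * CZsum g)%C =
  (CZsum (fun j => CZsum (fun i => f (j + i)%Z * g (j - i)%Z)) +
   CZsum (fun j => CZsum (fun i => f (j + i + 1)%Z * g (j - i)%Z)))%C.
Proof.
  intros Hf Hg.
  assert (HR : expdec2 (fun n m => Re (f n * g m)%C)).
  { destruct (expdec2_mult _ _ Hf Hg) as (M & r & HM & Hr & H). exists M, r.
    repeat split; try lra. intros n m. eapply Rle_trans; [apply re_le_Cmod |].
    rewrite Cmod_mult. eapply Rle_trans; [apply Rle_abs | apply H]. }
  assert (HI : expdec2 (fun n m => Im (f n * g m)%C)).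
  { destruct (expdec2_mult _ _ Hf Hg) as (M & r & HM & Hr & H). exists M, r.
    repeat split; try lra. intros n m. eapply Rle_trans; [apply Im_le_Cmod |].
    rewrite Cmod_mult. eapply Rle_trans; [apply Rle_abs | apply H]. }
  transitivity (CZsum (fun n => CZsum (fun m => f n * g m)%C)).
  - rewrite <- CZsum_scal_r by exact Hf. apply CZsum_ext. intros n. symmetry. now apply CZsum_scal.
  - apply C_ext; simpl.
    + exact (Zsum_sum_diff _ HR).
    + exact (Zsum_sum_diff _ HI).
Qed.

Lemma Cexp_plus (a b : C) : Cexp (a + b)%C = (Cexp a * Cexp b)%C.
Proof.
  destruct a as [a1 a2], b as [b1 b2].
  apply C_ext; unfold Cexp; simpl; rewrite exp_plus, ?cos_plus, ?sin_plus; ring.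
Qed.

Lemma Cexp_0 : Cexp 0%C = 1%C.
Proof. apply C_ext; simpl; rewrite exp_0, ?cos_0, ?sin_0; ring. Qed.

Lemma Cmod_Cexp (z : C) : Cmod (Cexp z) = exp (Re z).
Proof.
  unfold Cmod, Cexp; simpl fst; simpl snd.
  replace ((exp (Re z) * cos (Im z)) ^ 2 + (exp (Re z) * sin (Im z)) ^ 2)
    with (exp (Re z) ^ 2 * ((sin (Im z)) ^ 2 + (cos (Im z)) ^ 2)) by ring.
  replace ((sin (Im z)) ^ 2 + (cos (Im z)) ^ 2) with 1
    by (rewrite <- (sin2_cos2 (Im z)); unfold Rsqr; ring).
  rewrite Rmult_1_r. apply sqrt_pow2. left. apply exp_pos.
Qed.

Lemma Cexp_conj (z : C) : Cexp (Cconj z) = Cconj (Cexp z).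
Proof.
  destruct z as [a b]. apply C_ext; unfold Cexp; simpl; [now rewrite cos_neg | rewrite sin_neg; ring].
Qed.

Lemma Cexp_RtoC (x : R) : Cexp (RtoC x) = RtoC (exp x).
Proof. apply C_ext; simpl; rewrite ?cos_0, ?sin_0; ring. Qed.

(** * Taylor bounds for exponential, sine and cosine *)

Lemma exp_ge_1_plus (x : R) : 1 + x <= exp x.
Proof.
  destruct (Req_dec x 0) as [->|H]; [rewrite exp_0; lra |]. left. now apply exp_ineq1.
Qed.

Lemma exp_le (x y : R) : x <= y -> exp x <= exp y.
Proof. intros [H | ->]; [left; now apply exp_increasing | lra]. Qed.

(** Here and in the next bound everything follows from 1 + x <= exp x at a and at -a, together with
    exp a exp(-a) = 1. *)
Lemma exp_sub_1_abs (a : R) : Rabs (exp a - 1) <= Rabs a * exp (Rabs a).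
Proof.
  assert (H1 := exp_ge_1_plus a). assert (H2 := exp_ge_1_plus (- a)).
  assert (H3 : exp a * exp (- a) = 1) by (rewrite <- exp_plus, <- exp_0; f_equal; ring).
  assert (H4 := exp_pos a). assert (H5 := exp_pos (- a)).
  unfold Rabs. destruct (Rcase_abs a); destruct (Rcase_abs (exp a - 1)); nra.
Qed.

Lemma exp_taylor1_abs (a : R) : Rabs (exp a - 1 - a) <= a ^ 2 * exp (Rabs a).
Proof.
  assert (H1 := exp_ge_1_plus a). rewrite Rabs_pos_eq by lra.
  assert (H2 := exp_ge_1_plus (- a)).
  assert (H3 : exp a * exp (- a) = 1) by (rewrite <- exp_plus, <- exp_0; f_equal; ring).
  assert (H4 := exp_pos a). assert (H5 := exp_pos (- a)).
  assert (H6 : exp a - 1 <= a * exp a) by nra.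
  unfold Rabs. destruct (Rcase_abs a).
  - assert (1 <= exp (- a)) by lra. nra.
  - nra.
Qed.

Lemma cos_sub_1_abs (b : R) : Rabs (cos b - 1) <= b ^ 2.
Proof.
  assert (H : forall t, 0 <= t -> 1 - t ^ 2 <= cos t).
  { intros t Ht. destruct (Rle_dec t 1) as [Ht1|Ht1].
    - assert (Hp := PI2_3_2).
      destruct (cos_bound t 0) as [Hc _]; try lra. unfold cos_approx, cos_term in Hc; simpl in Hc.
      nra.
    - assert (Hp := COS_bound t). destruct (Rle_dec t 2); [| nra].
      assert (Hpi := PI2_3_2). assert (1 < t) by lra.
      destruct (Rle_dec t (PI / 2)).
      + assert (0 <= cos t) by (apply cos_ge_0; lra). nra.
      + assert (1.5 < t) by lra. nra. }
  assert (Hb := COS_bound b).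
  rewrite Rabs_left1 by lra.
  destruct (Rle_dec 0 b) as [Hb0|Hb0].
  - specialize (H b Hb0). lra.
  - specialize (H (- b) ltac:(lra)). rewrite cos_neg in H. nra.
Qed.

Lemma sin_abs_le (b : R) : Rabs (sin b) <= Rabs b.
Proof.
  assert (H : forall t, 0 <= t -> Rabs (sin t) <= t).
  { intros t Ht. assert (Hb := SIN_bound t).
    destruct (Rle_dec t 1) as [H1|H1].
    - destruct (Req_dec t 0) as [->|H0]; [rewrite sin_0, Rabs_R0; lra |].
      assert (Hp := PI2_3_2). assert (0 <= sin t) by (apply sin_ge_0; lra).
      rewrite Rabs_pos_eq by lra. left. apply sin_lt_x. lra.
    - apply Rabs_le. lra. }
  destruct (Rle_dec 0 b) as [Hb|Hb].
  - rewrite (Rabs_pos_eq b) by exact Hb. now apply H.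
  - rewrite (Rabs_left1 b) by lra. rewrite <- (Rabs_Ropp (sin b)), <- sin_neg. apply H. lra.
Qed.

Lemma sin_taylor1_abs (b : R) : Rabs (sin b - b) <= b ^ 2.
Proof.
  assert (H : forall t, 0 <= t -> t - t ^ 2 <= sin t <= t).
  { intros t Ht. split.
    - destruct (Rle_dec t 1) as [H1|H1].
      + assert (Hp := PI2_3_2).
        destruct (sin_bound t 0) as [Hc _]; try lra. unfold sin_approx, sin_term in Hc; simpl in Hc.
        nra.
      + destruct (Rle_dec t 2).
        * assert (Hpi := PI2_3_2). assert (0 <= sin t) by (apply sin_ge_0; lra). nra.
        * assert (Hb := SIN_bound t). nra.
    - assert (Hs := sin_abs_le t). rewrite (Rabs_pos_eq t) in Hs by exact Ht.
      apply Rabs_le_between in Hs. lra. }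
  destruct (Rle_dec 0 b) as [Hb|Hb].
  - specialize (H b Hb). rewrite Rabs_left1 by lra. lra.
  - specialize (H (- b) ltac:(lra)). rewrite sin_neg in H.
    rewrite Rabs_pos_eq by lra. nra.
Qed.

(** With h = a + i b the real part of the remainder is (exp a - 1 - a) + exp a (cos b - 1), the
    imaginary part is exp a (sin b - b) + b (exp a - 1). Each of the four pieces is at most |h|^2
    exp |h|, whence the constant 4. *)
Lemma Cexp_taylor1 (h : C) : Cmod (Cexp h - 1 - h)%C <= 4 * (Cmod h) ^ 2 * exp (Cmod h).
Proof.
  eapply Rle_trans; [apply Cmod_le_Re_Im |].
  destruct h as [a b].
  assert (Ha := re_le_Cmod (a, b)). assert (Hb := Im_le_Cmod (a, b)). simpl in Ha, Hb.
  set (m := Cmod (a, b)) in *.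
  assert (Hm : 0 <= m) by apply Cmod_ge_0.
  assert (Em : exp (Rabs a) <= exp m) by now apply exp_le.
  assert (Em' : exp a <= exp m).
  { apply exp_le. eapply Rle_trans; [apply Rle_abs | exact Ha]. }
  assert (A2 : a ^ 2 <= m ^ 2) by (rewrite <- (pow2_abs a); apply pow_incr; split; [apply Rabs_pos | exact Ha]).
  assert (B2 : b ^ 2 <= m ^ 2) by (rewrite <- (pow2_abs b); apply pow_incr; split; [apply Rabs_pos | exact Hb]).
  assert (T1 := exp_taylor1_abs a). assert (T2 := exp_sub_1_abs a).
  assert (T3 := cos_sub_1_abs b). assert (T4 := sin_taylor1_abs b).
  assert (Pe := exp_pos a). assert (Pm := exp_pos m).
  assert (Pa := Rabs_pos a). assert (Pb := Rabs_pos b). assert (Pea := exp_pos (Rabs a)).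
  assert (R1 : Rabs (Re (Cexp (a, b) - 1 - (a, b))%C) <= m ^ 2 * exp m + exp m * m ^ 2).
  { replace (Re (Cexp (a, b) - 1 - (a, b))%C) with ((exp a - 1 - a) + exp a * (cos b - 1)) by (simpl; ring).
    eapply Rle_trans; [apply Rabs_triang |]. apply Rplus_le_compat.
    - eapply Rle_trans; [apply T1 |]. apply Rmult_le_compat; try lra. apply pow2_ge_0.
    - rewrite Rabs_mult, (Rabs_pos_eq (exp a)) by lra.
      apply Rmult_le_compat; try lra. apply Rabs_pos. }
  assert (R2 : Rabs (Im (Cexp (a, b) - 1 - (a, b))%C) <= exp m * m ^ 2 + m * (m * exp m)).
  { replace (Im (Cexp (a, b) - 1 - (a, b))%C) with (exp a * (sin b - b) + b * (exp a - 1)) by (simpl; ring).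
    eapply Rle_trans; [apply Rabs_triang |]. apply Rplus_le_compat.
    - rewrite Rabs_mult, (Rabs_pos_eq (exp a)) by lra.
      apply Rmult_le_compat; try lra. apply Rabs_pos.
    - rewrite Rabs_mult. apply Rmult_le_compat; try lra; try apply Rabs_pos.
      eapply Rle_trans; [apply T2 |]. apply Rmult_le_compat; lra. }
  lra.
Qed.

(** * Theta functions *)

(* With [q = exp (- L)] the terms are [q ^ ((n + c) ^ 2) * exp (2 i (n + c) z)]; Jacobi's four
   theta functions have [c = 0] or [c = 1/2], up to a shift of [z] by [PI / 2]. *)
Definition theta_term (c L : R) (z : C) (n : Z) : C :=
  Cexp (RtoC (- (L * (IZR n + c) ^ 2)) + RtoC (2 * (IZR n + c)) * (Ci * z))%C.

Definition theta (c L : R) (z : C) : C := CZsum (theta_term c L z).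

Definition dtheta (c L : R) (z : C) : C :=
  CZsum (fun n => RtoC (2 * (IZR n + c)) * Ci * theta_term c L z n)%C.

Lemma expdec_le_pos (f g : Z -> R) :
  (forall n, 0 <= f n <= g n) -> expdec g -> expdec f.
Proof.
  intros H. apply expdec_le. intros n. specialize (H n).
  rewrite (Rabs_pos_eq (f n)), (Rabs_pos_eq (g n)); lra.
Qed.

(** The linear term with B leaves room for the growth of the exponentials off the real axis and for
    polynomial factors. Completing the square gives - L t^2 + B |t| <= (B + 1)^2 / (4 L) - |t|, so
    the rate exp(-1) works for every L. *)
Lemma gauss_expdec (c L B : R) :
  0 < L -> expdec (fun n => exp (- (L * (IZR n + c) ^ 2) + B * Rabs (IZR n + c))).
Proof.
  intros HL.
  exists (exp ((B + 1) ^ 2 / (4 * L) + Rabs c)), (exp (- 1)).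
  split; [left; apply exp_pos |]. split.
  { split; [apply exp_pos |]. rewrite <- exp_0. apply exp_increasing. lra. }
  intros n. rewrite Rabs_pos_eq by (left; apply exp_pos).
  assert (E : exp (-1) ^ Z.abs_nat n = exp (- Rabs (IZR n))).
  { replace (Rabs (IZR n)) with (INR (Z.abs_nat n)) by (rewrite INR_IZR_INZ, Zabs2Nat.id_abs, abs_IZR; reflexivity).
    induction (Z.abs_nat n) as [|k IH].
    - simpl. now rewrite Ropp_0, exp_0.
    - rewrite S_INR. simpl pow. rewrite IH, <- exp_plus. f_equal. ring. }
  rewrite E, <- exp_plus. apply exp_le.
  set (t := IZR n + c).
  assert (H1 : Rabs (IZR n) <= Rabs t + Rabs c).
  { replace (IZR n) with (t - c) by (unfold t; ring). unfold Rminus.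
    rewrite <- (Rabs_Ropp c). apply Rabs_triang. }
  assert (H2 : - (L * t ^ 2) + B * Rabs t <= (B + 1) ^ 2 / (4 * L) - Rabs t).
  { apply Rminus_le. rewrite <- (pow2_abs t).
    replace (- (L * Rabs t ^ 2) + B * Rabs t - ((B + 1) ^ 2 / (4 * L) - Rabs t))
      with (- ((2 * L * Rabs t - (B + 1)) ^ 2 / (4 * L))) by (field; lra).
    apply Ropp_le_cancel. rewrite Ropp_0, Ropp_involutive.
    apply Rmult_le_pos; [apply pow2_ge_0 |]. left. apply Rinv_0_lt_compat. lra. }
  lra.
Qed.

Lemma Cmod_theta_term (c L : R) (z : C) (n : Z) :
  Cmod (theta_term c L z n) = exp (- (L * (IZR n + c) ^ 2) - 2 * (IZR n + c) * Im z).
Proof.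
  unfold theta_term. rewrite Cmod_Cexp. f_equal. destruct z as [x y]; simpl. ring.
Qed.

Lemma Cmod_theta_term_le (c L : R) (z : C) (n : Z) :
  Cmod (theta_term c L z n)
  <= exp (- (L * (IZR n + c) ^ 2) + 2 * Rabs (Im z) * Rabs (IZR n + c)).
Proof.
  rewrite Cmod_theta_term. apply exp_le.
  assert (H := Rle_abs (- ((IZR n + c) * Im z))).
  rewrite Rabs_Ropp, Rabs_mult in H. lra.
Qed.

Lemma theta_term_expdec (c L : R) (z : C) : 0 < L -> Cexpdec (theta_term c L z).
Proof.
  intros HL. eapply expdec_le_pos; [| apply (gauss_expdec c L (2 * Rabs (Im z)) HL)].
  intros n. split; [apply Cmod_ge_0 | apply Cmod_theta_term_le].
Qed.

Lemma dtheta_term_expdec (c L : R) (z : C) :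
  0 < L -> Cexpdec (fun n => RtoC (2 * (IZR n + c)) * Ci * theta_term c L z n)%C.
Proof.
  intros HL. apply (expdec_le_pos _ (fun n => 2 *
    exp (- (L * (IZR n + c) ^ 2) + (2 * Rabs (Im z) + 1) * Rabs (IZR n + c)))).
  - intros n. split; [apply Cmod_ge_0 |].
    rewrite !Cmod_mult, Cmod_Ci, Cmod_R, Rmult_1_r, Rabs_mult, (Rabs_pos_eq 2) by lra.
    rewrite Rmult_assoc. apply Rmult_le_compat_l; [lra |].
    replace (- (L * (IZR n + c) ^ 2) + (2 * Rabs (Im z) + 1) * Rabs (IZR n + c)) with
      (Rabs (IZR n + c) + (- (L * (IZR n + c) ^ 2) + 2 * Rabs (Im z) * Rabs (IZR n + c))) by ring.
    rewrite exp_plus. apply Rmult_le_compat; [apply Rabs_pos | apply Cmod_ge_0 | |].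
    + assert (H := exp_ge_1_plus (Rabs (IZR n + c))). lra.
    + apply Cmod_theta_term_le.
  - apply expdec_scal. now apply gauss_expdec.
Qed.

(** The parallelogram law: for n = j + i and m = j - i, (n + c)^2 + (m + d)^2 is twice the sum of
    the squares of j + (c + d) / 2 and i + (c - d) / 2, and the linear terms in x and y separate in
    the same way. Odd n + m gives the second product, with c replaced by c + 1. *)
Lemma theta_mult (c d L : R) (x y : C) :
  0 < L ->
  (theta c L (x + y) * theta d L (x - y) =
   theta ((c + d) / 2) (2 * L) (2 * x) * theta ((c - d) / 2) (2 * L) (2 * y) +
   theta ((c + d + 1) / 2) (2 * L) (2 * x) * theta ((c - d + 1) / 2) (2 * L) (2 * y))%C.
Proof.
  intros HL. assert (HL2 : 0 < 2 * L) by lra.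
  unfold theta. rewrite CZsum_sum_diff by now apply theta_term_expdec.
  f_equal.
  - rewrite <- CZsum_scal_r by now apply theta_term_expdec. apply CZsum_ext. intros j.
    rewrite <- CZsum_scal by now apply theta_term_expdec. apply CZsum_ext. intros i.
    unfold theta_term. rewrite <- !Cexp_plus. f_equal.
    rewrite plus_IZR, minus_IZR. destruct x as [x1 x2], y as [y1 y2].
    apply C_ext; simpl; field.
  - rewrite <- CZsum_scal_r by now apply theta_term_expdec. apply CZsum_ext. intros j.
    rewrite <- CZsum_scal by now apply theta_term_expdec. apply CZsum_ext. intros i.
    unfold theta_term. rewrite <- !Cexp_plus. f_equal.
    rewrite !plus_IZR, minus_IZR. destruct x as [x1 x2], y as [y1 y2].
    apply C_ext; simpl; field.
Qed.

Lemma theta_char_1 (c L : R) (z : C) : 0 < L -> theta (c + 1) L z = theta c L z.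
Proof.
  intros HL. unfold theta. rewrite <- (CZsum_shift (theta_term c L z) 1) by now apply theta_term_expdec.
  apply CZsum_ext. intros n. unfold theta_term. rewrite plus_IZR.
  replace (IZR n + (c + 1)) with (IZR n + 1 + c) by ring. reflexivity.
Qed.

Lemma theta_opp (c L : R) (z : C) : 0 < L -> theta (- c) L (- z)%C = theta c L z.
Proof.
  intros HL. unfold theta. rewrite <- (CZsum_opp (theta_term (- c) L (- z)%C)) by now apply theta_term_expdec.
  apply CZsum_ext. intros n. unfold theta_term. f_equal. rewrite opp_IZR.
  destruct z as [x y]. apply C_ext; simpl; ring.
Qed.

Lemma theta_conj (c L : R) (z : C) : 0 < L -> theta c L (- Cconj z)%C = Cconj (theta c L z).
Proof.
  intros HL. unfold theta.
  transitivity (CZsum (fun n => Cconj (theta_term c L z n))).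
  - apply CZsum_ext. intros n. unfold theta_term. rewrite <- Cexp_conj. f_equal.
    destruct z as [x y]. apply C_ext; simpl; ring.
  - apply C_ext; [reflexivity |].
    change (Zsum (fun n => - Im (theta_term c L z n)) = - Zsum (fun n => Im (theta_term c L z n))).
    replace (- Zsum (fun n => Im (theta_term c L z n)))
      with (-1 * Zsum (fun n => Im (theta_term c L z n))) by ring.
    rewrite <- Zsum_scal. apply Zsum_ext. intros n. ring.
Qed.

Lemma Cexp_2PI_int (n : Z) : Cexp (RtoC (2 * PI * IZR n) * Ci)%C = 1%C.
Proof.
  assert (H : forall k : nat, Cexp (RtoC (2 * PI * INR k) * Ci)%C = 1%C).
  { intros k. apply C_ext; unfold Cexp; simpl;
      (replace (2 * PI * INR k * 0 - 0 * 1) with 0 by ring); rewrite exp_0, Rmult_1_l;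
      (replace (2 * PI * INR k * 1 + 0 * 0) with (0 + 2 * INR k * PI) by ring).
    - rewrite cos_period. apply cos_0.
    - rewrite sin_period. apply sin_0. }
  destruct (Z.le_ge_cases 0 n) as [Hn|Hn].
  - specialize (H (Z.to_nat n)). now rewrite INR_IZR_INZ, Z2Nat.id in H.
  - specialize (H (Z.to_nat (- n))). rewrite INR_IZR_INZ, Z2Nat.id, opp_IZR in H by lia.
    assert (E : (Cexp (RtoC (2 * PI * IZR n) * Ci) * Cexp (RtoC (2 * PI * - IZR n) * Ci) = 1)%C).
    { rewrite <- Cexp_plus. rewrite <- Cexp_0. f_equal. apply C_ext; simpl; ring. }
    rewrite H, Cmult_1_r in E. exact E.
Qed.

Lemma theta_add_PI (c L : R) (z : C) :
  0 < L -> (theta c L (z + PI) = Cexp (RtoC (2 * PI * c) * Ci) * theta c L z)%C.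
Proof.
  intros HL. unfold theta. rewrite <- CZsum_scal by now apply theta_term_expdec.
  apply CZsum_ext. intros n. unfold theta_term.
  rewrite <- (Cmult_1_l (Cexp _ * _)%C), <- (Cexp_2PI_int n), <- !Cexp_plus. f_equal.
  destruct z as [x y]. apply C_ext; simpl; ring.
Qed.

(** On the imaginary axis every term of the series is a positive real number. *)
Lemma theta_imag_pos (c L y : R) :
  0 < L -> exists r, 0 < r /\ theta c L (Ci * y)%C = RtoC r.
Proof.
  intros HL. exists (Re (theta c L (Ci * y)%C)).
  assert (E : forall n, theta_term c L (Ci * y)%C n =
            RtoC (exp (- (L * (IZR n + c) ^ 2) - 2 * (IZR n + c) * y))).
  { intros n. unfold theta_term. rewrite <- Cexp_RtoC. f_equal. apply C_ext; simpl; ring. }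
  split.
  - change (0 < Zsum (fun n => Re (theta_term c L (Ci * y)%C n))).
    assert (Hd := Cexpdec_Re _ (theta_term_expdec c L (Ci * y)%C HL)).
    set (e := fun n => exp (- (L * (IZR n + c) ^ 2) - 2 * (IZR n + c) * y)) in *.
    assert (Ee : forall n, Re (theta_term c L (Ci * y)%C n) = e n) by (intros n; now rewrite E).
    rewrite (Zsum_ext _ e Ee). apply (expdec_ext _ e Ee) in Hd.
    assert (He : forall n, 0 < e n) by (intros n; apply exp_pos).
    unfold Zsum. rewrite Series_incr_1 by now apply expdec_ex_series.
    apply Rplus_lt_le_0_compat; [apply Rplus_lt_0_compat; apply He |].
    apply Series_nonneg.
    + intros n. assert (H1 := He (Z.of_nat (S n))). assert (H2 := He (- Z.of_nat (S n) - 1)%Z). lra.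
    + apply (ex_series_incr_1 (fun n => e (Z.of_nat n) + e (- Z.of_nat n - 1)%Z)).
      now apply expdec_ex_series.
  - apply C_ext; [reflexivity |].
    change (Zsum (fun n => Im (theta_term c L (Ci * y)%C n)) = 0).
    apply Series_eq_0. intros n. rewrite !E. simpl. ring.
Qed.

(** A quadratic remainder is what the termwise Taylor bound supplies. It survives products and
    affine substitutions with explicit constants, and it restricts to real derivatives along every
    line. *)
Definition Cder (f : C -> C) (z l : C) : Prop :=
  exists M d, 0 <= M /\ 0 < d /\ forall h, Cmod h <= d ->
    Cmod (f (z + h) - f z - h * l)%C <= M * Cmod h ^ 2.

Lemma theta_Cder (c L : R) (z : C) : 0 < L -> Cder (theta c L) z (dtheta c L z).
Proof.
  intros HL.
  (* With t = n + c and |h| <= 1, the remainder 4 |w|^2 exp |w| for |w| = 2 |t| |h| and the bound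
     t^2 <= 4 exp |t| give 64 |h|^2 exp(3 |t|); this explains both 64 and the extra 3 in the
     exponent. *)
  set (g := fun n : Z => 64 * exp (- (L * (IZR n + c) ^ 2) + (2 * Rabs (Im z) + 3) * Rabs (IZR n + c))).
  assert (Hg : expdec g) by (apply expdec_scal; now apply gauss_expdec).
  assert (Hg0 : forall n, 0 <= g n) by (intros n; unfold g; apply Rmult_le_pos; [lra | left; apply exp_pos]).
  exists (2 * Zsum g), 1. split; [| split; [lra |]].
  { apply Rmult_le_pos; [lra |]. rewrite <- (Rmult_0_l (Zsum g)), <- Zsum_scal.
    apply Zsum_le; [| now apply expdec_scal | exact Hg]. intros n. rewrite Rmult_0_l. apply Hg0. }
  intros h Hh.
  assert (E : (theta c L (z + h) - theta c L z - h * dtheta c L z)%C =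
    CZsum (fun n => theta_term c L z n *
      (Cexp (RtoC (2 * (IZR n + c)) * (Ci * h)) - 1 - RtoC (2 * (IZR n + c)) * (Ci * h)))%C).
  { replace (theta c L (z + h) - theta c L z - h * dtheta c L z)%C with
      (theta c L (z + h) + ((-1) * theta c L z + (- h) * dtheta c L z))%C by ring.
    unfold theta, dtheta.
    rewrite <- !CZsum_scal by (try apply dtheta_term_expdec; try apply theta_term_expdec; exact HL).
    rewrite <- CZsum_plus by (apply Cexpdec_scal; try apply dtheta_term_expdec; try apply theta_term_expdec; exact HL).
    rewrite <- CZsum_plus.
    - apply CZsum_ext. intros n.
      assert (Et : theta_term c L (z + h) n =
        (theta_term c L z n * Cexp (RtoC (2 * (IZR n + c)) * (Ci * h)))%C).
      { unfold theta_term. rewrite <- Cexp_plus. f_equal. ring. }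
      rewrite Et. ring.
    - now apply theta_term_expdec.
    - apply Cexpdec_plus; apply Cexpdec_scal; [now apply theta_term_expdec | now apply dtheta_term_expdec]. }
  rewrite E.
  replace (2 * Zsum g * Cmod h ^ 2) with (2 * Zsum (fun n => Cmod h ^ 2 * g n)) by (rewrite Zsum_scal; ring).
  apply CZsum_bound; [| now apply expdec_scal].
  intros n. rewrite Cmod_mult. set (t := IZR n + c).
  set (w := (RtoC (2 * t) * (Ci * h))%C).
  assert (Hw : Cmod w = 2 * Rabs t * Cmod h).
  { unfold w. rewrite !Cmod_mult, Cmod_Ci, Cmod_R, Rabs_mult, (Rabs_pos_eq 2) by lra. ring. }
  assert (Hh0 := Cmod_ge_0 h). assert (Ht0 := Rabs_pos t).
  assert (T1 := Cmod_theta_term_le c L z n). fold t in T1.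
  assert (T2 := Cexp_taylor1 w).
  assert (T3 : exp (Cmod w) <= exp (2 * Rabs t)) by (apply exp_le; rewrite Hw; nra).
  assert (T4 : Rabs t ^ 2 <= 4 * exp (Rabs t)).
  { assert (H := exp_ge_1_plus (Rabs t / 2)). assert (E2 : exp (Rabs t) = exp (Rabs t / 2) * exp (Rabs t / 2)).
    { rewrite <- exp_plus. f_equal. field. }
    rewrite E2. nra. }
  assert (T5 : Cmod (Cexp w - 1 - w)%C <= Cmod h ^ 2 * (64 * exp (3 * Rabs t))).
  { eapply Rle_trans; [apply T2 |].
    replace (3 * Rabs t) with (Rabs t + 2 * Rabs t) by ring. rewrite exp_plus.
    replace (4 * Cmod w ^ 2) with (Cmod h ^ 2 * (16 * Rabs t ^ 2)) by (rewrite Hw; ring).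
    rewrite Rmult_assoc. apply Rmult_le_compat_l; [apply pow2_ge_0 |].
    replace (64 * (exp (Rabs t) * exp (2 * Rabs t))) with ((16 * (4 * exp (Rabs t))) * exp (2 * Rabs t)) by ring.
    apply Rmult_le_compat; [| left; apply exp_pos | | exact T3].
    - apply Rmult_le_pos; [lra | apply pow2_ge_0].
    - apply Rmult_le_compat_l; lra. }
  unfold g. fold t.
  replace (Cmod h ^ 2 * (64 * exp (- (L * t ^ 2) + (2 * Rabs (Im z) + 3) * Rabs t))) with
    (exp (- (L * t ^ 2) + 2 * Rabs (Im z) * Rabs t) * (Cmod h ^ 2 * (64 * exp (3 * Rabs t)))).
  2: { replace (- (L * t ^ 2) + (2 * Rabs (Im z) + 3) * Rabs t) with
       (- (L * t ^ 2) + 2 * Rabs (Im z) * Rabs t + 3 * Rabs t) by ring.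
       rewrite (exp_plus (_ + _) (3 * _)). ring. }
  apply Rmult_le_compat; try apply Cmod_ge_0; assumption.
Qed.

(** Stated for a general normed module because it is applied over the complex numbers and also to
    real and imaginary parts over the reals. *)
Lemma is_derive_quadratic {K : AbsRing} {V : NormedModule K} (f : K -> V) (x : K) (l : V) (M d : R) :
  0 <= M -> 0 < d ->
  (forall y, abs (minus y x) <= d ->
     norm (minus (minus (f y) (f x)) (scal (minus y x) l)) <= M * abs (minus y x) ^ 2) ->
  is_derive f x l.
Proof.
  intros HM Hd0 H. split; [apply is_linear_scal_l |].
  intros x' Hx. apply (@is_filter_lim_locally_unique K (AbsRing_NormedModule K)) in Hx.
  rewrite <- Hx. clear x' Hx. intros eps. assert (He := cond_pos eps).
  assert (Hd : 0 < Rmin d (eps / (M + 1))).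
  { apply Rmin_pos; [exact Hd0 |]. apply Rdiv_lt_0_compat; lra. }
  exists (mkposreal _ Hd). intros y Hy. change (abs (minus y x) < Rmin d (eps / (M + 1))) in Hy.
  change (norm (minus y x)) with (abs (minus y x)).
  assert (H1 := Rmin_l d (eps / (M + 1))). assert (H2 := Rmin_r d (eps / (M + 1))).
  assert (H0 := abs_ge_0 (minus y x)).
  eapply Rle_trans; [apply H; lra |]. simpl. rewrite Rmult_1_r, <- Rmult_assoc.
  apply Rmult_le_compat_r; [exact H0 |].
  apply Rle_trans with (M * (eps / (M + 1))); [apply Rmult_le_compat_l; lra |].
  apply Rmult_le_reg_r with (M + 1); [lra |].
  replace (M * (eps / (M + 1)) * (M + 1)) with (M * eps) by (field; lra). lra.
Qed.

Lemma Cder_is_derive (f : C -> C) (z l : C) : Cder f z l -> is_derive f z l.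
Proof.
  intros (M & d & HM & Hd & H). apply (is_derive_quadratic f z l M d HM Hd). intros y Hy.
  assert (Ey : forall a b : C, (a + (b - a))%C = b) by (intros; ring).
  specialize (H (y - z)%C Hy). rewrite Ey in H. exact H.
Qed.

Lemma Cder_along (f : C -> C) (z v l : C) (t : R) :
  Cmod v = 1 -> Cder f (z + t * v)%C l ->
  is_derive (fun s : R => Re (f (z + s * v)%C)) t (Re (v * l)%C) /\
  is_derive (fun s : R => Im (f (z + s * v)%C)) t (Im (v * l)%C).
Proof.
  intros Hv (M & d & HM & Hd & H).
  assert (K : forall h : R, Rabs h <= d ->
    Cmod (f (z + RtoC (t + h) * v) - f (z + RtoC t * v) - RtoC h * (v * l))%C <= M * h ^ 2).
  { intros h Hh. specialize (H (RtoC h * v)%C).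
    rewrite Cmod_mult, Cmod_R, Hv, Rmult_1_r in H. specialize (H Hh).
    rewrite pow2_abs in H. rewrite RtoC_plus.
    replace (z + (t + h) * v)%C with (z + t * v + h * v)%C by ring.
    replace (h * (v * l))%C with (h * v * l)%C by ring. exact H. }
  split; apply (is_derive_quadratic (K := R_AbsRing) (V := R_NormedModule)) with M d; try assumption;
    intros s Hs; specialize (K (s - t) Hs); rewrite Rplus_minus, <- pow2_abs in K;
    (eapply Rle_trans; [| exact K]);
    generalize (f (z + RtoC s * v)%C) (f (z + RtoC t * v)%C) (v * l)%C;
    intros [a1 a2] [b1 b2] [e1 e2].
  - eapply Rle_trans; [| apply re_le_Cmod]. right. change norm with Rabs. f_equal.
    change minus with Rminus. change scal with Rmult. simpl. ring.
  - eapply Rle_trans; [| apply Im_le_Cmod]. right. change norm with Rabs. f_equal.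
    change minus with Rminus. change scal with Rmult. simpl. ring.
Qed.

Lemma Cder_unique (f : C -> C) (z l l' : C) : Cder f z l -> Cder f z l' -> l = l'.
Proof.
  intros H H'. apply Cder_is_derive, is_C_derive_unique in H.
  apply Cder_is_derive, is_C_derive_unique in H'. congruence.
Qed.

Lemma Cder_ext (f g : C -> C) (z l l' : C) :
  (forall x, f x = g x) -> l = l' -> Cder f z l -> Cder g z l'.
Proof.
  intros E <- (M & d & HM & Hd & H). exists M, d. repeat split; try assumption.
  intros h Hh. rewrite <- !E. now apply H.
Qed.

Lemma Cder_const (a z : C) : Cder (fun _ => a) z 0%C.
Proof.
  exists 0, 1. repeat split; try lra. intros h _.
  replace (a - a - h * 0)%C with (RtoC 0) by ring. rewrite Cmod_0. lra.
Qed.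

Lemma Cder_plus (f g : C -> C) (z l m : C) :
  Cder f z l -> Cder g z m -> Cder (fun x => f x + g x)%C z (l + m)%C.
Proof.
  intros (M & d & HM & Hd & H) (N & e & HN & He & H').
  exists (M + N), (Rmin d e). repeat split; [lra | now apply Rmin_pos |].
  intros h Hh. assert (Hm1 := Rmin_l d e). assert (Hm2 := Rmin_r d e).
  specialize (H h ltac:(lra)). specialize (H' h ltac:(lra)).
  replace (f (z + h) + g (z + h) - (f z + g z) - h * (l + m))%C with
    ((f (z + h) - f z - h * l) + (g (z + h) - g z - h * m))%C by ring.
  eapply Rle_trans; [apply Cmod_triangle |]. lra.
Qed.

Lemma Cder_mult (f g : C -> C) (z l m : C) :
  Cder f z l -> Cder g z m -> Cder (fun x => f x * g x)%C z (l * g z + f z * m)%C.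
Proof.
  intros (M & d & HM & Hd & H) (N & e & HN & He & H').
  exists (M * (Cmod (g z) + Cmod m + N) + (Cmod (f z) + Cmod l) * N + Cmod l * Cmod m),
    (Rmin 1 (Rmin d e)).
  assert (P1 := Cmod_ge_0 (g z)). assert (P2 := Cmod_ge_0 m).
  assert (P3 := Cmod_ge_0 (f z)). assert (P4 := Cmod_ge_0 l).
  split; [| split].
  - repeat apply Rplus_le_le_0_compat; apply Rmult_le_pos; lra.
  - apply Rmin_pos; [lra | now apply Rmin_pos].
  - intros h Hh.
    assert (Hm1 := Rmin_l d e). assert (Hm2 := Rmin_r d e).
    assert (Hm3 := Rmin_l 1 (Rmin d e)). assert (Hm4 := Rmin_r 1 (Rmin d e)).
    specialize (H h ltac:(lra)). specialize (H' h ltac:(lra)).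
    set (u := (f (z + h) - f z - h * l)%C) in *. set (v := (g (z + h) - g z - h * m)%C) in *.
    replace (f (z + h) * g (z + h) - f z * g z - h * (l * g z + f z * m))%C with
      (u * (g z + h * m + v) + (f z + h * l) * v + (h * l) * (h * m))%C by (unfold u, v; ring).
    assert (H0 := Cmod_ge_0 h). set (t := Cmod h) in *.
    assert (Ht2 : t ^ 2 <= 1) by nra.
    assert (B1 : Cmod (g z + h * m + v)%C <= Cmod (g z) + Cmod m + N).
    { eapply Rle_trans; [apply Cmod_triangle |]. apply Rplus_le_compat; [| nra].
      eapply Rle_trans; [apply Cmod_triangle |]. rewrite Cmod_mult. fold t. nra. }
    assert (B2 : Cmod (f z + h * l)%C <= Cmod (f z) + Cmod l).
    { eapply Rle_trans; [apply Cmod_triangle |]. rewrite Cmod_mult. fold t. nra. }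
    eapply Rle_trans; [apply Cmod_triangle |].
    eapply Rle_trans; [apply Rplus_le_compat_r, Cmod_triangle |].
    rewrite !Cmod_mult. fold t.
    assert (Q1 : Cmod u * Cmod (g z + h * m + v)%C <= M * t ^ 2 * (Cmod (g z) + Cmod m + N)).
    { apply Rmult_le_compat; try apply Cmod_ge_0; assumption. }
    assert (Q2 : Cmod (f z + h * l)%C * Cmod v <= (Cmod (f z) + Cmod l) * (N * t ^ 2)).
    { apply Rmult_le_compat; try apply Cmod_ge_0; assumption. }
    lra.
Qed.

Lemma Cder_affine (f : C -> C) (a b z l : C) :
  Cder f (a + b * z)%C l -> Cder (fun x => f (a + b * x)%C) z (b * l)%C.
Proof.
  intros (M & d & HM & Hd & H).
  assert (Hb := Cmod_ge_0 b).
  exists (M * Cmod b ^ 2), (d / (Cmod b + 1)). split; [| split].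
  - apply Rmult_le_pos; [exact HM | apply pow2_ge_0].
  - apply Rdiv_lt_0_compat; lra.
  - intros h Hh. specialize (H (b * h)%C). rewrite Cmod_mult in H.
    assert (H0 := Cmod_ge_0 h).
    assert (Hbh : Cmod b * Cmod h <= d).
    { apply Rle_trans with ((Cmod b + 1) * (d / (Cmod b + 1))).
      - apply Rmult_le_compat; lra.
      - right. field. lra. }
    specialize (H Hbh).
    replace (a + b * (z + h))%C with (a + b * z + b * h)%C by ring.
    replace (h * (b * l))%C with (b * h * l)%C by ring.
    rewrite Rmult_assoc, <- Rpow_mult_distr. exact H.
Qed.

(** Jacobi's functions theta_1 to theta_4 with nome exp(-L). The minus sign gives [th1] the
    customary sine series with positive leading coefficient. *)
Definition th1 (L : R) (z : C) : C := (- theta (1 / 2) L (z + RtoC (PI / 2)))%C.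
Definition th2 (L : R) (z : C) : C := theta (1 / 2) L z.
Definition th3 (L : R) (z : C) : C := theta 0 L z.
Definition th4 (L : R) (z : C) : C := theta 0 L (z + RtoC (PI / 2))%C.

(** * Product formulas and quadratic identities *)

Lemma theta_eq (c c' L : R) (z z' : C) : c = c' -> z = z' -> theta c L z = theta c' L z'.
Proof. now intros -> ->. Qed.

Lemma theta_mult_eq (c d L : R) (x y z w z' w' : C) (a b a' b' : R) :
  0 < L -> z = (x + y)%C -> w = (x - y)%C -> z' = (2 * x)%C -> w' = (2 * y)%C ->
  a = (c + d) / 2 -> b = (c - d) / 2 -> a' = (c + d + 1) / 2 -> b' = (c - d + 1) / 2 ->
  (theta c L z * theta d L w =
   theta a (2 * L) z' * theta b (2 * L) w' + theta a' (2 * L) z' * theta b' (2 * L) w')%C.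
Proof. intros HL -> -> -> -> -> -> -> ->. now apply theta_mult. Qed.

Ltac ceq := first [assumption | reflexivity | apply C_ext; simpl; field | field].

Lemma Cexp_Ci (c : R) : Cexp (RtoC c * Ci)%C = (cos c, sin c).
Proof.
  apply C_ext; unfold Cexp; simpl;
  (replace (c * 0 - 0 * 1) with 0 by ring); rewrite exp_0, Rmult_1_l; f_equal; ring.
Qed.

Lemma theta_0_PI (L : R) (z : C) : 0 < L -> theta 0 L (z + PI)%C = theta 0 L z.
Proof.
  intros HL. rewrite theta_add_PI, Cexp_Ci by exact HL.
  rewrite Rmult_0_r, cos_0, sin_0. change (1, 0) with (RtoC 1). ring.
Qed.

Lemma theta_half_PI (L : R) (z : C) : 0 < L -> theta (1 / 2) L (z + PI)%C = (- theta (1 / 2) L z)%C.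
Proof.
  intros HL. rewrite theta_add_PI, Cexp_Ci by exact HL.
  replace (2 * PI * (1 / 2)) with PI by field.
  rewrite cos_PI, sin_PI. change (-1, 0) with (RtoC (-1)).
  replace (RtoC (-1)) with (- (1))%C by (apply C_ext; simpl; ring). ring.
Qed.

Lemma theta_quarter_PI (L : R) (z : C) :
  0 < L -> theta (1 / 4) L (z + PI)%C = (Ci * theta (1 / 4) L z)%C.
Proof.
  intros HL. rewrite theta_add_PI, Cexp_Ci by exact HL.
  replace (2 * PI * (1 / 4)) with (PI / 2) by field.
  now rewrite cos_PI2, sin_PI2.
Qed.

Lemma theta_3quarter (L : R) (z : C) : 0 < L -> theta (3 / 4) L z = theta (1 / 4) L (- z)%C.
Proof.
  intros HL. rewrite <- (theta_opp (1 / 4)), <- (theta_char_1 (- (1 / 4))) by exact HL.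
  apply theta_eq; [field | ring].
Qed.

(** In this formula and its three companions the right side is bilinear in the values of [th2],
    [th3] at 2x and at 2y for the parameter 2L. Quadratic identities between theta functions thereby
    become polynomial identities. *)
Lemma th3_mult (L : R) (x y : C) : 0 < L ->
  (th3 L (x + y) * th3 L (x - y) =
   th3 (2 * L) (2 * x) * th3 (2 * L) (2 * y) + th2 (2 * L) (2 * x) * th2 (2 * L) (2 * y))%C.
Proof.
  intros HL. unfold th3, th2. apply (theta_mult_eq 0 0 L x y); try exact HL; try reflexivity; field.
Qed.

Lemma th4_mult (L : R) (x y : C) : 0 < L ->
  (th4 L (x + y) * th4 L (x - y) =
   th3 (2 * L) (2 * x) * th3 (2 * L) (2 * y) - th2 (2 * L) (2 * x) * th2 (2 * L) (2 * y))%C.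
Proof.
  intros HL. unfold th4, th3, th2.
  rewrite (theta_mult_eq 0 0 L (x + RtoC (PI / 2)) y _ _ (2 * x + PI) (2 * y) 0 0 (1 / 2) (1 / 2))%C by ceq.
  rewrite theta_0_PI, theta_half_PI by lra. ring.
Qed.

Lemma theta_1 (L : R) (z : C) : 0 < L -> theta 1 L z = theta 0 L z.
Proof. intros HL. rewrite <- (theta_char_1 0) by exact HL. apply theta_eq; [ring | reflexivity]. Qed.

Lemma th2_mult (L : R) (x y : C) : 0 < L ->
  (th2 L (x + y) * th2 L (x - y) =
   th2 (2 * L) (2 * x) * th3 (2 * L) (2 * y) + th3 (2 * L) (2 * x) * th2 (2 * L) (2 * y))%C.
Proof.
  intros HL. unfold th3, th2.
  rewrite (theta_mult_eq (1 / 2) (1 / 2) L x y _ _ (2 * x) (2 * y) (1 / 2) 0 1 (1 / 2))%C by ceq.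
  now rewrite (theta_1 (2 * L) (2 * x)%C) by lra.
Qed.

Lemma th1_mult (L : R) (x y : C) : 0 < L ->
  (th1 L (x + y) * th1 L (x - y) =
   th3 (2 * L) (2 * x) * th2 (2 * L) (2 * y) - th2 (2 * L) (2 * x) * th3 (2 * L) (2 * y))%C.
Proof.
  intros HL. unfold th1, th3, th2.
  match goal with |- (- ?a * - ?b = _)%C => replace (- a * - b)%C with (a * b)%C by ring end.
  rewrite (theta_mult_eq (1 / 2) (1 / 2) L (x + RtoC (PI / 2)) y _ _ (2 * x + PI) (2 * y) (1 / 2) 0 1 (1 / 2))%C by ceq.
  rewrite theta_1, theta_0_PI, theta_half_PI by lra. ring.
Qed.

(** Evenness and antiperiodicity under PI make this value equal to its own negative. *)
Lemma theta_half_PI2 (L : R) : 0 < L -> theta (1 / 2) L (RtoC (PI / 2)) = 0%C.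
Proof.
  intros HL.
  assert (H := theta_half_PI L (- RtoC (PI / 2))%C HL).
  rewrite <- (theta_opp (1 / 2) L (- RtoC (PI / 2))%C) in H by exact HL.
  rewrite <- (theta_char_1 (- (1 / 2))) in H by exact HL.
  rewrite (theta_eq (1 / 2) (1 / 2) L (- RtoC (PI / 2) + PI)%C (RtoC (PI / 2))) in H by ceq.
  rewrite (theta_eq (- (1 / 2) + 1) (1 / 2) L (- - RtoC (PI / 2))%C (RtoC (PI / 2))) in H by first [ring | field].
  assert (E : forall a : C, a = (- a)%C -> a = 0%C).
  { intros [a1 a2] Ha. injection Ha. intros. apply C_ext; simpl; lra. }
  now apply E.
Qed.

Lemma th1_0 (L : R) : 0 < L -> th1 L 0%C = 0%C.
Proof.
  intros HL. unfold th1. rewrite Cplus_0_l, theta_half_PI2 by exact HL. ring.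
Qed.

(** Landen's transformation: in the product formula at x + PI / 4 and PI / 4 the second summand
    contains theta of characteristic 1/2 at PI / 2, which is 0. The same choice proves [th1_th2]. *)
Lemma th3_th4 (L : R) (x : C) : 0 < L ->
  (th3 L x * th4 L x = th4 (2 * L) (2 * x) * th4 (2 * L) 0)%C.
Proof.
  intros HL. unfold th3, th4.
  rewrite Cmult_comm.
  rewrite (theta_mult_eq 0 0 L (x + RtoC (PI / 4)) (RtoC (PI / 4)) _ _
    (2 * x + RtoC (PI / 2)) (0 + RtoC (PI / 2)) 0 0 (1 / 2) (1 / 2))%C by ceq.
  rewrite Cplus_0_l, (theta_half_PI2 (2 * L)) by lra. ring.
Qed.

Lemma th1_th2 (L : R) (x : C) : 0 < L ->
  (th1 L x * th2 L x = th1 (2 * L) (2 * x) * th4 (2 * L) 0)%C.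
Proof.
  intros HL. unfold th1, th2, th4.
  match goal with |- (- ?a * ?b = - ?c * ?d)%C =>
    replace (- a * b)%C with (- (a * b))%C by ring; replace (- c * d)%C with (- (c * d))%C by ring end.
  f_equal.
  rewrite (theta_mult_eq (1 / 2) (1 / 2) L (x + RtoC (PI / 4)) (RtoC (PI / 4)) _ _
    (2 * x + RtoC (PI / 2)) (0 + RtoC (PI / 2)) (1 / 2) 0 1 (1 / 2))%C by ceq.
  rewrite !Cplus_0_l, (theta_half_PI2 (2 * L)) by lra. ring.
Qed.

(** Every square is a product formula with second argument 0; after expansion both sides are the
    same polynomial in values of [th2] and [th3] for the parameter 2L. *)
Lemma th1_addition (L : R) (x y : C) : 0 < L ->
  (th1 L (x + y) * th1 L (x - y) * th4 L 0 ^ 2 =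
   th1 L x ^ 2 * th4 L y ^ 2 - th4 L x ^ 2 * th1 L y ^ 2)%C.
Proof.
  intros HL.
  assert (S1 := th1_mult L x 0 HL). assert (S2 := th1_mult L y 0 HL).
  assert (S3 := th4_mult L x 0 HL). assert (S4 := th4_mult L y 0 HL).
  assert (S5 := th4_mult L 0 0 HL).
  assert (E1 : forall z : C, (z + 0)%C = z) by (intros; ring).
  assert (E2 : forall z : C, (z - 0)%C = z) by (intros; ring).
  rewrite ?E1, ?E2, ?Cmult_0_r in S1, S2, S3, S4, S5.
  assert (Sq : forall z : C, (z ^ 2 = z * z)%C) by (intros; simpl; ring).
  rewrite !Sq, S1, S2, S3, S4, S5, th1_mult by exact HL. ring.
Qed.

(** Divided by th4(x)^2 and a constant these become sn^2 + cn^2 = 1 and dn^2 + k^2 sn^2 = 1. *)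
Lemma th_squares (L : R) (x : C) : 0 < L ->
  (th4 L x ^ 2 * th2 L 0 ^ 2 = th1 L x ^ 2 * th3 L 0 ^ 2 + th2 L x ^ 2 * th4 L 0 ^ 2)%C /\
  (th4 L x ^ 2 * th3 L 0 ^ 2 = th1 L x ^ 2 * th2 L 0 ^ 2 + th3 L x ^ 2 * th4 L 0 ^ 2)%C.
Proof.
  intros HL.
  assert (S1 := th1_mult L x 0 HL). assert (S2 := th2_mult L x 0 HL).
  assert (S3 := th3_mult L x 0 HL). assert (S4 := th4_mult L x 0 HL).
  assert (Z2 := th2_mult L 0 0 HL). assert (Z3 := th3_mult L 0 0 HL). assert (Z4 := th4_mult L 0 0 HL).
  assert (E1 : forall z : C, (z + 0)%C = z) by (intros; ring).
  assert (E2 : forall z : C, (z - 0)%C = z) by (intros; ring).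
  rewrite ?E1, ?E2, ?Cmult_0_r in S1, S2, S3, S4, Z2, Z3, Z4.
  assert (Sq : forall z : C, (z ^ 2 = z * z)%C) by (intros; simpl; ring).
  rewrite !Sq, S1, S2, S3, S4, Z2, Z3, Z4. split; ring.
Qed.

(** The relation k^2 + k'^2 = 1 for modulus and complementary modulus. *)
Lemma th_0_quartic (L : R) : 0 < L -> (th3 L 0 ^ 4 = th2 L 0 ^ 4 + th4 L 0 ^ 4)%C.
Proof.
  intros HL.
  assert (Z2 := th2_mult L 0 0 HL). assert (Z3 := th3_mult L 0 0 HL). assert (Z4 := th4_mult L 0 0 HL).
  assert (E1 : forall z : C, (z + 0)%C = z) by (intros; ring).
  assert (E2 : forall z : C, (z - 0)%C = z) by (intros; ring).
  rewrite ?E1, ?E2, ?Cmult_0_r in Z2, Z3, Z4.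
  assert (Sq : forall z : C, (z ^ 4 = (z * z) * (z * z))%C) by (intros; simpl; ring).
  rewrite !Sq, Z2, Z3, Z4. ring.
Qed.

(** * Derivatives and Wronskians of theta functions *)

Definition dth1 (L : R) (z : C) : C := (- dtheta (1 / 2) L (z + RtoC (PI / 2)))%C.
Definition dth2 (L : R) (z : C) : C := dtheta (1 / 2) L z.
Definition dth4 (L : R) (z : C) : C := dtheta 0 L (z + RtoC (PI / 2))%C.

Lemma Cder_shift (f : C -> C) (a z l : C) : Cder f (z + a)%C l -> Cder (fun x => f (x + a)%C) z l.
Proof.
  intros H.
  apply (Cder_ext (fun x => f (a + 1 * x)%C) _ _ (1 * l)%C).
  - intros x. f_equal. ring.
  - ring.
  - apply Cder_affine. now replace (a + 1 * z)%C with (z + a)%C by ring.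
Qed.

Lemma th1_Cder (L : R) (z : C) : 0 < L -> Cder (th1 L) z (dth1 L z).
Proof.
  intros HL.
  apply (Cder_ext (fun x => (-1) * theta (1 / 2) L (x + RtoC (PI / 2)))%C _ _
     (0 * theta (1 / 2) L (z + RtoC (PI / 2)) + (-1) * dtheta (1 / 2) L (z + RtoC (PI / 2)))%C).
  - intros x. unfold th1. ring.
  - unfold dth1. ring.
  - apply (Cder_mult (fun _ => RtoC (-1)) (fun x => theta (1 / 2) L (x + RtoC (PI / 2)))%C);
      [apply Cder_const |].
    exact (Cder_shift (theta (1 / 2) L) (RtoC (PI / 2)) z _ (theta_Cder (1 / 2) L _ HL)).
Qed.

Lemma th2_Cder (L : R) (z : C) : 0 < L -> Cder (th2 L) z (dth2 L z).
Proof. apply theta_Cder. Qed.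

Lemma th4_Cder (L : R) (z : C) : 0 < L -> Cder (th4 L) z (dth4 L z).
Proof.
  intros HL. exact (Cder_shift (theta 0 L) (RtoC (PI / 2)) z _ (theta_Cder 0 L _ HL)).
Qed.

(* Both Wronskians below come from factorisations [f (x + y) g (x - y) = u p(y) + v p(-y)]
   (up to units): the derivative in [y] at [0] is proportional to a value at [0] of a
   product of the same shape. *)
Lemma Cder_product_sum_diff (f g p : C -> C) (f' g' : C -> C) (p' u v x : C) :
  (forall z, Cder f z (f' z)) -> (forall z, Cder g z (g' z)) -> Cder p 0 p' ->
  (forall y, f (x + y) * g (x - y) = u * p y + v * p (- y))%C ->
  (f' x * g x - f x * g' x = (u - v) * p')%C.
Proof.
  intros Hf Hg Hp E.
  assert (E1 : forall y, (x + y = x + 1 * y)%C) by (intros; ring).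
  assert (E2 : forall y, (x - y = x + (-1) * y)%C) by (intros; ring).
  assert (E3 : forall y, (- y = 0 + (-1) * y)%C) by (intros; ring).
  assert (D1 := Cder_mult _ _ 0%C _ _ (Cder_affine f x 1 0 _ (Hf _)) (Cder_affine g x (-1) 0 _ (Hg _))).
  assert (Hp' : Cder (fun y => p (0 + (-1) * y)%C) 0 ((-1) * p')%C).
  { apply Cder_affine. now replace (0 + -1 * 0)%C with (RtoC 0) by ring. }
  assert (D2 := Cder_plus _ _ 0%C _ _ (Cder_mult _ _ 0%C _ _ (Cder_const u 0) Hp)
                                   (Cder_mult _ _ 0%C _ _ (Cder_const v 0) Hp')).
  apply (Cder_ext _ (fun y => f (x + y) * g (x - y))%C _ _ _) with (2 := eq_refl) in D1.
  2: { intros y. now rewrite (E1 y), (E2 y). }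
  apply (Cder_ext _ (fun y => f (x + y) * g (x - y))%C _ _ _) with (2 := eq_refl) in D2.
  2: { intros y. now rewrite E, (E3 y). }
  assert (U := Cder_unique _ _ _ _ D1 D2). cbv beta in U.
  replace (x + 1 * 0)%C with x in U by ring.
  replace (x + -1 * 0)%C with x in U by ring.
  transitivity (1 * f' x * g x + f x * (-1 * g' x))%C; [ring |]. rewrite U.
  replace (RtoC (-1)) with (- (1))%C by (apply C_ext; simpl; ring). ring.
Qed.

(** The source of sn' = cn dn. Both th1 th4 and th2 th3 split through the same function P of
    characteristic 1/4, and both the Wronskian and th2 th3 at x are constant multiples of P(x) +
    P(-x). The constant is found at x = 0, where [th1] vanishes. *)
Lemma th1_th4_wronskian (L : R) (x : C) : 0 < L ->
  ((dth1 L x * th4 L x - th1 L x * dth4 L x) * (th2 L 0 * th3 L 0) =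
   dth1 L 0 * th4 L 0 * (th2 L x * th3 L x))%C.
Proof.
  intros HL. assert (HL2 : 0 < 2 * L) by lra.
  set (P := fun y : C => theta (1 / 4) (2 * L) (0 + 2 * y)%C).
  assert (HP : Cder P 0 (2 * dtheta (1 / 4) (2 * L) (0 + 2 * 0))%C).
  { apply Cder_affine. now apply theta_Cder. }
  set (P' := (2 * dtheta (1 / 4) (2 * L) (0 + 2 * 0))%C) in HP.
  assert (E14 : forall x y, (th1 L (x + y) * th4 L (x - y) = (- Ci * P x) * P y + (Ci * P (- x)) * P (- y))%C).
  { intros a b. unfold th1, th4.
    match goal with |- (- ?a * ?b = _)%C => replace (- a * b)%C with (- (a * b))%C by ring end.
    rewrite (theta_mult_eq (1 / 2) 0 L (a + RtoC (PI / 2)) b _ _ (2 * a + PI) (2 * b) (1 / 4) (1 / 4) (3 / 4) (3 / 4))%C by ceq.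
    rewrite !theta_3quarter by exact HL2. unfold P.
    rewrite theta_quarter_PI by exact HL2.
    assert (E := theta_quarter_PI (2 * L) (- (2 * a + PI))%C HL2).
    replace (- (2 * a + PI) + PI)%C with (0 + 2 * - a)%C in E by ring.
    rewrite E.
    replace (- (2 * b))%C with (0 + 2 * - b)%C by ring.
    replace (0 + 2 * a)%C with (2 * a)%C by ring. replace (0 + 2 * b)%C with (2 * b)%C by ring.
    set (t := theta (1 / 4) (2 * L) (- (2 * a + PI))%C).
    replace (Ci * (Ci * t))%C with (- t)%C.
    - ring.
    - rewrite Cmult_assoc. replace (Ci * Ci)%C with (- (1))%C by (apply C_ext; simpl; ring). ring. }
  assert (E23 : forall x y, (th2 L (x + y) * th3 L (x - y) = P x * P y + P (- x) * P (- y))%C).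
  { intros a b. unfold th2, th3.
    rewrite (theta_mult_eq (1 / 2) 0 L a b _ _ (2 * a) (2 * b) (1 / 4) (1 / 4) (3 / 4) (3 / 4))%C by ceq.
    rewrite !theta_3quarter by exact HL2. unfold P.
    replace (- (2 * b))%C with (0 + 2 * - b)%C by ring.
    replace (- (2 * a))%C with (0 + 2 * - a)%C by ring.
    replace (0 + 2 * a)%C with (2 * a)%C by ring. now replace (0 + 2 * b)%C with (2 * b)%C by ring. }
  assert (W := fun x => Cder_product_sum_diff _ _ P (dth1 L) (dth4 L) P' _ _ x
     (fun z => th1_Cder L z HL) (fun z => th4_Cder L z HL) HP (E14 x)).
  assert (V := fun x => E23 x 0%C).
  assert (E0 : (- 0 = 0)%C) by ring.
  assert (W0 := W 0%C). rewrite th1_0 in W0 by exact HL. rewrite E0 in W0.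
  assert (Ep : forall z : C, (z + 0)%C = z) by (intros; ring).
  assert (Em : forall z : C, (z - 0)%C = z) by (intros; ring).
  assert (Vx := V x). assert (V0 := V 0%C). rewrite ?Ep, ?Em, ?E0 in Vx, V0.
  rewrite W, Vx, V0.
  replace (dth1 L 0 * th4 L 0)%C with (dth1 L 0 * th4 L 0 - 0 * dth4 L 0)%C by ring.
  rewrite W0. ring.
Qed.

(** * Trigonometric series in the form used by [Theta] and [Eta] *)

Lemma CZsum_symm (f : Z -> C) :
  Cexpdec f -> CZsum f = (f 0%Z + CSeries (fun n => f (Z.of_nat (S n)) + f (- Z.of_nat (S n))%Z))%C.
Proof.
  intros Hf. apply C_ext.
  - exact (Zsum_symm _ (Cexpdec_Re f Hf)).
  - exact (Zsum_symm _ (Cexpdec_Im f Hf)).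
Qed.

Lemma CSeries_ext (a b : nat -> C) : (forall n, a n = b n) -> CSeries a = CSeries b.
Proof. intros H. unfold CSeries. f_equal; apply Series_ext; intros n; now rewrite H. Qed.

Lemma CSeries_scal_R (c : R) (a : nat -> C) : CSeries (fun n => RtoC c * a n)%C = (RtoC c * CSeries a)%C.
Proof.
  apply C_ext; rewrite ?Re_mult, ?Im_mult; simpl.
  - rewrite Rmult_0_l, Rminus_0_r, <- Series_scal_l. apply Series_ext. intros n. destruct (a n); simpl; ring.
  - rewrite Rmult_0_l, Rplus_0_r, <- Series_scal_l. apply Series_ext. intros n. destruct (a n); simpl; ring.
Qed.

Lemma Cexp_INR_PI (n : nat) : Cexp (RtoC (INR n * PI) * Ci)%C = RtoC ((-1) ^ n).
Proof.
  induction n as [|n IH].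
  - simpl. rewrite Rmult_0_l, Cmult_0_l. apply Cexp_0.
  - rewrite S_INR. replace (RtoC ((INR n + 1) * PI) * Ci)%C with (RtoC (INR n * PI) * Ci + RtoC PI * Ci)%C
      by (apply C_ext; simpl; ring).
    rewrite Cexp_plus, IH, Cexp_Ci, cos_PI, sin_PI. simpl. apply C_ext; simpl; ring.
Qed.

Lemma Cexp_opp_INR_PI (n : nat) : Cexp (- (RtoC (INR n * PI) * Ci))%C = RtoC ((-1) ^ n).
Proof.
  replace (- (RtoC (INR n * PI) * Ci))%C with (Cconj (RtoC (INR n * PI) * Ci)) by (apply C_ext; simpl; ring).
  rewrite Cexp_conj, Cexp_INR_PI. apply C_ext; simpl; ring.
Qed.

Lemma exp_opp_pow (L : R) (n : nat) : exp (- L) ^ n = exp (- (L * INR n)).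
Proof.
  induction n as [|n IH].
  - simpl. now rewrite Rmult_0_r, Ropp_0, exp_0.
  - rewrite S_INR. simpl pow. rewrite IH, <- exp_plus. f_equal. ring.
Qed.

Lemma th4_series (L : R) (z : C) : 0 < L ->
  th4 L z = (1 + 2 * CSeries (fun m => RtoC ((-1) ^ S m * exp (- L) ^ (S m * S m))
                                       * Ccos (RtoC (2 * INR (S m)) * z)))%C.
Proof.
  intros HL. unfold th4, theta. rewrite CZsum_symm by now apply theta_term_expdec.
  f_equal.
  - unfold theta_term. rewrite <- Cexp_0. f_equal. apply C_ext; simpl; ring.
  - rewrite <- CSeries_scal_R. apply CSeries_ext. intros m.
    set (n := S m). unfold theta_term. rewrite opp_IZR, <- INR_IZR_INZ.
    rewrite exp_opp_pow, mult_INR, (RtoC_mult ((-1) ^ n)), <- Cexp_RtoC. unfold Ccos.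
    replace (RtoC (- (L * (INR n + 0) ^ 2)) + RtoC (2 * (INR n + 0)) * (Ci * (z + RtoC (PI / 2))))%C with
      (RtoC (INR n * PI) * Ci + (RtoC (- (L * (INR n * INR n))) + Ci * (RtoC (2 * INR n) * z)))%C
      by (destruct z; apply C_ext; simpl; field).
    replace (RtoC (- (L * (- INR n + 0) ^ 2)) + RtoC (2 * (- INR n + 0)) * (Ci * (z + RtoC (PI / 2))))%C with
      (- (RtoC (INR n * PI) * Ci) + (RtoC (- (L * (INR n * INR n))) + - (Ci * (RtoC (2 * INR n) * z))))%C
      by (destruct z; apply C_ext; simpl; field).
    rewrite !Cexp_plus, Cexp_INR_PI, Cexp_opp_INR_PI. field.
Qed.

Lemma Rpower_exp_opp (L x : R) : Rpower (exp (- L)) x = exp (- (L * x)).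
Proof. unfold Rpower. rewrite ln_exp. f_equal. ring. Qed.

Lemma th1_series (L : R) (z : C) : 0 < L ->
  th1 L z = (2 * CSeries (fun n => RtoC ((-1) ^ n * Rpower (exp (- L)) ((INR n + 1 / 2) ^ 2))
                                   * Csin (RtoC (2 * INR n + 1) * z)))%C.
Proof.
  intros HL. unfold th1, theta.
  rewrite <- CSeries_scal_R.
  transitivity (RtoC (-1) * CZsum (theta_term (1 / 2) L (z + RtoC (PI / 2))%C))%C; [ring |].
  change (CZsum (theta_term (1 / 2) L (z + RtoC (PI / 2))%C)) with
    (CSeries (fun n => theta_term (1 / 2) L (z + RtoC (PI / 2))%C (Z.of_nat n) +
                       theta_term (1 / 2) L (z + RtoC (PI / 2))%C (- Z.of_nat n - 1)%Z)%C).
  rewrite <- CSeries_scal_R. apply CSeries_ext. intros n.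
  unfold theta_term. rewrite minus_IZR, opp_IZR, <- INR_IZR_INZ.
  rewrite Rpower_exp_opp, (RtoC_mult ((-1) ^ n)), <- Cexp_RtoC. unfold Csin.
  replace (RtoC (- (L * (INR n + 1 / 2) ^ 2)) + RtoC (2 * (INR n + 1 / 2)) * (Ci * (z + RtoC (PI / 2))))%C with
    (RtoC (PI / 2) * Ci + (RtoC (INR n * PI) * Ci +
      (RtoC (- (L * (INR n + 1 / 2) ^ 2)) + Ci * (RtoC (2 * INR n + 1) * z))))%C
    by (destruct z; apply C_ext; simpl; field).
  replace (RtoC (- (L * (- INR n - 1 + 1 / 2) ^ 2)) + RtoC (2 * (- INR n - 1 + 1 / 2)) * (Ci * (z + RtoC (PI / 2))))%C with
    (RtoC (- (PI / 2)) * Ci + (- (RtoC (INR n * PI) * Ci) +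
      (RtoC (- (L * (INR n + 1 / 2) ^ 2)) + - (Ci * (RtoC (2 * INR n + 1) * z)))))%C
    by (destruct z; apply C_ext; simpl; field).
  rewrite !Cexp_plus, Cexp_INR_PI, Cexp_opp_INR_PI, !Cexp_Ci.
  rewrite cos_neg, sin_neg, cos_PI2, sin_PI2.
  change (0, 1) with Ci. replace (0, -(1)) with (- Ci)%C by (apply C_ext; simpl; ring).
  set (a := RtoC ((-1) ^ n)). set (b := Cexp (RtoC (- (L * (INR n + 1 / 2) ^ 2)))).
  set (e1 := Cexp (Ci * (RtoC (2 * INR n + 1) * z))%C).
  set (e2 := Cexp (- (Ci * (RtoC (2 * INR n + 1) * z)))%C).
  transitivity (a * b * (e1 - e2) * - Ci)%C; [ring |].
  replace (- Ci)%C with (/ Ci)%C by (apply C_ext; simpl; field).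
  field. intros H; injection H; lra.
Qed.

Lemma Cmult_cancel_l (a b c : C) : a <> 0%C -> (a * b = a * c)%C -> b = c.
Proof.
  intros Ha H. replace b with (/ a * (a * b))%C by (now field). rewrite H. now field.
Qed.

Lemma th1_PI2 (L : R) : 0 < L -> th1 L (RtoC (PI / 2)) = th2 L 0.
Proof.
  intros HL. unfold th1, th2.
  rewrite (theta_eq (1 / 2) (1 / 2) L (RtoC (PI / 2) + RtoC (PI / 2))%C (0 + PI)%C) by ceq.
  rewrite theta_half_PI by exact HL. ring.
Qed.

Lemma th4_PI2 (L : R) (x : C) : 0 < L -> th4 L (x + RtoC (PI / 2)) = th3 L x.
Proof.
  intros HL. unfold th4, th3. rewrite <- (theta_0_PI L x) by exact HL. apply theta_eq; ceq.
Qed.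

(** The source of cn' = - sn dn, by the same argument with arguments moved by PI / 4: the Wronskian
    and th1 th3 are both multiples of r(x) - r(-x). The nonvanishing of th4(0), which makes r(0)
    nonzero, is a hypothesis because zeros are located only later. *)
Lemma th2_th4_wronskian (L : R) (x : C) : 0 < L -> th4 L 0 <> 0%C ->
  ((dth2 L x * th4 L x - th2 L x * dth4 L x) * (th2 L 0 * th4 L 0) =
   - (dth1 L 0 * th3 L 0) * (th1 L x * th3 L x))%C.
Proof.
  intros HL H40. assert (HL2 : 0 < 2 * L) by lra.
  set (r := fun y : C => theta (1 / 4) (2 * L) (RtoC (PI / 2) + 2 * y)%C).
  assert (Hr : Cder r 0 (2 * dtheta (1 / 4) (2 * L) (RtoC (PI / 2) + 2 * 0))%C).
  { apply Cder_affine. now apply theta_Cder. }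
  set (r' := (2 * dtheta (1 / 4) (2 * L) (RtoC (PI / 2) + 2 * 0))%C) in Hr.
  assert (ECi : forall t, (Ci * (Ci * t) = - t)%C).
  { intros t. rewrite Cmult_assoc. replace (Ci * Ci)%C with (- (1))%C by (apply C_ext; simpl; ring). ring. }
  assert (Em : forall y, theta (1 / 4) (2 * L) (2 * y - RtoC (PI / 2))%C = (- Ci * r y)%C).
  { intros y. unfold r. assert (E := theta_quarter_PI (2 * L) (2 * y - RtoC (PI / 2))%C HL2).
    rewrite (theta_eq (1 / 4) (1 / 4) (2 * L) (2 * y - RtoC (PI / 2) + PI)%C (RtoC (PI / 2) + 2 * y)%C) in E by ceq.
    rewrite E.
    match goal with |- ?a = (- Ci * (Ci * ?t))%C => transitivity (- (Ci * (Ci * t)))%C end; [rewrite ECi; ring | ring]. }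
  assert (E24 : forall x y, (th2 L (x + y) * th4 L (x - y) = (- Ci * r x) * r y + (- Ci * r (- x)) * r (- y))%C).
  { intros a b. unfold th2, th4.
    rewrite (theta_mult_eq (1 / 2) 0 L (a + RtoC (PI / 4)) (b - RtoC (PI / 4)) _ _
      (RtoC (PI / 2) + 2 * a) (2 * b - RtoC (PI / 2)) (1 / 4) (1 / 4) (3 / 4) (3 / 4))%C by ceq.
    rewrite !theta_3quarter by exact HL2.
    replace (- (2 * b - RtoC (PI / 2)))%C with (RtoC (PI / 2) + 2 * - b)%C by ring.
    replace (- (RtoC (PI / 2) + 2 * a))%C with (2 * - a - RtoC (PI / 2))%C by ring.
    rewrite !Em. unfold r. ring. }
  assert (E13 : forall x y, (th1 L (x + y) * th3 L (x - y) = (- r x) * r y + r (- x) * r (- y))%C).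
  { intros a b. unfold th1, th3.
    match goal with |- (- ?a * ?b = _)%C => replace (- a * b)%C with (- (a * b))%C by ring end.
    rewrite (theta_mult_eq (1 / 2) 0 L (a + RtoC (PI / 4)) (b + RtoC (PI / 4)) _ _
      (RtoC (PI / 2) + 2 * a) (RtoC (PI / 2) + 2 * b) (1 / 4) (1 / 4) (3 / 4) (3 / 4))%C by ceq.
    rewrite !theta_3quarter by exact HL2.
    replace (- (RtoC (PI / 2) + 2 * b))%C with (2 * - b - RtoC (PI / 2))%C by ring.
    replace (- (RtoC (PI / 2) + 2 * a))%C with (2 * - a - RtoC (PI / 2))%C by ring.
    rewrite !Em.
    transitivity (- (r a * r b + (- (r (- a)%C * r (- b)%C))))%C; [| ring].
    f_equal. f_equal.
    transitivity (Ci * (Ci * (r (- a) * r (- b))))%C; [ring | apply ECi]. }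
  assert (W := fun x => Cder_product_sum_diff _ _ r (dth2 L) (dth4 L) r' _ _ x
     (fun z => th2_Cder L z HL) (fun z => th4_Cder L z HL) Hr (E24 x)).
  assert (V := fun x => E13 x 0%C).
  assert (E0 : (- 0 = 0)%C) by ring.
  assert (Ep : forall z : C, (z + 0)%C = z) by (intros; ring).
  assert (Emn : forall z : C, (z - 0)%C = z) by (intros; ring).
  assert (V' : forall x, (th1 L x * th3 L x = (- r x + r (- x)) * r 0)%C).
  { intros a. specialize (V a). rewrite ?Ep, ?Emn, ?E0 in V. rewrite V. ring. }
  (* At PI / 2 the function [th2] vanishes, so the Wronskian is explicit there and fixes the
     constant. *)
  set (p := RtoC (PI / 2)).
  assert (T1 : th1 L p = th2 L 0) by now apply th1_PI2.
  assert (T3 : th3 L p = th4 L 0) by (unfold th3, th4; now rewrite Cplus_0_l).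
  assert (T4 : th4 L p = th3 L 0) by (rewrite <- (Cplus_0_l p); now apply th4_PI2).
  assert (T2 : th2 L p = 0%C) by now apply theta_half_PI2.
  assert (D2 : dth2 L p = (- dth1 L 0)%C) by (unfold dth2, dth1; rewrite Cplus_0_l; fold p; ring).
  assert (Vp := V' p). assert (Wp := W p).
  rewrite T1, T3 in Vp. rewrite D2, T4, T2 in Wp.
  assert (H2 : th2 L 0 <> 0%C).
  { destruct (theta_imag_pos (1 / 2) L 0 HL) as (t & Ht & E). rewrite Cmult_0_r in E.
    unfold th2. rewrite E. intros H. injection H. lra. }
  assert (Hr0 : r 0%C <> 0%C).
  { intros H. rewrite H, Cmult_0_r in Vp. apply (Cmult_neq_0 _ _ H2 H40). exact Vp. }
  apply (Cmult_cancel_l (r 0%C)); [exact Hr0 |].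
  transitivity ((- Ci * r x - - Ci * r (- x)) * r' * (r 0 * (th2 L 0 * th4 L 0)))%C.
  { rewrite W. ring. }
  rewrite V'.
  transitivity ((- dth1 L 0 * th3 L 0 - 0 * dth4 L p) * r 0 * ((- r x + r (- x)) * r 0))%C; [| ring].
  rewrite Wp, Vp. ring.
Qed.

(** * Parity, conjugation and values on the axes *)

Lemma theta_0_opp (L : R) (z : C) : 0 < L -> theta 0 L (- z)%C = theta 0 L z.
Proof. intros HL. rewrite <- (theta_opp 0 L z) by exact HL. now rewrite Ropp_0. Qed.

Lemma theta_half_opp (L : R) (z : C) : 0 < L -> theta (1 / 2) L (- z)%C = theta (1 / 2) L z.
Proof.
  intros HL. rewrite <- (theta_opp (1 / 2) L z) by exact HL.
  rewrite <- (theta_char_1 (- (1 / 2))) by exact HL. apply theta_eq; [field | reflexivity].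
Qed.

Lemma th4_opp (L : R) (z : C) : 0 < L -> th4 L (- z)%C = th4 L z.
Proof.
  intros HL. unfold th4. rewrite <- theta_0_opp by exact HL.
  rewrite <- theta_0_PI by exact HL. apply theta_eq; [reflexivity | destruct z; ceq].
Qed.

Lemma th1_opp (L : R) (z : C) : 0 < L -> th1 L (- z)%C = (- th1 L z)%C.
Proof.
  intros HL. unfold th1. f_equal.
  assert (H := theta_half_PI L (- (- z + RtoC (PI / 2)))%C HL).
  rewrite theta_half_opp in H by exact HL.
  rewrite (theta_eq (1 / 2) (1 / 2) L (z + RtoC (PI / 2))%C (- (- z + RtoC (PI / 2)) + PI)%C)
    by (destruct z; ceq).
  rewrite H. ring.
Qed.

Lemma theta_0_Cconj (L : R) (z : C) : 0 < L -> theta 0 L (Cconj z) = Cconj (theta 0 L z).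
Proof. intros HL. rewrite <- theta_conj by exact HL. now rewrite theta_0_opp. Qed.

Lemma theta_half_Cconj (L : R) (z : C) : 0 < L -> theta (1 / 2) L (Cconj z) = Cconj (theta (1 / 2) L z).
Proof. intros HL. rewrite <- theta_conj by exact HL. now rewrite theta_half_opp. Qed.

Lemma th4_Cconj (L : R) (z : C) : 0 < L -> th4 L (Cconj z) = Cconj (th4 L z).
Proof.
  intros HL. unfold th4. rewrite <- theta_0_Cconj by exact HL.
  apply theta_eq; [reflexivity | destruct z; ceq].
Qed.

Lemma th1_Cconj (L : R) (z : C) : 0 < L -> th1 L (Cconj z) = Cconj (th1 L z).
Proof.
  intros HL. unfold th1. rewrite Copp_conj, <- theta_half_Cconj by exact HL. f_equal.
  apply theta_eq; [reflexivity | destruct z; ceq].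
Qed.

Lemma Cconj_fixed (z : C) : Cconj z = z -> z = RtoC (Re z).
Proof. destruct z as [a b]. intros H. injection H. intros. apply C_ext; simpl; lra. Qed.

Lemma Cconj_opposed (z : C) : Cconj z = (- z)%C -> z = (Ci * RtoC (Im z))%C.
Proof. destruct z as [a b]. intros H. injection H. intros. apply C_ext; simpl; lra. Qed.

Lemma Cconj_RtoC (x : R) : Cconj (RtoC x) = RtoC x.
Proof. apply C_ext; simpl; ring. Qed.

Lemma Cconj_Ci_mult (y : R) : Cconj (Ci * RtoC y)%C = (- (Ci * RtoC y))%C.
Proof. apply C_ext; simpl; ring. Qed.

Lemma th1_real (L x : R) : 0 < L -> th1 L (RtoC x) = RtoC (Re (th1 L (RtoC x))).
Proof. intros HL. apply Cconj_fixed. now rewrite <- th1_Cconj, Cconj_RtoC. Qed.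

Lemma th2_real (L x : R) : 0 < L -> th2 L (RtoC x) = RtoC (Re (th2 L (RtoC x))).
Proof. intros HL. apply Cconj_fixed. unfold th2. now rewrite <- theta_half_Cconj, Cconj_RtoC. Qed.

Lemma th3_real (L x : R) : 0 < L -> th3 L (RtoC x) = RtoC (Re (th3 L (RtoC x))).
Proof. intros HL. apply Cconj_fixed. unfold th3. now rewrite <- theta_0_Cconj, Cconj_RtoC. Qed.

Lemma th4_real (L x : R) : 0 < L -> th4 L (RtoC x) = RtoC (Re (th4 L (RtoC x))).
Proof. intros HL. apply Cconj_fixed. now rewrite <- th4_Cconj, Cconj_RtoC. Qed.

Lemma th1_imag (L y : R) : 0 < L -> th1 L (Ci * RtoC y)%C = (Ci * RtoC (Im (th1 L (Ci * RtoC y))))%C.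
Proof. intros HL. apply Cconj_opposed. now rewrite <- th1_Cconj, Cconj_Ci_mult, th1_opp. Qed.

Lemma th4_imag (L y : R) : 0 < L -> th4 L (Ci * RtoC y)%C = RtoC (Re (th4 L (Ci * RtoC y)%C)).
Proof. intros HL. apply Cconj_fixed. now rewrite <- th4_Cconj, Cconj_Ci_mult, th4_opp. Qed.

Lemma theta_imag_neq_0 (c L y : R) : 0 < L -> theta c L (Ci * RtoC y)%C <> 0%C.
Proof.
  intros HL H. destruct (theta_imag_pos c L y HL) as (r & Hr & E).
  rewrite H in E. injection E. lra.
Qed.

Lemma th2_0_neq_0 (L : R) : 0 < L -> th2 L 0 <> 0%C.
Proof.
  intros HL H. apply (theta_imag_neq_0 (1 / 2) L 0 HL). now rewrite Cmult_0_r.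
Qed.

(** * Zeros of the theta functions *)

Lemma CSeries_bound (a : nat -> C) (M r : R) :
  0 < r < 1 -> (forall n, Cmod (a n) <= M * r ^ n) -> Cmod (CSeries a) <= 2 * (M / (1 - r)).
Proof.
  intros Hr H. eapply Rle_trans; [apply Cmod_le_Re_Im |].
  replace (2 * (M / (1 - r))) with (M / (1 - r) + M / (1 - r)) by ring.
  apply Rplus_le_compat; simpl; apply Series_bound_geom; try exact Hr; intros n;
    (eapply Rle_trans; [| apply H]); [apply re_le_Cmod | apply Im_le_Cmod].
Qed.

(** The terms of index n and -n have modulus at most exp(- L n^2 + 2 r L n), and n <= n^2 bounds
    this by Q^n. The factor 4 counts the two signs and the two components of a complex number. *)
Lemma th4_sub_1_bound (L r : R) (z : C) :
  0 < L -> 0 <= r < 1 / 2 -> Rabs (Im z) <= r * L ->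
  Cmod (th4 L z - 1)%C <= 4 * (exp (- ((1 - 2 * r) * L)) / (1 - exp (- ((1 - 2 * r) * L)))).
Proof.
  intros HL Hr Hz. set (Q := exp (- ((1 - 2 * r) * L))).
  assert (HQ : 0 < Q < 1).
  { split; [apply exp_pos |]. apply Rlt_le_trans with (exp 0); [| rewrite exp_0; lra]. apply exp_increasing.
    assert (0 < (1 - 2 * r) * L) by (apply Rmult_lt_0_compat; lra). lra. }
  unfold th4, theta. rewrite CZsum_symm by now apply theta_term_expdec.
  replace (theta_term 0 L (z + RtoC (PI / 2))%C 0%Z) with (RtoC 1)
    by (unfold theta_term; rewrite <- Cexp_0; f_equal; apply C_ext; simpl; ring).
  assert (Ec : forall w : C, (1 + w - 1)%C = w) by (intros; ring). rewrite Ec.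
  replace (4 * (Q / (1 - Q))) with (2 * ((2 * Q) / (1 - Q))) by (field; lra).
  apply CSeries_bound; [exact HQ |]. intros n.
  eapply Rle_trans; [apply Cmod_triangle |].
  replace (2 * Q * Q ^ n) with (Q ^ S n + Q ^ S n) by (simpl; ring).
  assert (Hn : 1 <= INR (S n)) by (rewrite S_INR; assert (H := pos_INR n); lra).
  assert (EQ : Q ^ S n = exp (- ((1 - 2 * r) * L * INR (S n)))) by apply exp_opp_pow.
  assert (Hi : Rabs (Im (z + RtoC (PI / 2))%C) <= r * L).
  { destruct z as [z1 z2]. simpl in *. now rewrite Rplus_0_r. }
  apply Rabs_le_between in Hi.
  assert (H1 : L * INR (S n) <= L * INR (S n) ^ 2) by (apply Rmult_le_compat_l; [lra | nra]).
  apply Rplus_le_compat; rewrite EQ, Cmod_theta_term; apply exp_le;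
    rewrite ?opp_IZR, <- INR_IZR_INZ; nra.
Qed.

(** The strip is measured by the ratio r because r is unchanged when z and L are both doubled. The
    product formula [th3_th4] then passes a zero on to 2L, at 2z or at 0, both in the strip. *)
Lemma th4_neq_0 (L r : R) (z : C) :
  0 < L -> 0 <= r < 1 / 2 -> Rabs (Im z) <= r * L -> th4 L z <> 0%C.
Proof.
  intros HL Hr.
  (* Once (1 - 2r) L exceeds 4, Q is below 1/5 and 4 Q / (1 - Q) < 1, so th4 stays within distance
     less than 1 of 1. *)
  assert (Hn : exists n : nat, 4 < 2 ^ n * (L * (1 - 2 * r))).
  { destruct (Pow_x_infinity 2 ltac:(rewrite Rabs_pos_eq; lra) (4 / (L * (1 - 2 * r)) + 1)) as [n Hn].
    exists n. specialize (Hn n (le_n n)). rewrite Rabs_pos_eq in Hn by (apply pow_le; lra).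
    assert (Hp : 0 < L * (1 - 2 * r)) by (apply Rmult_lt_0_compat; lra).
    apply Rmult_lt_reg_r with (/ (L * (1 - 2 * r))); [now apply Rinv_0_lt_compat |].
    rewrite Rmult_assoc, Rinv_r by lra. unfold Rdiv in Hn. lra. }
  destruct Hn as [n Hn]. revert L z HL Hn. induction n as [|n IH]; intros L z HL Hn Hz H.
  - assert (B := th4_sub_1_bound L r z HL Hr Hz). rewrite H in B.
    replace (0 - 1)%C with (- (1))%C in B by ring. rewrite Cmod_m1 in B.
    simpl in Hn. rewrite Rmult_1_l in Hn.
    set (Q := exp (- ((1 - 2 * r) * L))) in *.
    assert (HQ : 5 * Q < 1).
    { assert (E := exp_ge_1_plus ((1 - 2 * r) * L)).
      assert (E' : exp ((1 - 2 * r) * L) * Q = 1).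
      { unfold Q. rewrite <- exp_plus, <- exp_0. f_equal. ring. }
      assert (0 < Q) by apply exp_pos. nra. }
    assert (0 < Q) by apply exp_pos.
    assert (4 * (Q / (1 - Q)) < 1).
    { apply Rmult_lt_reg_r with (1 - Q); [lra |].
      replace (4 * (Q / (1 - Q)) * (1 - Q)) with (4 * Q) by (field; lra). lra. }
    lra.
  - assert (E := th3_th4 L z HL). rewrite H, Cmult_0_r in E. symmetry in E. revert E.
    simpl in Hn. apply Cmult_neq_0; apply IH; try lra.
    + destruct z as [z1 z2]. simpl in *. replace (2 * z2 + 0 * z1) with (2 * z2) by ring.
      rewrite Rabs_mult, (Rabs_pos_eq 2); lra.
    + simpl. rewrite Rabs_R0. apply Rmult_le_pos; lra.
Qed.

Lemma th4_real_neq_0 (L x : R) : 0 < L -> th4 L (RtoC x) <> 0%C.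
Proof.
  intros HL. apply (th4_neq_0 L 0); try lra. simpl. rewrite Rabs_R0. lra.
Qed.

Lemma th1_PI_minus (L : R) (z : C) : 0 < L -> th1 L (PI - z)%C = th1 L z.
Proof.
  intros HL. replace (PI - z)%C with (- (z - PI))%C by ring. rewrite th1_opp by exact HL.
  unfold th1. rewrite <- (theta_half_PI L (z - PI + RtoC (PI / 2))%C) by exact HL.
  f_equal. replace (z - PI + RtoC (PI / 2) + PI)%C with (z + RtoC (PI / 2))%C by ring.
  ring.
Qed.

Lemma sin_mult_abs_le (n : nat) (x : R) : Rabs (sin (INR n * x)) <= INR n * Rabs (sin x).
Proof.
  induction n as [|n IH].
  - simpl. rewrite Rmult_0_l, sin_0, Rabs_R0. lra.
  - rewrite S_INR. replace ((INR n + 1) * x) with (INR n * x + x) by ring.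
    rewrite sin_plus. eapply Rle_trans; [apply Rabs_triang |]. rewrite !Rabs_mult.
    assert (H1 : Rabs (cos x) <= 1) by (apply Rabs_le, COS_bound).
    assert (H2 : Rabs (cos (INR n * x)) <= 1) by (apply Rabs_le, COS_bound).
    assert (P1 := Rabs_pos (sin (INR n * x))). assert (P2 := Rabs_pos (sin x)). nra.
Qed.

Lemma Csin_RtoC (x : R) : Csin (RtoC x) = RtoC (sin x).
Proof.
  unfold Csin. replace (Ci * RtoC x)%C with (RtoC x * Ci)%C by ring.
  replace (- (RtoC x * Ci))%C with (RtoC (- x) * Ci)%C by (apply C_ext; simpl; ring).
  rewrite !Cexp_Ci, cos_neg, sin_neg.
  replace ((cos x, sin x) - (cos x, (- sin x)%R))%C with (2 * Ci * RtoC (sin x))%C by (apply C_ext; simpl; ring).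
  field. intros H; injection H; lra.
Qed.

(** The first term dominates. The bound |sin((2n + 1) x)| <= 3^n sin x keeps the factor sin x in
    every term, so the comparison does not degrade near 0 and PI; the exponents satisfy (n + 1/2)^2
    >= 1/4 + 2n for n >= 1. The tail is geometric of ratio 3Q, and L >= 3 gives 6Q < 1. *)
Lemma th1_neq_0_large (L x : R) : 3 <= L -> 0 < x < PI -> th1 L (RtoC x) <> 0%C.
Proof.
  intros HL Hx H.
  set (a := fun n => (-1) ^ n * exp (- (L * (INR n + 1 / 2) ^ 2)) * sin ((2 * INR n + 1) * x)).
  assert (E : Series a = 0).
  { rewrite th1_series in H by lra.
    apply (f_equal Re) in H. rewrite Re_mult in H.
    change (2 * Series (fun n => Re (RtoC ((-1) ^ n * Rpower (exp (- L)) ((INR n + 1 / 2) ^ 2))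
         * Csin (RtoC (2 * INR n + 1) * RtoC x))%C) - 0 *
         Series (fun n => Im (RtoC ((-1) ^ n * Rpower (exp (- L)) ((INR n + 1 / 2) ^ 2))
         * Csin (RtoC (2 * INR n + 1) * RtoC x))%C) = 0) in H.
    rewrite Rmult_0_l, Rminus_0_r in H.
    replace (Series a) with (2 * Series a / 2) by field. rewrite <- (Rmult_0_l (/ 2)).
    unfold Rdiv. f_equal. rewrite <- H. f_equal. apply Series_ext. intros n. unfold a.
    rewrite <- RtoC_mult, Csin_RtoC, Rpower_exp_opp. simpl. ring. }
  assert (Hs : 0 < sin x) by (apply sin_gt_0; lra).
  set (Q := exp (- (2 * L))).
  assert (HQ : 0 < Q) by apply exp_pos.
  assert (HQ6 : 6 * Q < 1).
  { assert (E1 := exp_ge_1_plus (2 * L)).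
    assert (E' : exp (2 * L) * Q = 1).
    { unfold Q. rewrite <- exp_plus, <- exp_0. f_equal. ring. }
    nra. }
  set (e := exp (- (L / 4))). assert (He : 0 < e) by apply exp_pos.
  assert (B : forall n, Rabs (a (S n)) <= (e * sin x * (3 * Q)) * (3 * Q) ^ n).
  { intros n. unfold a. rewrite !Rabs_mult, pow_1_abs, Rmult_1_l, (Rabs_pos_eq (exp _)) by (left; apply exp_pos).
    assert (B1 : Rabs (sin ((2 * INR (S n) + 1) * x)) <= 3 ^ S n * sin x).
    { replace (2 * INR (S n) + 1) with (INR (2 * S n + 1)) by (rewrite plus_INR, mult_INR; simpl; ring).
      eapply Rle_trans; [apply sin_mult_abs_le |]. rewrite (Rabs_pos_eq (sin x)) by lra.
      apply Rmult_le_compat_r; [lra |].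
      clear. induction n as [|n IH]; [simpl; lra |].
      replace (2 * S (S n) + 1)%nat with (2 * S n + 1 + 2)%nat by lia. rewrite plus_INR.
      replace (3 ^ S (S n)) with (3 ^ S n + 2 * 3 ^ S n) by (simpl; ring).
      assert (1 <= 3 ^ S n) by (apply pow_R1_Rle; lra). simpl INR at 2. lra. }
    assert (B2 : exp (- (L * (INR (S n) + 1 / 2) ^ 2)) <= e * Q ^ S n).
    { unfold e, Q. rewrite exp_opp_pow, <- exp_plus. apply exp_le.
      rewrite S_INR. assert (Hn := pos_INR n). nra. }
    replace (e * sin x * (3 * Q) * (3 * Q) ^ n) with ((e * Q ^ S n) * (3 ^ S n * sin x)).
    2: { rewrite Rpow_mult_distr. simpl. ring. }
    apply Rmult_le_compat; try assumption; [left; apply exp_pos | apply Rabs_pos]. }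
  assert (Hex : ex_series a).
  { apply ex_series_incr_1. apply (ex_series_dom _ _ (3 * Q) ltac:(lra) B). }
  rewrite Series_incr_1 in E by exact Hex.
  assert (B' := Series_bound_geom _ _ (3 * Q) ltac:(lra) B).
  assert (E0 : a 0%nat = e * sin x).
  { unfold a, e. simpl. rewrite Rmult_1_l. f_equal; f_equal; field. }
  rewrite E0 in E. assert (Hes : 0 < e * sin x) by now apply Rmult_lt_0_compat.
  apply Rabs_le_between in B'.
  assert (e * sin x * (3 * Q) / (1 - 3 * Q) < e * sin x).
  { apply Rmult_lt_reg_r with (1 - 3 * Q); [lra |].
    replace (e * sin x * (3 * Q) / (1 - 3 * Q) * (1 - 3 * Q)) with (e * sin x * (3 * Q)) by (field; lra).
    nra. }
  lra.
Qed.

(** Doubling maps (0, PI / 2) into (0, PI), where the induction hypothesis for 2L applies. The other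
    half is its reflection, and the midpoint value is th2(0). *)
Lemma th1_neq_0 (L x : R) : 0 < L -> 0 < x < PI -> th1 L (RtoC x) <> 0%C.
Proof.
  intros HL.
  assert (Hn : exists n : nat, 3 <= 2 ^ n * L).
  { destruct (Pow_x_infinity 2 ltac:(rewrite Rabs_pos_eq; lra) (3 / L)) as [n Hn].
    exists n. specialize (Hn n (le_n n)). rewrite Rabs_pos_eq in Hn by (apply pow_le; lra).
    apply Rmult_le_reg_r with (/ L); [now apply Rinv_0_lt_compat |].
    rewrite Rmult_assoc, Rinv_r by lra. unfold Rdiv in Hn. lra. }
  destruct Hn as [n Hn]. revert L x HL Hn. induction n as [|n IH]; intros L x HL Hn Hx.
  - apply th1_neq_0_large; [simpl in Hn; lra | exact Hx].
  - assert (Hlt : forall y, 0 < y < PI / 2 -> th1 L (RtoC y) <> 0%C).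
    { intros y Hy H. assert (E := th1_th2 L y HL). rewrite H, Cmult_0_l in E.
      symmetry in E. revert E. apply Cmult_neq_0.
      - rewrite <- RtoC_mult. simpl in Hn. apply IH; lra.
      - apply (th4_real_neq_0 (2 * L) 0). lra. }
    destruct (Rtotal_order x (PI / 2)) as [H|[H|H]].
    + apply Hlt. lra.
    + rewrite H, th1_PI2 by exact HL. now apply th2_0_neq_0.
    + rewrite <- th1_PI_minus, <- RtoC_minus by exact HL. apply Hlt. lra.
Qed.

(** * Elliptic integrals and the amplitude *)

Ltac rewrite_Derive D :=
  match type of D with is_derive ?f ?x ?l => rewrite (is_derive_unique (fun t : R => f t) x l D) end.

Lemma is_derive_zero_const (f : R -> R) :
  (forall x, is_derive f x 0) -> forall x y, f x = f y.
Proof.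
  intros H.
  assert (K : forall x y, x < y -> f x = f y).
  { intros x y Hxy. apply (eq_is_derive f x y); [| exact Hxy]. intros t _. apply H. }
  intros x y. destruct (Rtotal_order x y) as [Hl|[->|Hg]]; [now apply K | reflexivity |].
  symmetry. now apply K.
Qed.

Lemma positive_of_nonvanishing (f : R -> R) (b : R) :
  (forall x, continuous f x) -> 0 < f 0 -> (forall x, 0 <= x <= b -> f x <> 0) ->
  forall x, 0 <= x <= b -> 0 < f x.
Proof.
  intros Hc H0 Hn x Hx. destruct (Rlt_dec 0 (f x)) as [H|H]; [exact H | exfalso].
  destruct (IVT_cor f 0 x) as (z & Hz & Ez).
  - intros t. apply continuity_pt_filterlim. apply Hc.
  - lra.
  - assert (f x <= 0) by lra. nra.
  - apply (Hn z); [lra | exact Ez].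
Qed.

(** The interval is half open on the right because the sine-like functions to which this is applied
    have derivative 0 at the quarter period. *)
Lemma strictly_increasing_of_derive (f : R -> R) (a b : R) :
  (forall x, continuous f x) ->
  (forall x, a <= x < b -> exists l, 0 < l /\ is_derive f x l) ->
  forall x y, a <= x -> x < y -> y <= b -> f x < f y.
Proof.
  intros Hc Hd x y Hx Hxy Hy.
  assert (Hex : forall z, x < z < y -> ex_derive f z).
  { intros z Hz. destruct (Hd z ltac:(lra)) as (l & _ & Hl). now exists l. }
  destruct (MVT_gen f x y (Derive f)) as (c & Hcc & E).
  - intros z Hz. rewrite Rmin_left, Rmax_right in Hz by lra. now apply Derive_correct, Hex.
  - intros z _. apply continuity_pt_filterlim. apply Hc.
  - rewrite Rmin_left, Rmax_right in Hcc by lra.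
    destruct (Rlt_dec c y) as [Hcy|Hcy].
    + destruct (Hd c ltac:(lra)) as (l & Hl & Hdl). rewrite (is_derive_unique _ _ _ Hdl) in E. nra.
    + (* The mean value point may be the endpoint, where nothing is known: split the interval. *)
      set (m := (x + y) / 2). assert (Hm : x < m < y) by (unfold m; lra).
      assert (M : forall u v, x <= u -> u < v -> v < y -> f u < f v).
      { intros u v Hu Huv Hv.
        destruct (MVT_gen f u v (Derive f)) as (w & Hw & E').
        - intros z Hz. rewrite Rmin_left, Rmax_right in Hz by lra. apply Derive_correct, Hex. lra.
        - intros z _. apply continuity_pt_filterlim. apply Hc.
        - rewrite Rmin_left, Rmax_right in Hw by lra.
          destruct (Hd w ltac:(lra)) as (l & Hl & Hdl). rewrite (is_derive_unique _ _ _ Hdl) in E'. nra. }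
      assert (Hxm : f x < f m) by (apply M; lra).
      destruct (Rlt_dec (f x) (f y)) as [H|H]; [exact H | exfalso].
      (* Otherwise f y < f m, contradicting monotonicity to the left of y by continuity at y. *)
      assert (Hlt : f y < f m) by lra.
      assert (Hloc := Hc y (fun v => v < f m)).
      assert (Hop : locally (f y) (fun v => v < f m)) by (apply (open_lt (f m)); exact Hlt).
      destruct (Hloc Hop) as [d Hdd].
      assert (Hd0 := cond_pos d).
      set (u := Rmax (y - d / 2) ((m + y) / 2)).
      assert (Hu1 : y - d / 2 <= u) by apply Rmax_l.
      assert (Hu2 : (m + y) / 2 <= u) by apply Rmax_r.
      assert (Hu3 : u < y) by (apply Rmax_lub_lt; lra).
      assert (Hu : f u < f m).
      { apply Hdd. change (Rabs (u - y) < d). rewrite Rabs_left; lra. }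
      assert (f m < f u) by (apply M; lra). lra.
Qed.

Lemma legendre_integrand_continuous (m t : R) :
  0 <= m < 1 -> -1 < t < 1 ->
  continuous (fun t => / (sqrt (1 - t ^ 2) * sqrt (1 - m ^ 2 * t ^ 2))) t.
Proof.
  intros Hm Ht. apply continuous_Rinv_comp.
  - apply (continuous_mult (K := R_AbsRing) (fun t => sqrt (1 - t ^ 2)) (fun t => sqrt (1 - m ^ 2 * t ^ 2))).
    + apply continuous_comp; [| apply continuous_sqrt].
      apply (ex_derive_continuous (fun t => 1 - t ^ 2)). auto_derive. exact I.
    + apply continuous_comp; [| apply continuous_sqrt].
      apply (ex_derive_continuous (fun t => 1 - m ^ 2 * t ^ 2)). auto_derive. exact I.
  - assert (t ^ 2 < 1) by nra. assert (0 <= t ^ 2) by nra.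
    assert (m ^ 2 < 1) by nra. assert (0 <= m ^ 2) by nra.
    apply Rgt_not_eq, Rmult_lt_0_compat; apply sqrt_lt_R0; nra.
Qed.

(** Substituting t(x) turns Legendre's integrand into the constant C on [0, b). Only the endpoint e,
    singular when e = 1, needs a limit. *)
Lemma ellF_param (m C b e : R) (t : R -> R) :
  0 <= m < 1 -> 0 < C -> 0 < b -> e <= 1 -> t 0 = 0 -> t b = e ->
  (forall x, continuous t x) ->
  (forall x, 0 <= x < b -> 0 <= t x < 1) ->
  (forall x, 0 <= x < b ->
     is_derive t x (C * (sqrt (1 - t x ^ 2) * sqrt (1 - m ^ 2 * t x ^ 2)))) ->
  ellF e m = C * b.
Proof.
  intros Hm HC Hb He Ht0 Htb Hc Ht Hd.
  set (g := fun t => / (sqrt (1 - t ^ 2) * sqrt (1 - m ^ 2 * t ^ 2))).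
  assert (Hpos : forall x, 0 <= x < b -> 0 < sqrt (1 - t x ^ 2) * sqrt (1 - m ^ 2 * t x ^ 2)).
  { intros x Hx. specialize (Ht x Hx). assert (t x ^ 2 < 1) by nra.
    assert (0 <= t x ^ 2) by nra. assert (m ^ 2 < 1) by nra. assert (0 <= m ^ 2) by nra.
    apply Rmult_lt_0_compat; apply sqrt_lt_R0; nra. }
  assert (Hinc : forall x y, 0 <= x -> x < y -> y <= b -> t x < t y).
  { apply strictly_increasing_of_derive; [exact Hc |]. intros x Hx. eexists. split; [| now apply Hd].
    apply Rmult_lt_0_compat; [exact HC | now apply Hpos]. }
  assert (HI : forall x, 0 <= x < b -> is_RInt g 0 (t x) (C * x)).
  { intros x Hx.
    assert (J : is_RInt (fun y => scal (C * (sqrt (1 - t y ^ 2) * sqrt (1 - m ^ 2 * t y ^ 2))) (g (t y)))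
                  0 x (RInt g (t 0) (t x))).
    { apply (is_RInt_comp (V := R_CompleteNormedModule) g t
        (fun y => C * (sqrt (1 - t y ^ 2) * sqrt (1 - m ^ 2 * t y ^ 2)))).
      - intros y Hy. rewrite Rmin_left, Rmax_right in Hy by lra.
        apply legendre_integrand_continuous; [exact Hm |]. specialize (Ht y ltac:(lra)). lra.
      - intros y Hy. rewrite Rmin_left, Rmax_right in Hy by lra. split; [apply Hd; lra |].
        apply (continuous_scal_r C (fun y => sqrt (1 - t y ^ 2) * sqrt (1 - m ^ 2 * t y ^ 2))).
        apply (continuous_mult (K := R_AbsRing) (fun y => sqrt (1 - t y ^ 2)) (fun y => sqrt (1 - m ^ 2 * t y ^ 2))).
        + apply (continuous_comp (fun y => t y) (fun z => sqrt (1 - z ^ 2))); [apply Hc |].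
          apply continuous_comp; [| apply continuous_sqrt].
          apply (ex_derive_continuous (fun z => 1 - z ^ 2)). auto_derive. exact I.
        + apply (continuous_comp (fun y => t y) (fun z => sqrt (1 - m ^ 2 * z ^ 2))); [apply Hc |].
          apply continuous_comp; [| apply continuous_sqrt].
          apply (ex_derive_continuous (fun z => 1 - m ^ 2 * z ^ 2)). auto_derive. exact I. }
    assert (J2 : is_RInt (fun _ : R => C) 0 x (RInt g (t 0) (t x))).
    { eapply is_RInt_ext; [| exact J]. intros y Hy.
      rewrite Rmin_left, Rmax_right in Hy by lra. unfold g. change scal with Rmult.
      match goal with |- @eq _ ?u ?v => change (@eq R u v) end.
      specialize (Hpos y ltac:(lra)). field.
      split; intros E; rewrite E in Hpos; lra. }
    assert (J3 := is_RInt_unique _ _ _ _ J2). rewrite RInt_const in J3.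
    change (scal (x - 0) C) with ((x - 0) * C) in J3. rewrite Ht0 in J3.
    replace (C * x) with (RInt g 0 (t x)) by (rewrite <- J3;
      match goal with |- @eq _ ?u ?v => change (@eq R u v) end; ring).
    apply (RInt_correct (V := R_CompleteNormedModule)).
    apply (ex_RInt_continuous (V := R_CompleteNormedModule)). intros z Hz.
    assert (H1 := Ht x Hx). rewrite Rmin_left, Rmax_right in Hz by lra.
    apply legendre_integrand_continuous; [exact Hm | lra]. }
  unfold ellF. apply is_RInt_gen_unique. fold g. intros P HP.
  destruct HP as [eps Heps]. assert (He0 := cond_pos eps).
  (* Points above x1 are within eps / (2C) of b, and every y between t(x1) and e is t(x) for such an
     x; hence its integral C x is within eps of C b. *)
  set (x1 := Rmax 0 (b - eps / (2 * C))).
  assert (Hx0 : 0 <= x1) by apply Rmax_l.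
  assert (Hx1 : b - eps / (2 * C) <= x1) by apply Rmax_r.
  assert (Hdiv : 0 < eps / (2 * C)) by (apply Rdiv_lt_0_compat; lra).
  assert (Hx1b : x1 < b) by (apply Rmax_lub_lt; lra).
  assert (Htx1 : t x1 < e) by (rewrite <- Htb; apply Hinc; lra).
  apply Filter_prod with (Q := fun x => x = 0) (R := fun y => t x1 < y < e).
  - reflexivity.
  - exists (mkposreal (e - t x1) ltac:(lra)). intros y Hy Hye.
    change (Rabs (y - e) < e - t x1) in Hy. rewrite Rabs_left in Hy by lra. lra.
  - intros x y -> Hy. simpl.
    destruct (IVT_gen t x1 b y) as (x & Hx & Ex).
    + intros z. apply continuity_pt_filterlim. apply Hc.
    + rewrite Htb, Rmin_left, Rmax_right by lra. lra.
    + rewrite Rmin_left, Rmax_right in Hx by lra.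
      assert (Hxb : x < b) by (destruct (Req_dec x b); [subst x; rewrite Htb in Ex; lra | lra]).
      exists (C * x). split.
      * rewrite <- Ex. apply HI. lra.
      * apply Heps. change (Rabs (C * x - C * b) < eps).
        rewrite Rabs_left1 by nra.
        apply Rle_lt_trans with (C * (eps / (2 * C))); [nra |].
        replace (C * (eps / (2 * C))) with (eps / 2) by (field; lra). lra.
Qed.

Lemma am_integrand_continuous (k t : R) :
  0 <= k < 1 -> continuous (fun t => / sqrt (1 - k ^ 2 * sin t ^ 2)) t.
Proof.
  intros Hk. apply (ex_derive_continuous (fun t => / sqrt (1 - k ^ 2 * sin t ^ 2))).
  assert (0 < 1 - k ^ 2 * sin t ^ 2).
  { assert (Hs := SIN_bound t). assert (sin t ^ 2 <= 1) by nra. assert (0 <= sin t ^ 2) by nra.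
    assert (k ^ 2 < 1) by nra. assert (0 <= k ^ 2) by nra. nra. }
  auto_derive. simpl in *. rewrite !Rmult_1_r in *. repeat split; try lra.
  apply Rgt_not_eq, sqrt_lt_R0. lra.
Qed.

(** [iota] returns the solution only if it is unique; uniqueness holds because the integrand is
    positive. *)
Lemma am_eq (k u p : R) :
  0 <= k < 1 -> RInt (fun t => / sqrt (1 - k ^ 2 * sin t ^ 2)) 0 p = u -> am u k = p.
Proof.
  intros Hk Hp. unfold am. apply (iota_unique (V := R_CompleteNormedModule)); [| exact Hp].
  set (g := fun t => / sqrt (1 - k ^ 2 * sin t ^ 2)) in *.
  assert (Hex : forall a b, ex_RInt g a b).
  { intros a b. apply (ex_RInt_continuous (V := R_CompleteNormedModule)).
    intros z _. now apply am_integrand_continuous. }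
  assert (Hinc : forall a b, a < b -> RInt g 0 a < RInt g 0 b).
  { intros a b Hab. rewrite <- (RInt_Chasles g 0 a b) by apply Hex.
    change plus with Rplus.
    assert (0 < RInt g a b).
    { apply RInt_gt_0; [exact Hab | | intros; now apply am_integrand_continuous].
      intros x _. unfold g. apply Rinv_0_lt_compat, sqrt_lt_R0.
      assert (Hs := SIN_bound x). assert (sin x ^ 2 <= 1) by nra. assert (0 <= sin x ^ 2) by nra.
      assert (k ^ 2 < 1) by nra. assert (0 <= k ^ 2) by nra. nra. }
    lra. }
  intros y Hy. destruct (Rtotal_order y p) as [H|[H|H]]; [| exact H |].
  - specialize (Hinc y p H). rewrite Hy, Hp in Hinc. lra.
  - specialize (Hinc p y H). rewrite Hy, Hp in Hinc. lra.
Qed.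

(* [(c, s)] and [(cos p, sin p)] rotate with the same angular velocity, so their scalar
   product is constant. *)
Lemma rotation_unique (w c s p : R -> R) :
  (forall x, is_derive c x (- (w x * s x))) -> (forall x, is_derive s x (w x * c x)) ->
  (forall x, is_derive p x (w x)) -> (forall x, c x ^ 2 + s x ^ 2 = 1) ->
  c 0 = cos (p 0) -> s 0 = sin (p 0) ->
  forall x, cos (p x) = c x /\ sin (p x) = s x.
Proof.
  intros Hc Hs Hp Hcs Hc0 Hs0 x.
  set (A := fun x => s x * sin (p x) + c x * cos (p x)).
  assert (E : A x = A 0).
  { apply is_derive_zero_const. intros z.
    assert (Es := Hs z). assert (Ec := Hc z). assert (Ep := Hp z).
    unfold A. auto_derive.
    - repeat split; [now exists (w z * c z) | now exists (w z) | now exists (- (w z * s z)) | now exists (w z)].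
    - rewrite_Derive Es; rewrite_Derive Ec; rewrite_Derive Ep. ring. }
  assert (HA : s x * sin (p x) + c x * cos (p x) = 1).
  { change (A x = 1). rewrite E. unfold A. rewrite Hs0, Hc0.
    rewrite <- (sin2_cos2 (p 0)). reflexivity. }
  specialize (Hcs x). assert (Ht := sin2_cos2 (p x)). unfold Rsqr in Ht.
  assert (Hz : (sin (p x) - s x) ^ 2 + (cos (p x) - c x) ^ 2 = 0) by nra.
  assert (Hz1 := pow2_ge_0 (sin (p x) - s x)). assert (Hz2 := pow2_ge_0 (cos (p x) - c x)).
  assert (K : forall t, t ^ 2 <= 0 -> t = 0) by (intros t Ht2; nra).
  split; apply Rminus_diag_uniq, K; lra.
Qed.

(** The angle p with p' = C d and p(0) = 0 satisfies sin p = s and cos p = c by [rotation_unique].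
    Substituting it into the integral behind [am] leaves the constant integrand C, so p(x) is the
    amplitude of C x. *)
Lemma sn_unique (k C : R) (s c d : R -> R) :
  0 <= k < 1 ->
  (forall x, is_derive s x (C * c x * d x)) ->
  (forall x, is_derive c x (- (C * s x * d x))) ->
  (forall x, continuous d x) ->
  s 0 = 0 -> c 0 = 1 -> (forall x, 0 < d x) ->
  (forall x, s x ^ 2 + c x ^ 2 = 1) ->
  (forall x, d x ^ 2 = 1 - k ^ 2 * s x ^ 2) ->
  forall x, sn (C * x) k = s x.
Proof.
  intros Hk Hs Hc Hd Hs0 Hc0 Hdp Hsc Hds.
  assert (HCd : forall x, continuous (fun y => C * d y) x).
  { intros x. apply (continuous_scal_r C d). apply Hd. }
  set (p := (fun x => RInt (fun y => C * d y) 0 x) : R -> R).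
  assert (Hp : forall x, is_derive p x (C * d x)).
  { intros x. apply (is_derive_RInt (fun y => C * d y) p 0 x); [| apply HCd].
    apply filter_forall. intros y. apply (RInt_correct (V := R_CompleteNormedModule)).
    apply (ex_RInt_continuous (V := R_CompleteNormedModule)). intros z _. apply HCd. }
  assert (Hp0 : p 0 = 0) by exact (RInt_point (V := R_CompleteNormedModule) 0 (fun y => C * d y)).
  assert (Hsin : forall x, sin (p x) = s x).
  { intros x. apply (rotation_unique (fun x => C * d x) c s p).
    - intros y. replace (C * d y * s y) with (C * s y * d y) by ring. apply Hc.
    - intros y. replace (C * d y * c y) with (C * c y * d y) by ring. apply Hs.
    - exact Hp.
    - intros y. rewrite Rplus_comm. apply Hsc.
    - now rewrite Hp0, cos_0.
    - now rewrite Hp0, sin_0. }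
  intros x. unfold sn. rewrite (am_eq k (C * x) (p x) Hk); [apply Hsin |].
  set (g := fun t => / sqrt (1 - k ^ 2 * sin t ^ 2)).
  assert (J : is_RInt (fun y => scal (C * d y) (g (p y))) 0 x (RInt g (p 0) (p x))).
  { apply (is_RInt_comp (V := R_CompleteNormedModule) g p (fun y => C * d y)).
    - intros y _. now apply am_integrand_continuous.
    - intros y _. split; [apply Hp | apply HCd]. }
  assert (J2 : is_RInt (fun _ : R => C) 0 x (RInt g (p 0) (p x))).
  { eapply is_RInt_ext; [| exact J]. intros y _. unfold g. change scal with Rmult.
    rewrite Hsin, <- Hds. specialize (Hdp y).
    replace (d y ^ 2) with (d y * d y) by ring. rewrite sqrt_square by lra.
    match goal with |- @eq _ ?u ?v => change (@eq R u v) end. field. lra. }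
  assert (J3 := is_RInt_unique _ _ _ _ J2). rewrite RInt_const, Hp0 in J3.
  change (scal (x - 0) C) with ((x - 0) * C) in J3. rewrite <- J3.
  match goal with |- @eq _ ?u ?v => change (@eq R u v) end. ring.
Qed.

Lemma Cder_horizontal (f f' : C -> C) (a : C) (x : R) :
  (forall z, Cder f z (f' z)) ->
  is_derive (fun t : R => Re (f (RtoC t + a)%C)) x (Re (f' (RtoC x + a)%C)) /\
  is_derive (fun t : R => Im (f (RtoC t + a)%C)) x (Im (f' (RtoC x + a)%C)).
Proof.
  intros H.
  assert (E : forall t : R, (a + RtoC t * 1 = RtoC t + a)%C) by (intros; ring).
  destruct (Cder_along f a 1%C (f' (RtoC x + a)%C) x Cmod_1) as [H1 H2].
  { rewrite E. apply H. }
  rewrite Cmult_1_l in H1, H2.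
  split; [apply (is_derive_ext _ _ _ _) with (2 := H1) | apply (is_derive_ext _ _ _ _) with (2 := H2)];
    intros t; now rewrite E.
Qed.

Lemma Cder_vertical (f f' : C -> C) (a : C) (y : R) :
  (forall z, Cder f z (f' z)) ->
  is_derive (fun t : R => Re (f (a + Ci * RtoC t)%C)) y (- Im (f' (a + Ci * RtoC y)%C)) /\
  is_derive (fun t : R => Im (f (a + Ci * RtoC t)%C)) y (Re (f' (a + Ci * RtoC y)%C)).
Proof.
  intros H.
  assert (E : forall t : R, (a + RtoC t * Ci = a + Ci * RtoC t)%C) by (intros; ring).
  destruct (Cder_along f a Ci (f' (a + Ci * RtoC y)%C) y Cmod_Ci) as [H1 H2].
  { rewrite E. apply H. }
  rewrite Re_mult in H1. rewrite Im_mult in H2. simpl Re in H1 at 2. simpl Im in H1 at 2.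
  simpl Re in H2 at 2. simpl Im in H2 at 3.
  split.
  - replace (- Im (f' (a + Ci * RtoC y)%C)) with
      (0 * Re (f' (a + Ci * RtoC y)%C) - 1 * Im (f' (a + Ci * RtoC y)%C)) by ring.
    apply (is_derive_ext _ _ _ _) with (2 := H1). intros t; now rewrite E.
  - replace (Re (f' (a + Ci * RtoC y)%C)) with
      (0 * Im (f' (a + Ci * RtoC y)%C) + 1 * Re (f' (a + Ci * RtoC y)%C)) by ring.
    apply (is_derive_ext _ _ _ _) with (2 := H2). intros t; now rewrite E.
Qed.

(** * Theta constants, modulus and period *)

Definition q2 (L : R) : R := Re (th2 L 0).
Definition q3 (L : R) : R := Re (th3 L 0).
Definition q4 (L : R) : R := Re (th4 L 0).
Definition e1 (L : R) : R := Re (dth1 L 0).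

(* Jacobi's functions of modulus [modulus L] and argument [period L * x] turn out to be quotients
   of theta functions at [x]. *)
Definition modulus (L : R) : R := (q2 L / q3 L) ^ 2.
Definition period (L : R) : R := e1 L * q3 L / (q2 L * q4 L).

Lemma q2_spec (L : R) : 0 < L -> th2 L 0 = RtoC (q2 L).
Proof. intros HL. now apply th2_real. Qed.
Lemma q3_spec (L : R) : 0 < L -> th3 L 0 = RtoC (q3 L).
Proof. intros HL. now apply th3_real. Qed.
Lemma q4_spec (L : R) : 0 < L -> th4 L 0 = RtoC (q4 L).
Proof. intros HL. now apply th4_real. Qed.

Lemma theta_imag_Re_pos (c L y : R) : 0 < L -> 0 < Re (theta c L (Ci * RtoC y)%C).
Proof. intros HL. destruct (theta_imag_pos c L y HL) as (r & Hr & E). rewrite E. exact Hr. Qed.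

Lemma q2_pos (L : R) : 0 < L -> 0 < q2 L.
Proof.
  intros HL. unfold q2. assert (H := theta_imag_Re_pos (1 / 2) L 0 HL). now rewrite Cmult_0_r in H.
Qed.

Lemma q3_pos (L : R) : 0 < L -> 0 < q3 L.
Proof.
  intros HL. unfold q3. assert (H := theta_imag_Re_pos 0 L 0 HL). now rewrite Cmult_0_r in H.
Qed.

Lemma RtoC_neq_0 (x : R) : RtoC x <> 0%C -> x <> 0.
Proof. intros H ->. now apply H. Qed.

Lemma q4_neq_0 (L : R) : 0 < L -> q4 L <> 0.
Proof.
  intros HL. apply RtoC_neq_0. rewrite <- q4_spec by exact HL. now apply th4_real_neq_0.
Qed.

Lemma q_quartic (L : R) : 0 < L -> q3 L ^ 4 = q2 L ^ 4 + q4 L ^ 4.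
Proof.
  intros HL. assert (H := th_0_quartic L HL).
  rewrite q2_spec, q3_spec, q4_spec in H by exact HL.
  rewrite <- !RtoC_pow, <- RtoC_plus in H. now injection H.
Qed.

Lemma modulus_bounds (L : R) : 0 < L -> 0 < modulus L < 1.
Proof.
  intros HL. assert (H2 := q2_pos L HL). assert (H3 := q3_pos L HL).
  assert (H4 := q4_neq_0 L HL). assert (HQ := q_quartic L HL).
  unfold modulus. assert (Hd : 0 < q2 L / q3 L) by now apply Rdiv_lt_0_compat.
  split; [now apply pow_lt |].
  assert (H44 : 0 < q4 L ^ 4).
  { replace (q4 L ^ 4) with ((q4 L ^ 2) ^ 2) by ring. apply pow2_gt_0. now apply pow_nonzero. }
  assert (q2 L < q3 L).
  { destruct (Rlt_dec (q2 L) (q3 L)) as [H|H]; [exact H |].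
    assert (q3 L ^ 4 <= q2 L ^ 4) by (apply pow_incr; lra). lra. }
  assert (q2 L / q3 L < 1) by (apply Rmult_lt_reg_r with (q3 L); [lra |]; field_simplify; lra).
  nra.
Qed.

Lemma comodulus_sq (L : R) : 0 < L -> 1 - modulus L ^ 2 = ((q4 L / q3 L) ^ 2) ^ 2.
Proof.
  intros HL. assert (H3 := q3_pos L HL). unfold modulus.
  assert (HQ := q_quartic L HL).
  apply Rmult_eq_reg_r with (q3 L ^ 4); [| apply pow_nonzero; lra].
  transitivity (q3 L ^ 4 - q2 L ^ 4); [field; lra |].
  transitivity (q4 L ^ 4); [lra | field; lra].
Qed.

Lemma is_derive_scal_div (a : R) (f g : R -> R) (x f' g' : R) :
  is_derive f x f' -> is_derive g x g' -> g x <> 0 ->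
  is_derive (fun t => a * (f t / g t)) x (a * ((f' * g x - f x * g') / g x ^ 2)).
Proof.
  intros Hf Hg Hx. auto_derive.
  - repeat split; [now exists f' | now exists g' | exact Hx].
  - rewrite_Derive Hf; rewrite_Derive Hg.
    field. exact Hx.
Qed.

(** * The Jacobi functions on the real axis *)

Definition theta_sn (L x : R) : R := q3 L / q2 L * (Re (th1 L (RtoC x)) / Re (th4 L (RtoC x))).
Definition theta_cn (L x : R) : R := q4 L / q2 L * (Re (th2 L (RtoC x)) / Re (th4 L (RtoC x))).
Definition theta_dn (L x : R) : R := q4 L / q3 L * (Re (th3 L (RtoC x)) / Re (th4 L (RtoC x))).

Lemma th4_Re_neq_0 (L x : R) : 0 < L -> Re (th4 L (RtoC x)) <> 0.
Proof.
  intros HL. apply RtoC_neq_0. rewrite <- th4_real by exact HL. now apply th4_real_neq_0.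
Qed.

Lemma th_real_derive (L x : R) : 0 < L ->
  is_derive (fun t : R => Re (th1 L (RtoC t))) x (Re (dth1 L (RtoC x))) /\
  is_derive (fun t : R => Re (th2 L (RtoC t))) x (Re (dth2 L (RtoC x))) /\
  is_derive (fun t : R => Re (th3 L (RtoC t))) x (Re (dtheta 0 L (RtoC x))) /\
  is_derive (fun t : R => Re (th4 L (RtoC t))) x (Re (dth4 L (RtoC x))).
Proof.
  intros HL.
  assert (K : forall f f', (forall z, Cder f z (f' z)) ->
    is_derive (fun t : R => Re (f (RtoC t))) x (Re (f' (RtoC x)))).
  { intros f f' H. destruct (Cder_horizontal f f' 0%C x H) as [H1 _].
    rewrite Cplus_0_r in H1. eapply is_derive_ext; [| exact H1].
    intros t. simpl. now rewrite Cplus_0_r. }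
  split; [| split; [| split]].
  - apply (K (th1 L) (dth1 L)). intros z. now apply th1_Cder.
  - apply (K (th2 L) (dth2 L)). intros z. now apply th2_Cder.
  - apply (K (th3 L) (dtheta 0 L)). intros z. now apply theta_Cder.
  - apply (K (th4 L) (dth4 L)). intros z. now apply th4_Cder.
Qed.

Lemma th_real_squares (L x : R) : 0 < L ->
  Re (th4 L (RtoC x)) ^ 2 * q2 L ^ 2 =
    Re (th1 L (RtoC x)) ^ 2 * q3 L ^ 2 + Re (th2 L (RtoC x)) ^ 2 * q4 L ^ 2 /\
  Re (th4 L (RtoC x)) ^ 2 * q3 L ^ 2 =
    Re (th1 L (RtoC x)) ^ 2 * q2 L ^ 2 + Re (th3 L (RtoC x)) ^ 2 * q4 L ^ 2.
Proof.
  intros HL. destruct (th_squares L (RtoC x) HL) as [H1 H2].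
  rewrite (th1_real L x), (th2_real L x), (th4_real L x), q2_spec, q3_spec, q4_spec in H1 by exact HL.
  rewrite (th1_real L x), (th3_real L x), (th4_real L x), q2_spec, q3_spec, q4_spec in H2 by exact HL.
  rewrite <- !RtoC_pow, <- !RtoC_mult, <- RtoC_plus in H1, H2.
  injection H1. injection H2. intros E2 E1. split; assumption.
Qed.

Lemma theta_sn_cn_dn_squares (L x : R) : 0 < L ->
  theta_sn L x ^ 2 + theta_cn L x ^ 2 = 1 /\ theta_dn L x ^ 2 = 1 - modulus L ^ 2 * theta_sn L x ^ 2.
Proof.
  intros HL. destruct (th_real_squares L x HL) as [H1 H2].
  assert (P2 := q2_pos L HL). assert (P3 := q3_pos L HL).
  assert (P4 := th4_Re_neq_0 L x HL).
  unfold theta_sn, theta_cn, theta_dn, modulus.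
  set (r1 := Re (th1 L (RtoC x))) in *. set (r2 := Re (th2 L (RtoC x))) in *.
  set (r3 := Re (th3 L (RtoC x))) in *. set (r4 := Re (th4 L (RtoC x))) in *.
  split.
  - transitivity ((r1 ^ 2 * q3 L ^ 2 + r2 ^ 2 * q4 L ^ 2) / (r4 ^ 2 * q2 L ^ 2)); [field; lra |].
    rewrite <- H1. field. lra.
  - transitivity ((r1 ^ 2 * q2 L ^ 2 + r3 ^ 2 * q4 L ^ 2) / (r4 ^ 2 * q3 L ^ 2)
       - r1 ^ 2 * q2 L ^ 2 / (r4 ^ 2 * q3 L ^ 2)); [field; lra |].
    rewrite <- H2. field. lra.
Qed.

Lemma theta_sn_derive (L x : R) : 0 < L -> is_derive (theta_sn L) x (period L * theta_cn L x * theta_dn L x).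
Proof.
  intros HL. destruct (th_real_derive L x HL) as (D1 & _ & _ & D4).
  assert (P2 := q2_pos L HL). assert (P3 := q3_pos L HL). assert (P4' := q4_neq_0 L HL).
  assert (P4 := th4_Re_neq_0 L x HL).
  assert (W := th1_th4_wronskian L (RtoC x) HL).
  rewrite (th1_real L x), (th2_real L x), (th3_real L x), (th4_real L x), q2_spec, q3_spec, q4_spec in W by exact HL.
  apply (f_equal Re) in W.
  evar_last.
  - apply (is_derive_scal_div (q3 L / q2 L) (fun t => Re (th1 L (RtoC t))) (fun t => Re (th4 L (RtoC t))) x _ _ D1 D4 P4).
  - unfold period, theta_cn, theta_dn, e1.
    set (r1 := Re (th1 L (RtoC x))) in *. set (r2 := Re (th2 L (RtoC x))) in *.
    set (r3 := Re (th3 L (RtoC x))) in *. set (r4 := Re (th4 L (RtoC x))) in *.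
    set (d1 := dth1 L (RtoC x)) in *. set (d4 := dth4 L (RtoC x)) in *. set (d0 := dth1 L 0) in *.
    assert (W' : (Re d1 * r4 - r1 * Re d4) * (q2 L * q3 L) = Re d0 * q4 L * (r2 * r3)).
    { destruct d1, d4, d0. simpl in W. simpl. lra. }
    transitivity ((Re d1 * r4 - r1 * Re d4) * (q2 L * q3 L) / (q2 L ^ 2 * r4 ^ 2)); [field; lra |].
    rewrite W'. field. lra.
Qed.

Lemma theta_cn_derive (L x : R) : 0 < L -> is_derive (theta_cn L) x (- (period L * theta_sn L x * theta_dn L x)).
Proof.
  intros HL. destruct (th_real_derive L x HL) as (_ & D2 & _ & D4).
  assert (P2 := q2_pos L HL). assert (P3 := q3_pos L HL). assert (P4' := q4_neq_0 L HL).
  assert (P4 := th4_Re_neq_0 L x HL).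
  assert (W := th2_th4_wronskian L (RtoC x) HL (th4_real_neq_0 L 0 HL)).
  rewrite (th1_real L x), (th2_real L x), (th3_real L x), (th4_real L x), q2_spec, q3_spec, q4_spec in W by exact HL.
  apply (f_equal Re) in W.
  evar_last.
  - apply (is_derive_scal_div (q4 L / q2 L) (fun t => Re (th2 L (RtoC t))) (fun t => Re (th4 L (RtoC t))) x _ _ D2 D4 P4).
  - unfold period, theta_sn, theta_dn, e1.
    set (r1 := Re (th1 L (RtoC x))) in *. set (r2 := Re (th2 L (RtoC x))) in *.
    set (r3 := Re (th3 L (RtoC x))) in *. set (r4 := Re (th4 L (RtoC x))) in *.
    set (d2 := dth2 L (RtoC x)) in *. set (d4 := dth4 L (RtoC x)) in *. set (d0 := dth1 L 0) in *.
    assert (W' : (Re d2 * r4 - r2 * Re d4) * (q2 L * q4 L) = - (Re d0 * q3 L) * (r1 * r3)).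
    { destruct d2, d4, d0. simpl in W. simpl. lra. }
    transitivity ((Re d2 * r4 - r2 * Re d4) * (q2 L * q4 L) / (q2 L ^ 2 * r4 ^ 2)); [field; lra |].
    rewrite W'. field. lra.
Qed.

Lemma theta_sn_continuous (L x : R) : 0 < L -> continuous (theta_sn L) x.
Proof. intros HL. apply (ex_derive_continuous (theta_sn L)). eexists. now apply theta_sn_derive. Qed.

Lemma theta_cn_continuous (L x : R) : 0 < L -> continuous (theta_cn L) x.
Proof. intros HL. apply (ex_derive_continuous (theta_cn L)). eexists. now apply theta_cn_derive. Qed.

Lemma theta_dn_continuous (L x : R) : 0 < L -> continuous (theta_dn L) x.
Proof.
  intros HL. destruct (th_real_derive L x HL) as (_ & _ & D3 & D4).
  apply (ex_derive_continuous (theta_dn L)). eexists.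
  apply (is_derive_scal_div (q4 L / q3 L) (fun t => Re (th3 L (RtoC t))) (fun t => Re (th4 L (RtoC t))) x _ _ D3 D4).
  now apply th4_Re_neq_0.
Qed.

Lemma theta_sn_0 (L : R) : 0 < L -> theta_sn L 0 = 0.
Proof.
  intros HL. unfold theta_sn. change (th1 L (RtoC 0)) with (th1 L 0). rewrite th1_0 by exact HL. simpl.
  unfold Rdiv. now rewrite Rmult_0_l, Rmult_0_r.
Qed.

Lemma theta_cn_0 (L : R) : 0 < L -> theta_cn L 0 = 1.
Proof.
  intros HL. unfold theta_cn. change (Re (th2 L (RtoC 0))) with (q2 L). change (Re (th4 L (RtoC 0))) with (q4 L).
  assert (P2 := q2_pos L HL). assert (P4' := q4_neq_0 L HL). field. lra.
Qed.

Lemma theta_dn_0 (L : R) : 0 < L -> theta_dn L 0 = 1.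
Proof.
  intros HL. unfold theta_dn. change (Re (th3 L (RtoC 0))) with (q3 L). change (Re (th4 L (RtoC 0))) with (q4 L).
  assert (P3 := q3_pos L HL). assert (P4' := q4_neq_0 L HL). field. lra.
Qed.

Lemma th3_Re_shift (L x : R) : 0 < L -> Re (th4 L (RtoC (x + PI / 2))) = Re (th3 L (RtoC x)).
Proof. intros HL. now rewrite RtoC_plus, th4_PI2. Qed.

Lemma th3_Re_shift' (L x : R) : Re (th3 L (RtoC (x + PI / 2))) = Re (th4 L (RtoC x)).
Proof. now rewrite RtoC_plus. Qed.

Lemma th3_Re_neq_0 (L x : R) : 0 < L -> Re (th3 L (RtoC x)) <> 0.
Proof. intros HL. rewrite <- th3_Re_shift by exact HL. now apply th4_Re_neq_0. Qed.

(** Translation by PI / 2 exchanges [th3] and [th4], so the two theta quotients are inverse to each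
    other. *)
Lemma theta_dn_shift (L x : R) : 0 < L -> theta_dn L (x + PI / 2) * theta_dn L x = (q4 L / q3 L) ^ 2.
Proof.
  intros HL. unfold theta_dn. rewrite th3_Re_shift, th3_Re_shift' by exact HL.
  assert (P3 := q3_pos L HL).
  assert (N3 := th3_Re_neq_0 L x HL). assert (N4 := th4_Re_neq_0 L x HL). field. lra.
Qed.

Lemma theta_dn_neq_0 (L x : R) : 0 < L -> theta_dn L x <> 0.
Proof.
  intros HL H. assert (E := theta_dn_shift L x HL). rewrite H, Rmult_0_r in E.
  assert (P3 := q3_pos L HL). assert (P4' := q4_neq_0 L HL).
  assert (q4 L / q3 L <> 0) by (apply Rmult_integral_contrapositive_currified; [exact P4' | apply Rinv_neq_0_compat; lra]).
  symmetry in E. now apply (pow_nonzero _ 2) in E.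
Qed.

Lemma theta_dn_pos (L x : R) : 0 < L -> 0 < theta_dn L x.
Proof.
  intros HL. destruct (Rle_dec 0 x) as [Hx|Hx].
  - apply (positive_of_nonvanishing (theta_dn L) x); try lra.
    + intros y. now apply theta_dn_continuous.
    + rewrite theta_dn_0 by exact HL. lra.
    + intros y _. now apply theta_dn_neq_0.
  - replace x with (- (- x)) by ring.
    apply (positive_of_nonvanishing (fun y => theta_dn L (- y)) (- x)); try lra.
    + intros y. apply (continuous_comp (fun y => - y) (theta_dn L)); [| now apply theta_dn_continuous].
      apply (ex_derive_continuous (fun y => - y)). auto_derive. exact I.
    + rewrite Ropp_0, theta_dn_0 by exact HL. lra.
    + intros y _. now apply theta_dn_neq_0.
Qed.

Lemma sn_theta (L x : R) : 0 < L -> sn (period L * x) (modulus L) = theta_sn L x.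
Proof.
  intros HL. assert (Hm := modulus_bounds L HL).
  apply (sn_unique (modulus L) (period L) (theta_sn L) (theta_cn L) (theta_dn L)).
  - lra.
  - intros y. now apply theta_sn_derive.
  - intros y. now apply theta_cn_derive.
  - intros y. now apply theta_dn_continuous.
  - now apply theta_sn_0.
  - now apply theta_cn_0.
  - intros y. now apply theta_dn_pos.
  - intros y. now apply theta_sn_cn_dn_squares.
  - intros y. now apply theta_sn_cn_dn_squares.
Qed.

Lemma dn_theta (L x : R) : 0 < L -> dn (period L * x) (modulus L) = theta_dn L x.
Proof.
  intros HL. unfold dn. rewrite sn_theta by exact HL.
  destruct (theta_sn_cn_dn_squares L x HL) as [_ <-].
  replace (theta_dn L x ^ 2) with (theta_dn L x * theta_dn L x) by ring. apply sqrt_square. left. now apply theta_dn_pos.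
Qed.

Lemma theta_cn_pos (L x : R) : 0 < L -> 0 <= x < PI / 2 -> 0 < theta_cn L x.
Proof.
  intros HL Hx. apply (positive_of_nonvanishing (theta_cn L) x); try lra.
  - intros y. now apply theta_cn_continuous.
  - rewrite theta_cn_0 by exact HL. lra.
  - intros y Hy. unfold theta_cn. assert (P2 := q2_pos L HL). assert (P4' := q4_neq_0 L HL).
    assert (P4 := th4_Re_neq_0 L y HL).
    (* th2(y) equals th1(y + PI / 2), and y + PI / 2 lies strictly between 0 and PI. *)
    assert (N : Re (th2 L (RtoC y)) <> 0).
    { apply RtoC_neq_0. rewrite <- th2_real by exact HL.
      assert (N := th1_neq_0 L (y + PI / 2) HL ltac:(lra)).
      intros H. apply N. rewrite RtoC_plus. unfold th1. rewrite <- Cplus_assoc.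
      replace (RtoC (PI / 2) + RtoC (PI / 2))%C with (RtoC PI) by (apply C_ext; simpl; field).
      rewrite theta_half_PI by exact HL. unfold th2 in H. rewrite H. ring. }
    unfold Rdiv. repeat apply Rmult_integral_contrapositive_currified; try assumption;
      apply Rinv_neq_0_compat; lra.
Qed.

Lemma theta_sn_PI2 (L : R) : 0 < L -> theta_sn L (PI / 2) = 1.
Proof.
  intros HL. unfold theta_sn. rewrite th1_PI2 by exact HL.
  assert (E := th3_Re_shift L 0 HL). rewrite Rplus_0_l in E. rewrite E.
  change (Re (th3 L (RtoC 0))) with (q3 L). change (Re (th2 L 0)) with (q2 L).
  assert (P2 := q2_pos L HL). assert (P3 := q3_pos L HL). field. lra.
Qed.

(** The sign is read off the rise of the elliptic sine from 0 to 1 on [0, PI / 2]: by the mean value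
    theorem its derivative, [period] times cn dn, is positive somewhere, while cn >= 0 and dn >
    0. *)
Lemma period_pos (L : R) : 0 < L -> 0 < period L.
Proof.
  intros HL. assert (HPI := PI_RGT_0).
  destruct (MVT_gen (theta_sn L) 0 (PI / 2) (fun x => period L * theta_cn L x * theta_dn L x)) as (z & Hz & E).
  - intros x _. now apply theta_sn_derive.
  - intros x _. apply continuity_pt_filterlim. now apply theta_sn_continuous.
  - rewrite Rmin_left, Rmax_right in Hz by lra.
    rewrite theta_sn_PI2, theta_sn_0 in E by exact HL.
    assert (Hd := theta_dn_pos L z HL).
    assert (Hc : 0 <= theta_cn L z).
    { destruct (Rlt_dec z (PI / 2)); [left; apply theta_cn_pos; lra |].
      replace z with (PI / 2) by lra.
      destruct (theta_sn_cn_dn_squares L (PI / 2) HL) as [H _]. rewrite theta_sn_PI2 in H by exact HL. nra. }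
    destruct (Rlt_dec 0 (period L)) as [H|H]; [exact H | exfalso].
    assert (period L * theta_cn L z <= 0) by nra.
    assert (period L * theta_cn L z * theta_dn L z <= 0) by nra. nra.
Qed.

Lemma ellK_theta (L : R) : 0 < L -> ellK (modulus L) = period L * (PI / 2).
Proof.
  intros HL. assert (HPI := PI_RGT_0). assert (Hm := modulus_bounds L HL).
  assert (Hs : forall x, 0 <= x < PI / 2 -> -1 < theta_sn L x < 1).
  { intros x Hx. assert (Hc := theta_cn_pos L x HL Hx). destruct (theta_sn_cn_dn_squares L x HL) as [E _]. nra. }
  unfold ellK. apply (ellF_param (modulus L) (period L) (PI / 2) 1 (theta_sn L)); try lra.
  - now apply period_pos.
  - now apply theta_sn_0.
  - now apply theta_sn_PI2.
  - intros x. now apply theta_sn_continuous.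
  - intros x Hx. assert (Hb := Hs x Hx). split; [| lra].
    destruct (Req_dec x 0) as [->|Hx0]; [rewrite theta_sn_0; lra |].
    rewrite <- (theta_sn_0 L HL). left.
    apply (strictly_increasing_of_derive (theta_sn L) 0 (PI / 2)); try lra.
    + intros y. now apply theta_sn_continuous.
    + intros y Hy. exists (period L * theta_cn L y * theta_dn L y). split; [| now apply theta_sn_derive].
      apply Rmult_lt_0_compat; [apply Rmult_lt_0_compat |];
        [now apply period_pos | now apply theta_cn_pos | now apply theta_dn_pos].
  - intros x Hx. destruct (theta_sn_cn_dn_squares L x HL) as [E1 E2].
    replace (sqrt (1 - theta_sn L x ^ 2)) with (theta_cn L x).
    + replace (sqrt (1 - modulus L ^ 2 * theta_sn L x ^ 2)) with (theta_dn L x).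
      * rewrite <- Rmult_assoc. now apply theta_sn_derive.
      * rewrite <- E2. replace (theta_dn L x ^ 2) with (theta_dn L x * theta_dn L x) by ring.
        symmetry. apply sqrt_square. left. now apply theta_dn_pos.
    + replace (1 - theta_sn L x ^ 2) with (theta_cn L x * theta_cn L x) by lra.
      symmetry. apply sqrt_square. left. now apply theta_cn_pos.
Qed.

(** * The imaginary axis *)

(** On the imaginary axis [th1] is purely imaginary and the other three are real, so these four real
    functions carry all the values there. *)
Definition ith1 (L y : R) : R := Im (th1 L (Ci * RtoC y)%C).
Definition ith2 (L y : R) : R := Re (th2 L (Ci * RtoC y)%C).
Definition ith3 (L y : R) : R := Re (th3 L (Ci * RtoC y)%C).
Definition ith4 (L y : R) : R := Re (th4 L (Ci * RtoC y)%C).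

Lemma ith2_pos (L y : R) : 0 < L -> 0 < ith2 L y.
Proof. apply theta_imag_Re_pos. Qed.

Lemma ith3_pos (L y : R) : 0 < L -> 0 < ith3 L y.
Proof. apply theta_imag_Re_pos. Qed.

Lemma ith1_spec (L y : R) : 0 < L -> th1 L (Ci * RtoC y)%C = (Ci * RtoC (ith1 L y))%C.
Proof. apply th1_imag. Qed.

Lemma ith4_spec (L y : R) : 0 < L -> th4 L (Ci * RtoC y)%C = RtoC (ith4 L y).
Proof. apply th4_imag. Qed.

Lemma theta_imag_real (c L y : R) : 0 < L ->
  theta c L (Ci * RtoC y)%C = RtoC (Re (theta c L (Ci * RtoC y)%C)).
Proof. intros HL. destruct (theta_imag_pos c L y HL) as (r & _ & E). now rewrite E. Qed.

Lemma ith2_spec (L y : R) : 0 < L -> th2 L (Ci * RtoC y)%C = RtoC (ith2 L y).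
Proof. apply theta_imag_real. Qed.

Lemma ith3_spec (L y : R) : 0 < L -> th3 L (Ci * RtoC y)%C = RtoC (ith3 L y).
Proof. apply theta_imag_real. Qed.

Lemma th_imag_derive (L y : R) : 0 < L ->
  is_derive (ith1 L) y (Re (dth1 L (Ci * RtoC y)%C)) /\
  is_derive (ith2 L) y (- Im (dth2 L (Ci * RtoC y)%C)) /\
  is_derive (ith4 L) y (- Im (dth4 L (Ci * RtoC y)%C)).
Proof.
  intros HL.
  split; [| split].
  - destruct (Cder_vertical (th1 L) (dth1 L) 0%C y (fun z => th1_Cder L z HL)) as [_ H].
    rewrite Cplus_0_l in H. eapply is_derive_ext; [| exact H].
    intros t. cbv beta. now rewrite Cplus_0_l.
  - destruct (Cder_vertical (th2 L) (dth2 L) 0%C y (fun z => th2_Cder L z HL)) as [H _].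
    rewrite Cplus_0_l in H. eapply is_derive_ext; [| exact H].
    intros t. cbv beta. now rewrite Cplus_0_l.
  - destruct (Cder_vertical (th4 L) (dth4 L) 0%C y (fun z => th4_Cder L z HL)) as [H _].
    rewrite Cplus_0_l in H. eapply is_derive_ext; [| exact H].
    intros t. cbv beta. now rewrite Cplus_0_l.
Qed.

Lemma th_imag_squares (L y : R) : 0 < L ->
  ith2 L y ^ 2 * q4 L ^ 2 = ith4 L y ^ 2 * q2 L ^ 2 + ith1 L y ^ 2 * q3 L ^ 2 /\
  ith3 L y ^ 2 * q4 L ^ 2 = ith4 L y ^ 2 * q3 L ^ 2 + ith1 L y ^ 2 * q2 L ^ 2.
Proof.
  intros HL. destruct (th_squares L (Ci * RtoC y)%C HL) as [H1 H2].
  rewrite ith1_spec, ith2_spec, ith4_spec, q2_spec, q3_spec, q4_spec in H1 by exact HL.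
  rewrite ith1_spec, ith3_spec, ith4_spec, q2_spec, q3_spec, q4_spec in H2 by exact HL.
  apply (f_equal Re) in H1. apply (f_equal Re) in H2. simpl in H1, H2. split; lra.
Qed.

Lemma th_imag_wronskian (L y : R) : 0 < L ->
  (Re (dth1 L (Ci * RtoC y)%C) * ith4 L y + ith1 L y * Im (dth4 L (Ci * RtoC y)%C)) * (q2 L * q3 L)
  = e1 L * q4 L * (ith2 L y * ith3 L y).
Proof.
  intros HL. assert (W := th1_th4_wronskian L (Ci * RtoC y)%C HL).
  rewrite ith1_spec, ith2_spec, ith3_spec, ith4_spec, q2_spec, q3_spec, q4_spec in W by exact HL.
  apply (f_equal Re) in W. unfold e1.
  destruct (dth1 L (Ci * RtoC y)%C), (dth4 L (Ci * RtoC y)%C), (dth1 L 0).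
  simpl in W. simpl. lra.
Qed.

Lemma ith4_neq_0 (L y : R) : 0 < L -> 0 <= y < L / 2 -> ith4 L y <> 0.
Proof.
  intros HL Hy. apply RtoC_neq_0. rewrite <- ith4_spec by exact HL.
  apply (th4_neq_0 L (y / L)); [exact HL | |].
  - split; [apply Rmult_le_pos; [lra | left; now apply Rinv_0_lt_compat] |].
    apply Rmult_lt_reg_r with L; [exact HL |]. unfold Rdiv. rewrite Rmult_assoc, Rinv_l; lra.
  - replace (y / L * L) with y by (field; lra). simpl.
    replace (0 * 0 + 1 * y) with y by ring. rewrite Rabs_pos_eq; lra.
Qed.

Lemma ith1_0 (L : R) : 0 < L -> ith1 L 0 = 0.
Proof. intros HL. unfold ith1. rewrite Cmult_0_r, th1_0 by exact HL. reflexivity. Qed.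

Lemma ith4_0 (L : R) : ith4 L 0 = q4 L.
Proof. unfold ith4. now rewrite Cmult_0_r. Qed.

(* [i L / 2] is the half quasi-period; there the terms of index [n] and [-1-n] cancel. *)
Lemma ith4_half_period (L : R) : 0 < L -> ith4 L (L / 2) = 0.
Proof.
  intros HL.
  change (Zsum (fun n => Re (theta_term 0 L (Ci * RtoC (L / 2) + RtoC (PI / 2))%C n)) = 0). unfold Zsum.
  apply Series_eq_0. intros n.
  match goal with |- Re ?u + Re ?v = 0 => change (Re (u + v)%C = 0) end.
  unfold theta_term.
  rewrite minus_IZR, opp_IZR, <- INR_IZR_INZ.
  replace (RtoC (- (L * (INR n + 0) ^ 2)) + RtoC (2 * (INR n + 0)) * (Ci * (Ci * RtoC (L / 2) + RtoC (PI / 2))))%C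
    with (RtoC (INR n * PI) * Ci + RtoC (- (L * (INR n ^ 2 + INR n))))%C by (apply C_ext; simpl; field).
  replace (RtoC (- (L * (- INR n - 1 + 0) ^ 2)) + RtoC (2 * (- INR n - 1 + 0)) * (Ci * (Ci * RtoC (L / 2) + RtoC (PI / 2))))%C
    with (- (RtoC (INR n * PI) * Ci) + (RtoC (- PI) * Ci + RtoC (- (L * (INR n ^ 2 + INR n)))))%C by (apply C_ext; simpl; field).
  rewrite !Cexp_plus, Cexp_INR_PI, Cexp_opp_INR_PI, Cexp_Ci, cos_neg, sin_neg, cos_PI, sin_PI.
  match goal with |- Re ?z = 0 => replace z with (RtoC 0) end; [reflexivity |].
  replace (-1, - 0) with (- (1))%C by (apply C_ext; simpl; ring). ring.
Qed.

Lemma ith4_ratio_pos (L y : R) : 0 < L -> 0 <= y < L / 2 -> 0 < ith4 L y / q4 L.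
Proof.
  intros HL Hy. assert (P4 := q4_neq_0 L HL).
  apply (positive_of_nonvanishing (fun y => ith4 L y / q4 L) y); try lra.
  - intros x. apply (ex_derive_continuous (fun y => ith4 L y / q4 L)).
    destruct (th_imag_derive L x HL) as (_ & _ & D).
    auto_derive. now exists (- Im (dth4 L (Ci * RtoC x)%C)).
  - rewrite ith4_0. unfold Rdiv. rewrite Rinv_r by exact P4. lra.
  - intros x Hx. apply Rmult_integral_contrapositive_currified; [apply ith4_neq_0; lra |].
    now apply Rinv_neq_0_compat.
Qed.

(* [-i sn(i u) / cn(i u)], that is [sn(u)] for the complementary modulus. *)
Definition theta_sn_im (L y : R) : R := q3 L / q4 L * (ith1 L y / ith2 L y).

Definition comodulus (L : R) : R := (q4 L / q3 L) ^ 2.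

Lemma comodulus_bounds (L : R) : 0 < L -> 0 < comodulus L < 1.
Proof.
  intros HL. assert (E := comodulus_sq L HL). fold (comodulus L) in E.
  assert (Hm := modulus_bounds L HL). assert (P3 := q3_pos L HL). assert (P4 := q4_neq_0 L HL).
  assert (0 < comodulus L).
  { apply pow2_gt_0. apply Rmult_integral_contrapositive_currified; [exact P4 |].
    apply Rinv_neq_0_compat. lra. }
  split; [assumption |]. nra.
Qed.

Lemma comod_modulus (L : R) : 0 < L -> comod (modulus L) = comodulus L.
Proof.
  intros HL. unfold comod. rewrite comodulus_sq by exact HL. fold (comodulus L).
  apply sqrt_pow2. left. now apply comodulus_bounds.
Qed.

(** These are the two radicands of Legendre's integrand for the complementary modulus; their roots
    are the factors in [theta_sn_im_derive]. *)
Lemma theta_sn_im_squares (L y : R) : 0 < L ->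
  1 - theta_sn_im L y ^ 2 = (ith4 L y / q4 L * (q2 L / ith2 L y)) ^ 2 /\
  1 - comodulus L ^ 2 * theta_sn_im L y ^ 2 = (q2 L * ith3 L y / (q3 L * ith2 L y)) ^ 2.
Proof.
  intros HL. destruct (th_imag_squares L y HL) as [E1 E2].
  assert (P2 := q2_pos L HL). assert (P3 := q3_pos L HL). assert (P4 := q4_neq_0 L HL).
  assert (I2 := ith2_pos L y HL). assert (HQ := q_quartic L HL).
  unfold theta_sn_im, comodulus. split.
  - transitivity ((ith2 L y ^ 2 * q4 L ^ 2 - ith1 L y ^ 2 * q3 L ^ 2) / (ith2 L y ^ 2 * q4 L ^ 2)); [field; lra |].
    rewrite E1 at 1. field. lra.
  - transitivity ((q3 L ^ 2 * (ith2 L y ^ 2 * q4 L ^ 2) - q4 L ^ 4 * ith1 L y ^ 2) / (q3 L ^ 2 * ith2 L y ^ 2 * q4 L ^ 2)); [field; lra |].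
    rewrite E1. transitivity (q2 L ^ 2 * (ith3 L y ^ 2 * q4 L ^ 2) / (q3 L ^ 2 * ith2 L y ^ 2 * q4 L ^ 2)); [| field; lra].
    rewrite E2. f_equal.
    replace (q4 L ^ 4) with (q3 L ^ 4 - q2 L ^ 4) by lra. ring.
Qed.

Lemma theta_sn_im_derive (L y : R) : 0 < L ->
  is_derive (theta_sn_im L) y (period L * ((ith4 L y / q4 L * (q2 L / ith2 L y)) * (q2 L * ith3 L y / (q3 L * ith2 L y)))).
Proof.
  intros HL. destruct (th_imag_derive L y HL) as (D1 & D2 & D4).
  assert (P2 := q2_pos L HL). assert (P3 := q3_pos L HL). assert (P4 := q4_neq_0 L HL).
  assert (I2 := ith2_pos L y HL). assert (W := th_imag_wronskian L y HL).
  (* The relation between [ith1], [ith2], [ith4] eliminates the derivative of [ith2]. *)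
  assert (DE : ith2 L y * - Im (dth2 L (Ci * RtoC y)%C) * q4 L ^ 2 =
     ith4 L y * - Im (dth4 L (Ci * RtoC y)%C) * q2 L ^ 2 + ith1 L y * Re (dth1 L (Ci * RtoC y)%C) * q3 L ^ 2).
  { assert (A : is_derive (fun t => ith2 L t ^ 2 * q4 L ^ 2) y (2 * (ith2 L y * - Im (dth2 L (Ci * RtoC y)%C) * q4 L ^ 2))).
    { auto_derive; [now exists (- Im (dth2 L (Ci * RtoC y)%C)) |].
      rewrite_Derive D2. ring. }
    assert (B : is_derive (fun t => ith2 L t ^ 2 * q4 L ^ 2) y
       (2 * (ith4 L y * - Im (dth4 L (Ci * RtoC y)%C) * q2 L ^ 2 + ith1 L y * Re (dth1 L (Ci * RtoC y)%C) * q3 L ^ 2))).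
    { apply (is_derive_ext (fun t => ith4 L t ^ 2 * q2 L ^ 2 + ith1 L t ^ 2 * q3 L ^ 2)).
      - intros t. symmetry. exact (proj1 (th_imag_squares L t HL)).
      - auto_derive; [split; [now exists (- Im (dth4 L (Ci * RtoC y)%C)) |
          split; [now exists (Re (dth1 L (Ci * RtoC y)%C)) | exact I]] |].
        rewrite_Derive D4; rewrite_Derive D1. ring. }
    assert (U := is_derive_unique _ _ _ A). rewrite (is_derive_unique _ _ _ B) in U. lra. }
  destruct (th_imag_squares L y HL) as [E1 _].
  evar_last.
  - apply (is_derive_scal_div (q3 L / q4 L) (ith1 L) (ith2 L) y _ _ D1 D2). lra.
  - set (d1 := Re (dth1 L (Ci * RtoC y)%C)) in *. set (d2 := - Im (dth2 L (Ci * RtoC y)%C)) in *.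
    set (d4 := Im (dth4 L (Ci * RtoC y)%C)) in *.
    assert (K : (d1 * ith2 L y - ith1 L y * d2) * (ith2 L y * q4 L ^ 2 * (q2 L * q3 L)) =
      ith4 L y * q2 L ^ 2 * (e1 L * q4 L * (ith2 L y * ith3 L y))).
    { rewrite <- W. transitivity ((d1 * (ith2 L y ^ 2 * q4 L ^ 2) - ith1 L y * (ith2 L y * d2 * q4 L ^ 2)) * (q2 L * q3 L)); [ring |].
      rewrite DE, E1. ring. }
    unfold period.
    transitivity (q3 L / q4 L * (((d1 * ith2 L y - ith1 L y * d2) * (ith2 L y * q4 L ^ 2 * (q2 L * q3 L))) /
       (ith2 L y ^ 3 * q4 L ^ 2 * q2 L * q3 L))); [field; lra |].
    rewrite K. field. lra.
Qed.

Lemma theta_sn_im_continuous (L y : R) : 0 < L -> continuous (theta_sn_im L) y.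
Proof. intros HL. apply (ex_derive_continuous (theta_sn_im L)). eexists. now apply theta_sn_im_derive. Qed.

Lemma theta_sn_im_0 (L : R) : 0 < L -> theta_sn_im L 0 = 0.
Proof. intros HL. unfold theta_sn_im. rewrite ith1_0 by exact HL. unfold Rdiv. ring. Qed.

Lemma theta_sn_im_derive_pos (L y : R) : 0 < L -> 0 <= y < L / 2 ->
  0 < ith4 L y / q4 L * (q2 L / ith2 L y) /\ 0 < q2 L * ith3 L y / (q3 L * ith2 L y).
Proof.
  intros HL Hy.
  assert (P2 := q2_pos L HL). assert (P3 := q3_pos L HL).
  assert (I2 := ith2_pos L y HL). assert (I3 := ith3_pos L y HL). assert (Hr := ith4_ratio_pos L y HL Hy).
  split.
  - apply Rmult_lt_0_compat; [exact Hr | now apply Rdiv_lt_0_compat].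
  - apply Rdiv_lt_0_compat; now apply Rmult_lt_0_compat.
Qed.

Lemma theta_sn_im_increasing (L x y : R) : 0 < L -> 0 <= x -> x < y -> y <= L / 2 -> theta_sn_im L x < theta_sn_im L y.
Proof.
  intros HL. apply strictly_increasing_of_derive.
  - intros z. now apply theta_sn_im_continuous.
  - intros z Hz. eexists. split; [| now apply theta_sn_im_derive].
    destruct (theta_sn_im_derive_pos L z HL Hz) as [H1 H2].
    apply Rmult_lt_0_compat; [now apply period_pos | now apply Rmult_lt_0_compat].
Qed.

(** The vanishing of [ith4] gives the square 1, and the increase from the value 0 at 0 selects the
    sign. *)
Lemma theta_sn_im_half_period (L : R) : 0 < L -> theta_sn_im L (L / 2) = 1.
Proof.
  intros HL. destruct (theta_sn_im_squares L (L / 2) HL) as [E _].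
  rewrite ith4_half_period in E by exact HL. unfold Rdiv in E. rewrite !Rmult_0_l in E.
  assert (H := theta_sn_im_increasing L 0 (L / 2) HL ltac:(lra) ltac:(lra) ltac:(lra)).
  rewrite theta_sn_im_0 in H by exact HL. fold (L / 2) in E. nra.
Qed.

Lemma theta_sn_im_bounds (L y : R) : 0 < L -> 0 <= y < L / 2 -> 0 <= theta_sn_im L y < 1.
Proof.
  intros HL Hy. split.
  - destruct (Req_dec y 0) as [->|H]; [rewrite theta_sn_im_0; lra |].
    rewrite <- (theta_sn_im_0 L HL). left. apply theta_sn_im_increasing; lra.
  - rewrite <- (theta_sn_im_half_period L HL). apply theta_sn_im_increasing; lra.
Qed.

Lemma ellF_theta_sn_im (L b : R) : 0 < L -> 0 < b <= L / 2 ->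
  ellF (theta_sn_im L b) (comodulus L) = period L * b.
Proof.
  intros HL Hb. assert (Hm := comodulus_bounds L HL).
  apply (ellF_param (comodulus L) (period L) b (theta_sn_im L b) (theta_sn_im L)); try lra.
  - now apply period_pos.
  - destruct (Req_dec b (L / 2)) as [->|H]; [rewrite theta_sn_im_half_period; lra |].
    left. apply theta_sn_im_bounds; lra.
  - now apply theta_sn_im_0.
  - intros x. now apply theta_sn_im_continuous.
  - intros x Hx. apply theta_sn_im_bounds; lra.
  - intros x Hx. destruct (theta_sn_im_squares L x HL) as [E1 E2].
    destruct (theta_sn_im_derive_pos L x HL ltac:(lra)) as [H1 H2].
    rewrite E1, E2, !sqrt_pow2 by lra. now apply theta_sn_im_derive.
Qed.

Lemma ellK_comod_theta (L : R) : 0 < L -> ellK (comod (modulus L)) = period L * (L / 2).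
Proof.
  intros HL. unfold ellK. rewrite comod_modulus by exact HL.
  rewrite <- (theta_sn_im_half_period L HL). apply ellF_theta_sn_im; lra.
Qed.

Lemma nome_theta (L : R) : 0 < L -> nome (modulus L) = exp (- L).
Proof.
  intros HL. unfold nome. rewrite ellK_comod_theta, ellK_theta by exact HL.
  assert (HP := period_pos L HL). assert (HPI := PI_RGT_0). f_equal. field. lra.
Qed.

(** In theta coordinates alpha becomes [period] times the point b at which the imaginary-axis sine
    reaches k'. Since 0 < k' < 1, b lies strictly inside the half period, where [ith1] and [ith4]
    are nonzero. *)
Lemma alpha_theta (L : R) : 0 < L ->
  exists b, 0 < b < L / 2 /\ theta_sn_im L b = comodulus L /\ alpha (modulus L) = period L * b.
Proof.
  intros HL. assert (Hm := comodulus_bounds L HL).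
  destruct (IVT_gen (theta_sn_im L) 0 (L / 2) (comodulus L)) as (b & Hb & Eb).
  - intros z. apply continuity_pt_filterlim. now apply theta_sn_im_continuous.
  - rewrite theta_sn_im_0, theta_sn_im_half_period, Rmin_left, Rmax_right by lra. lra.
  - rewrite Rmin_left, Rmax_right in Hb by lra.
    assert (Hb0 : b <> 0) by (intros ->; rewrite theta_sn_im_0 in Eb; lra).
    assert (Hb1 : b <> L / 2) by (intros ->; rewrite theta_sn_im_half_period in Eb; lra).
    exists b. split; [lra |]. split; [exact Eb |].
    unfold alpha. rewrite comod_modulus by exact HL. rewrite <- Eb at 1. apply ellF_theta_sn_im; lra.
Qed.

(** * Every modulus comes from a nome *)

Lemma exp_opp_lipschitz (a b l t : R) :
  l <= a -> l <= b -> Rabs (exp (- (a * t ^ 2)) - exp (- (b * t ^ 2))) <= Rabs (a - b) * (t ^ 2 * exp (- (l * t ^ 2))).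
Proof.
  intros Ha Hb.
  assert (K : forall a b, l <= a -> a <= b ->
    Rabs (exp (- (a * t ^ 2)) - exp (- (b * t ^ 2))) <= Rabs (a - b) * (t ^ 2 * exp (- (l * t ^ 2)))).
  { clear. intros a b Ha Hab. assert (Ht := pow2_ge_0 t).
    assert (E : exp (- (b * t ^ 2)) = exp (- (a * t ^ 2)) * exp (- ((b - a) * t ^ 2))).
    { rewrite <- exp_plus. f_equal. ring. }
    assert (H1 := exp_ge_1_plus (- ((b - a) * t ^ 2))).
    assert (H2 : exp (- (a * t ^ 2)) <= exp (- (l * t ^ 2))) by (apply exp_le; nra).
    assert (H3 := exp_pos (- (a * t ^ 2))).
    assert (H4 : exp (- (b * t ^ 2)) <= exp (- (a * t ^ 2))) by (apply exp_le; nra).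
    rewrite Rabs_pos_eq, Rabs_left1 by lra. rewrite E.
    assert (H5 : 0 <= (b - a) * t ^ 2) by (apply Rmult_le_pos; lra).
    apply Rle_trans with (exp (- (a * t ^ 2)) * ((b - a) * t ^ 2)); [nra |].
    replace (- (a - b) * (t ^ 2 * exp (- (l * t ^ 2)))) with (exp (- (l * t ^ 2)) * ((b - a) * t ^ 2)) by ring.
    now apply Rmult_le_compat_r. }
  destruct (Rle_dec a b) as [H|H].
  - now apply K.
  - rewrite Rabs_minus_sym, (Rabs_minus_sym a). apply K; lra.
Qed.

(** For all parameters at least L / 2 the terms are dominated by the Gaussian of L / 2, which gives
    a Lipschitz bound at L. The 4 in g stems from t^2 <= 4 exp |t|. *)
Lemma theta_0_continuous_L (x L : R) : 0 < L -> continuous (fun l => Re (theta 0 l (RtoC x))) L.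
Proof.
  intros HL.
  set (l := L / 2).
  set (g := fun n : Z => 4 * exp (- (l * (IZR n + 0) ^ 2) + 1 * Rabs (IZR n + 0))).
  assert (Hg : expdec g) by (apply expdec_scal, gauss_expdec; unfold l; lra).
  set (M := Zsum g).
  assert (HM : forall a, l <= a -> Rabs (Re (theta 0 a (RtoC x)) - Re (theta 0 L (RtoC x))) <= Rabs (a - L) * M).
  { intros a Ha.
    change (Rabs (Zsum (fun n => Re (theta_term 0 a (RtoC x) n)) - Zsum (fun n => Re (theta_term 0 L (RtoC x) n)))
      <= Rabs (a - L) * M).
    assert (Ha0 : 0 < a) by (unfold l in Ha; lra).
    rewrite <- Zsum_minus by (apply Cexpdec_Re, theta_term_expdec; assumption).
    unfold M. rewrite <- Zsum_scal. apply Zsum_abs_le; [| now apply expdec_scal].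
    intros n.
    assert (E : forall b, theta_term 0 b (RtoC x) n =
      (RtoC (exp (- (b * (IZR n + 0) ^ 2))) * Cexp (RtoC (2 * (IZR n + 0) * x) * Ci))%C).
    { intros b. unfold theta_term. rewrite Cexp_plus, Cexp_RtoC. do 2 f_equal. apply C_ext; simpl; ring. }
    rewrite !E, Cexp_Ci. simpl.
    set (t := IZR n + 0).
    replace (exp (- (a * (t * (t * 1)))) * cos (2 * t * x) - 0 * sin (2 * t * x) -
      (exp (- (L * (t * (t * 1)))) * cos (2 * t * x) - 0 * sin (2 * t * x))) with
      ((exp (- (a * t ^ 2)) - exp (- (L * t ^ 2))) * cos (2 * t * x)) by (simpl; ring).
    rewrite Rabs_mult.
    assert (Hc : Rabs (cos (2 * t * x)) <= 1) by (apply Rabs_le, COS_bound).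
    assert (Hd := exp_opp_lipschitz a L l t Ha ltac:(unfold l; lra)).
    apply Rle_trans with (Rabs (a - L) * (t ^ 2 * exp (- (l * t ^ 2)))).
    { assert (P := Rabs_pos (exp (- (a * t ^ 2)) - exp (- (L * t ^ 2)))).
      assert (P' := Rabs_pos (cos (2 * t * x))). nra. }
    apply Rmult_le_compat_l; [apply Rabs_pos |].
    unfold g. fold t. rewrite exp_plus, Rmult_1_l.
    assert (T : t ^ 2 <= 4 * exp (Rabs t)).
    { assert (H := exp_ge_1_plus (Rabs t / 2)).
      assert (E2 : exp (Rabs t) = exp (Rabs t / 2) * exp (Rabs t / 2)).
      { rewrite <- exp_plus. f_equal. field. }
      rewrite <- pow2_abs, E2. assert (Ht := Rabs_pos t). nra. }
    assert (P := exp_pos (- (l * t ^ 2))). nra. }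
  assert (HM0 : 0 <= M).
  { assert (H := HM (L + 1) ltac:(unfold l; lra)).
    replace (L + 1 - L) with 1 in H by ring. rewrite Rabs_R1, Rmult_1_l in H.
    eapply Rle_trans; [apply Rabs_pos | exact H]. }
  intros P [eps HP]. assert (He := cond_pos eps).
  assert (Hd : 0 < Rmin l (eps / (M + 1))).
  { apply Rmin_pos; [unfold l; lra |]. apply Rdiv_lt_0_compat; lra. }
  exists (mkposreal _ Hd). intros a Ha. change (Rabs (a - L) < Rmin l (eps / (M + 1))) in Ha.
  apply HP. change (Rabs (Re (theta 0 a (RtoC x)) - Re (theta 0 L (RtoC x))) < eps).
  assert (H1 := Rmin_l l (eps / (M + 1))). assert (H2 := Rmin_r l (eps / (M + 1))).
  assert (Hla : l <= a).
  { assert (Hb : Rabs (a - L) < l) by lra. apply Rabs_lt_between in Hb. unfold l in *. lra. }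
  eapply Rle_lt_trans; [now apply HM |].
  assert (P0 := Rabs_pos (a - L)).
  apply Rle_lt_trans with (eps / (M + 1) * M).
  - apply Rmult_le_compat_r; lra.
  - apply Rmult_lt_reg_r with (M + 1); [lra |].
    replace (eps / (M + 1) * M * (M + 1)) with (eps * M) by (field; lra). nra.
Qed.

Lemma q3_continuous (L : R) : 0 < L -> continuous q3 L.
Proof. exact (theta_0_continuous_L 0 L). Qed.

Lemma q4_continuous (L : R) : 0 < L -> continuous q4 L.
Proof.
  intros HL. apply (continuous_ext (fun l => Re (theta 0 l (RtoC (PI / 2))))).
  - intros l. unfold q4, th4. now rewrite Cplus_0_l.
  - now apply theta_0_continuous_L.
Qed.

(** For L = 1 / N^2 the terms with 0 <= n < N are at least exp(-1) >= 1/3. Hence [q3] is unbounded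
    as L tends to 0. *)
Lemma q3_ge (N : nat) : (0 < N)%nat -> INR N / 3 <= q3 (/ INR N ^ 2).
Proof.
  intros HN. assert (HN0 : 0 < INR N) by now apply lt_0_INR.
  set (L := / INR N ^ 2). assert (HL : 0 < L) by (apply Rinv_0_lt_compat, pow_lt; lra).
  set (e := fun n : Z => exp (- (L * IZR n ^ 2))).
  assert (Ee : forall n, Re (theta_term 0 L 0 n) = e n).
  { intros n. unfold theta_term. rewrite Cmult_0_r, Cmult_0_r, Cplus_0_r, Cexp_RtoC. unfold e.
    simpl. do 3 f_equal. ring. }
  assert (He := expdec_ext _ _ Ee (Cexpdec_Re _ (theta_term_expdec 0 L 0%C HL))).
  assert (Eq : q3 L = Zsum e) by (apply (Zsum_ext _ _ Ee)).
  rewrite Eq. unfold Zsum.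
  assert (Hp : forall n, 0 < e n) by (intros; apply exp_pos).
  rewrite (Series_incr_n _ N) by (try exact HN; now apply expdec_ex_series).
  assert (H1 : 0 <= Series (fun k => e (Z.of_nat (N + k)) + e (- Z.of_nat (N + k) - 1)%Z)).
  { apply Series_nonneg.
    - intros n. assert (P1 := Hp (Z.of_nat (N + n))). assert (P2 := Hp (- Z.of_nat (N + n) - 1)%Z). lra.
    - apply (ex_series_incr_n (fun k => e (Z.of_nat k) + e (- Z.of_nat k - 1)%Z) N).
      now apply expdec_ex_series. }
  assert (H2 : INR N / 3 <= sum_f_R0 (fun n => e (Z.of_nat n) + e (- Z.of_nat n - 1)%Z) (Init.Nat.pred N)).
  { assert (H3 : forall n, (n < N)%nat -> 1 / 3 <= e (Z.of_nat n)).
    { intros n Hn. unfold e. rewrite <- INR_IZR_INZ.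
      apply Rle_trans with (exp (- 1)).
      - replace (exp (- 1)) with (/ exp 1) by (rewrite <- exp_Ropp; f_equal; ring).
        assert (H := exp_le_3). assert (H' := exp_pos 1).
        unfold Rdiv. rewrite Rmult_1_l. apply Rinv_le_contravar; lra.
      - apply exp_le. apply Ropp_le_contravar. unfold L.
        apply lt_INR in Hn. assert (Hn0 := pos_INR n).
        apply Rmult_le_reg_l with (INR N ^ 2); [apply pow_lt; lra |].
        rewrite <- Rmult_assoc, Rinv_r, Rmult_1_l, Rmult_1_r by (apply pow_nonzero; lra).
        apply pow_incr; lra. }
    assert (H4 : forall m, (m < N)%nat -> INR (S m) / 3 <= sum_f_R0 (fun n => e (Z.of_nat n) + e (- Z.of_nat n - 1)%Z) m).
    { induction m as [|m IH]; intros Hm.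
      - change (1 / 3 <= e (Z.of_nat 0) + e (- Z.of_nat 0 - 1)%Z). specialize (H3 0%nat Hm).
        assert (P := Hp (- Z.of_nat 0 - 1)%Z). lra.
      - rewrite tech5. specialize (IH ltac:(lia)). rewrite (S_INR (S m)).
        specialize (H3 (S m) Hm). assert (P := Hp (- Z.of_nat (S m) - 1)%Z). lra. }
    replace N with (S (Init.Nat.pred N)) at 1 by lia. apply H4. lia. }
  lra.
Qed.

(** The series alternates with decreasing terms. Pairing neighbours from the first or from the
    second term on places its sum between -q and 0, so 1 - 2q <= q4 <= 1. *)
Lemma q4_abs_le_1 (L : R) : 0 < L -> Rabs (q4 L) <= 1.
Proof.
  intros HL. set (q := exp (- L)).
  assert (Hq : 0 < q < 1).
  { split; [apply exp_pos |]. apply Rlt_le_trans with (exp 0); [| rewrite exp_0; lra].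
    apply exp_increasing. lra. }
  set (b := fun m => (-1) ^ S m * q ^ (S m * S m)).
  assert (Eb : q4 L = 1 + 2 * Series b).
  { assert (E := th4_series L 0%C HL). apply (f_equal Re) in E. fold (q4 L) in E. rewrite E.
    assert (Ec : forall z, Ccos (z * 0)%C = 1%C).
    { intros z. unfold Ccos. rewrite !Cmult_0_r. replace (- 0)%C with (RtoC 0) by ring.
      rewrite Cexp_0. field. }
    rewrite (CSeries_ext _ (fun m => RtoC (b m))).
    - simpl Re. unfold CSeries. simpl. rewrite Rmult_0_l, Rminus_0_r. reflexivity.
    - intros m. rewrite Ec, Cmult_1_r. reflexivity. }
  assert (Hb : forall m, Rabs (b m) <= 1 * q ^ m).
  { intros m. unfold b. rewrite Rabs_mult, pow_1_abs, (Rabs_pos_eq (q ^ _)) by (apply pow_le; lra).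
    apply Rmult_le_compat_l; [lra |]. apply pow_le_antimono; [lra | lia]. }
  assert (Hex : ex_series b) by (apply (ex_series_dom b 1 q Hq Hb)).
  assert (Hsgn : forall m, (-1) ^ (2 * m) = 1) by (intros m; rewrite pow_1_even; reflexivity).
  assert (Hdom : forall n m, (m <= n)%nat -> 0 <= q ^ n <= q ^ m).
  { intros n m Hmn. split; [apply pow_le; lra | apply pow_le_antimono; lra || lia]. }
  assert (Hpair : forall c : nat -> R, (forall m, Rabs (c m) <= 1 * q ^ m) ->
    (forall m, 0 <= c (2 * m)%nat + c (2 * m + 1)%nat) -> 0 <= Series c).
  { intros c Hc H. rewrite Series_even_odd by (apply (ex_series_dom c 1 q Hq Hc)).
    apply Series_nonneg; [exact H |].
    apply (ex_series_dom _ 2 q Hq). intros m. eapply Rle_trans; [apply Rabs_triang |].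
    assert (H1 := Hc (2 * m)%nat). assert (H2 := Hc (2 * m + 1)%nat).
    assert (H3 := Hdom (2 * m)%nat m ltac:(lia)). assert (H4 := Hdom (2 * m + 1)%nat m ltac:(lia)). lra. }
  assert (Hneg : Series b <= 0).
  { assert (H : 0 <= Series (fun m => - b m)).
    { apply Hpair.
      - intros m. rewrite Rabs_Ropp. apply Hb.
      - intros m. unfold b. replace (S (2 * m + 1)) with (2 * (m + 1))%nat by lia.
        replace (S (2 * m)) with (1 + 2 * m)%nat by lia. rewrite pow_add, !Hsgn.
        assert (H := Hdom (2 * (m + 1) * (2 * (m + 1)))%nat ((1 + 2 * m) * (1 + 2 * m))%nat ltac:(nia)).
        simpl pow at 1. lra. }
    rewrite Series_opp in H. lra. }
  assert (Hge : - q <= Series b).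
  { rewrite Series_incr_1 by exact Hex.
    assert (E0 : b 0%nat = - q) by (unfold b; simpl; ring). rewrite E0.
    assert (H : 0 <= Series (fun m => b (S m))).
    { apply Hpair.
      - intros m. eapply Rle_trans; [apply Hb |]. assert (H := Hdom (S m) m ltac:(lia)). lra.
      - intros m. unfold b. replace (S (S (2 * m + 1))) with (1 + 2 * (m + 1))%nat by lia.
        replace (S (S (2 * m))) with (2 * (m + 1))%nat by lia. rewrite (pow_add (-1) 1), !Hsgn.
        assert (H := Hdom ((1 + 2 * (m + 1)) * (1 + 2 * (m + 1)))%nat (2 * (m + 1) * (2 * (m + 1)))%nat ltac:(nia)).
        rewrite pow_1. lra. }
    lra. }
  rewrite Eb. apply Rabs_le. lra.
Qed.

(** The intermediate value theorem is applied to the complementary modulus (q4 / q3)^2. Near L = 0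
    its numerator is bounded while [q3] is not, and for large L both constants are close to 1. The
    value L = 1 separates the two end points. *)
Lemma modulus_surjective (k : R) : 0 < k < 1 -> exists L, 0 < L /\ modulus L = k.
Proof.
  intros Hk. set (k' := sqrt (1 - k ^ 2)).
  assert (Hk' : 0 < k' < 1).
  { split; [apply sqrt_lt_R0; nra |]. rewrite <- sqrt_1. apply sqrt_lt_1; nra. }
  assert (Hk'2 : k' ^ 2 = 1 - k ^ 2) by (unfold k'; rewrite <- Rsqr_pow2; apply Rsqr_sqrt; nra).
  assert (Hsmall : exists a, 0 < a <= 1 /\ comodulus a < k').
  { destruct (INR_unbounded (3 / k')) as [N HN].
    assert (H3 : 3 < 3 / k').
    { apply Rmult_lt_reg_r with k'; [lra |]. replace (3 / k' * k') with 3 by (field; lra). lra. }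
    assert (HN0 : (0 < N)%nat) by (apply INR_lt; simpl; lra).
    exists (/ INR N ^ 2).
    assert (HNp : 0 < / INR N ^ 2) by (apply Rinv_0_lt_compat, pow_lt; lra).
    split.
    - split; [exact HNp |]. rewrite <- Rinv_1. apply Rinv_le_contravar; nra.
    - assert (Hq3 := q3_ge N HN0). assert (Hq4 := q4_abs_le_1 _ HNp).
      set (a := / INR N ^ 2) in *.
      assert (Hr : Rabs (q4 a / q3 a) <= 3 / INR N).
      { unfold Rdiv. rewrite Rabs_mult, (Rabs_pos_eq (/ q3 a)).
        - apply Rle_trans with (1 * / (INR N / 3)).
          + apply Rmult_le_compat; try lra; [apply Rabs_pos | left; apply Rinv_0_lt_compat; lra |].
            apply Rinv_le_contravar; lra.
          + right. field. lra.
        - left. apply Rinv_0_lt_compat. lra. }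
      assert (H4 : 3 / INR N < k').
      { apply Rmult_lt_reg_r with (INR N / k'); [apply Rdiv_lt_0_compat; lra |].
        replace (3 / INR N * (INR N / k')) with (3 / k') by (field; lra).
        replace (k' * (INR N / k')) with (INR N) by (field; lra). exact HN. }
      unfold comodulus. rewrite <- pow2_abs. assert (P := Rabs_pos (q4 a / q3 a)). nra. }
  assert (Hlarge : exists b, 1 < b /\ k' < comodulus b).
  (* With d <= 8Q both constants differ from 1 by at most d, so (q4 / q3)^2 >= (1 - 2d)^2 >= 1 - 32Q
     = 1 - (1 - k') / 2, which exceeds k'. *)
  { set (Q := (1 - k') / 64). assert (HQ : 0 < Q < 1 / 64) by (unfold Q; lra).
    exists (- ln Q).
    assert (Hb : 1 < - ln Q).
    { assert (H := exp_le_3). assert (H' := exp_pos 1).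
      assert (Hl : ln Q < ln (/ exp 1)).
      { apply ln_increasing; [lra |]. apply Rlt_le_trans with (/ 3); [lra |].
        apply Rinv_le_contravar; lra. }
      rewrite ln_Rinv, ln_exp in Hl by exact H'. lra. }
    split; [exact Hb |]. set (b := - ln Q) in *.
    assert (EQ : exp (- ((1 - 2 * 0) * b)) = Q).
    { unfold b. replace (- ((1 - 2 * 0) * - ln Q)) with (ln Q) by ring. apply exp_ln. lra. }
    assert (B4 := th4_sub_1_bound b 0 0%C ltac:(lra) ltac:(lra) ltac:(simpl; rewrite Rabs_R0; lra)).
    assert (B3 := th4_sub_1_bound b 0 (0 + RtoC (PI / 2))%C ltac:(lra) ltac:(lra) ltac:(simpl; rewrite Rplus_0_l, Rabs_R0; lra)).
    rewrite th4_PI2 in B3 by lra. rewrite EQ in B3, B4.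
    set (d := 4 * (Q / (1 - Q))) in *.
    assert (Hd : 0 < d <= 8 * Q).
    { unfold d. split.
      - apply Rmult_lt_0_compat; [lra |]. apply Rdiv_lt_0_compat; lra.
      - apply Rmult_le_reg_r with (1 - Q); [lra |].
        replace (4 * (Q / (1 - Q)) * (1 - Q)) with (4 * Q) by (field; lra). nra. }
    assert (C4 : Rabs (q4 b - 1) <= d).
    { eapply Rle_trans; [| exact B4]. apply (re_le_Cmod (th4 b 0 - 1)%C). }
    assert (C3 : Rabs (q3 b - 1) <= d).
    { eapply Rle_trans; [| exact B3]. apply (re_le_Cmod (th3 b 0 - 1)%C). }
    apply Rabs_le_between in C3. apply Rabs_le_between in C4.
    assert (Hr : 1 - 2 * d <= q4 b / q3 b).
    { apply Rmult_le_reg_r with (q3 b); [lra |]. unfold Rdiv. rewrite Rmult_assoc, Rinv_l by lra. nra. }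
    unfold comodulus.
    assert (8 * Q <= 1 / 8) by lra.
    assert ((1 - 2 * d) ^ 2 <= (q4 b / q3 b) ^ 2) by (apply pow_incr; lra).
    assert (k' < (1 - 2 * d) ^ 2).
    { assert (64 * Q = 1 - k') by (unfold Q; field). nra. }
    lra. }
  destruct Hsmall as (a & Ha & Hca). destruct Hlarge as (b & Hb & Hcb).
  assert (Hab : a < b) by lra.
  destruct (Ranalysis5.IVT_interv (fun l => comodulus l - k') a b) as (L & HL & EL); try lra.
  - intros l Hl. apply continuity_pt_filterlim.
    assert (Hl0 : 0 < l) by lra.
    apply (continuous_minus (V := R_NormedModule) comodulus (fun _ => k')); [| apply continuous_const].
    unfold comodulus.
    apply (continuous_comp (fun l => q4 l / q3 l) (fun r => r ^ 2)).
    + apply (continuous_mult (K := R_AbsRing) q4 (fun l => / q3 l)); [now apply q4_continuous |].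
      apply continuous_Rinv_comp; [now apply q3_continuous |]. apply Rgt_not_eq. now apply q3_pos.
    + apply (ex_derive_continuous (fun r => r ^ 2)). auto_derive. exact I.
  - assert (HL0 : 0 < L) by lra. exists L. split; [exact HL0 |].
    assert (E := comodulus_sq L HL0). fold (comodulus L) in E.
    replace (comodulus L) with k' in E by lra.
    assert (Hm := modulus_bounds L HL0). nra.
Qed.

(** * The functions w_1 and w_2 *)

Lemma Theta_th4 (L : R) (z : C) : 0 < L -> Theta z (modulus L) = th4 L (RtoC (/ period L) * z)%C.
Proof.
  intros HL. assert (HP := period_pos L HL). assert (HPI := PI_RGT_0).
  rewrite th4_series by exact HL. unfold Theta. do 2 f_equal. apply CSeries_ext. intros m.
  rewrite nome_theta, ellK_theta by exact HL. do 2 f_equal.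
  rewrite Cmult_assoc, <- RtoC_mult. f_equal. f_equal. field. lra.
Qed.

Lemma Eta_th1 (L : R) (z : C) : 0 < L -> Eta z (modulus L) = th1 L (RtoC (/ period L) * z)%C.
Proof.
  intros HL. assert (HP := period_pos L HL). assert (HPI := PI_RGT_0).
  rewrite th1_series by exact HL. unfold Eta. f_equal. apply CSeries_ext. intros m.
  rewrite nome_theta, ellK_theta by exact HL. do 2 f_equal.
  rewrite Cmult_assoc, <- RtoC_mult. f_equal. f_equal. field. lra.
Qed.

Lemma zeta_theta (L : R) (z : C) : 0 < L ->
  zeta z (modulus L) = (RtoC (/ period L) * dth4 L (RtoC (/ period L) * z) / th4 L (RtoC (/ period L) * z))%C.
Proof.
  intros HL. unfold zeta. rewrite Theta_th4 by exact HL. f_equal.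
  apply is_C_derive_unique, Cder_is_derive.
  apply (Cder_ext (fun y => th4 L (0 + RtoC (/ period L) * y)%C) _ _ (RtoC (/ period L) * dth4 L (0 + RtoC (/ period L) * z))%C).
  - intros y. rewrite Theta_th4 by exact HL. now rewrite Cplus_0_l.
  - now rewrite Cplus_0_l.
  - apply Cder_affine. now apply th4_Cder.
Qed.

(** [th4] is real along the imaginary axis, so its derivative in the direction i is real. *)
Lemma dth4_imag (L y : R) : 0 < L ->
  dth4 L (Ci * RtoC y)%C = (Ci * RtoC (Im (dth4 L (Ci * RtoC y)%C)))%C.
Proof.
  intros HL.
  destruct (Cder_vertical (th4 L) (dth4 L) 0%C y (fun z => th4_Cder L z HL)) as [_ H].
  assert (H0 : is_derive (fun t : R => Im (th4 L (0 + Ci * RtoC t)%C)) y 0).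
  { apply (is_derive_ext (fun _ => 0)).
    - intros t. rewrite Cplus_0_l, ith4_spec by exact HL. reflexivity.
    - apply (is_derive_const (K := R_AbsRing) (V := R_NormedModule)). }
  assert (E : Re (dth4 L (0 + Ci * RtoC y)%C) = 0).
  { rewrite <- (is_derive_unique _ _ _ H). exact (is_derive_unique _ _ _ H0). }
  rewrite Cplus_0_l in E. destruct (dth4 L (Ci * RtoC y)%C) as [a b]. simpl in E. subst a.
  apply C_ext; simpl; ring.
Qed.

(** zeta(i alpha) is i times this number divided by [period]: the exponential factor of [w_plus] is
    a rotation of constant speed. *)
Definition phase_rate (L b : R) : R := Im (dth4 L (Ci * RtoC b)%C) / ith4 L b.

Lemma w_plus_theta (L b s : R) : 0 < L -> 0 <= b < L / 2 -> alpha (modulus L) = period L * b ->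
  w_plus (modulus L) s =
  (Cconj (th1 L (RtoC (s / period L) + Ci * RtoC b)) / th4 L (RtoC (s / period L))
   * Cexp (RtoC (phase_rate L b * (s / period L)) * Ci))%C.
Proof.
  intros HL Hb Ha. assert (HP := period_pos L HL).
  unfold w_plus. rewrite Eta_th1, Theta_th4, zeta_theta, Ha by exact HL.
  assert (Ez : (RtoC (/ period L) * (Ci * RtoC (period L * b)) = Ci * RtoC b)%C).
  { apply C_ext; simpl; field; lra. }
  rewrite Ez.
  replace (RtoC (/ period L) * (RtoC s - Ci * RtoC (period L * b)))%C
    with (Cconj (RtoC (s / period L) + Ci * RtoC b)) by (apply C_ext; simpl; field; lra).
  replace (RtoC (/ period L) * RtoC s)%C with (RtoC (s / period L)) by (apply C_ext; simpl; field; lra).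
  rewrite th1_Cconj by exact HL. f_equal. f_equal.
  rewrite dth4_imag, ith4_spec by exact HL. unfold phase_rate.
  assert (H4 := ith4_neq_0 L b HL Hb).
  set (m := Im (dth4 L (Ci * RtoC b)%C)).
  unfold Cdiv. rewrite <- (RtoC_inv (ith4 L b)) by exact H4.
  apply C_ext; simpl; field; split; lra.
Qed.

Lemma th1_add_imag_sq (L b x : R) : 0 < L ->
  (Re (th1 L (RtoC x + Ci * RtoC b)%C) ^ 2 + Im (th1 L (RtoC x + Ci * RtoC b)%C) ^ 2) * q4 L ^ 2 =
  Re (th1 L (RtoC x)) ^ 2 * ith4 L b ^ 2 + Re (th4 L (RtoC x)) ^ 2 * ith1 L b ^ 2.
Proof.
  intros HL. assert (A := th1_addition L (RtoC x) (Ci * RtoC b)%C HL).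
  replace (RtoC x - Ci * RtoC b)%C with (Cconj (RtoC x + Ci * RtoC b)) in A by (apply C_ext; simpl; ring).
  rewrite th1_Cconj, ith1_spec, ith4_spec, (th1_real L x), (th4_real L x), q4_spec in A by exact HL.
  destruct (th1 L (RtoC x + Ci * RtoC b)%C) as [g h].
  apply (f_equal Re) in A. simpl in A. simpl. lra.
Qed.

(** By the Cauchy-Riemann equations the derivative of |th1(x + i b)|^2 in b is twice the cross term
    in the x-derivatives. Differentiating [th1_add_imag_sq] in b therefore yields the horizontal
    Wronskian. *)
Lemma th1_add_imag_cross (L b x : R) : 0 < L ->
  (Im (th1 L (RtoC x + Ci * RtoC b)%C) * Re (dth1 L (RtoC x + Ci * RtoC b)%C)
   - Re (th1 L (RtoC x + Ci * RtoC b)%C) * Im (dth1 L (RtoC x + Ci * RtoC b)%C)) * q4 L ^ 2 =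
  Re (th1 L (RtoC x)) ^ 2 * (ith4 L b * - Im (dth4 L (Ci * RtoC b)%C))
  + Re (th4 L (RtoC x)) ^ 2 * (ith1 L b * Re (dth1 L (Ci * RtoC b)%C)).
Proof.
  intros HL.
  destruct (Cder_vertical (th1 L) (dth1 L) (RtoC x) b (fun z => th1_Cder L z HL)) as [Dr Di].
  destruct (th_imag_derive L b HL) as (D1 & _ & D4).
  set (g := fun t : R => Re (th1 L (RtoC x + Ci * RtoC t)%C)) in *.
  set (h := fun t : R => Im (th1 L (RtoC x + Ci * RtoC t)%C)) in *.
  set (u := dth1 L (RtoC x + Ci * RtoC b)%C) in *.
  set (r1 := Re (th1 L (RtoC x))). set (r4 := Re (th4 L (RtoC x))).
  assert (A : is_derive (fun t => (g t ^ 2 + h t ^ 2) * q4 L ^ 2) b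
     (2 * ((h b * Re u - g b * Im u) * q4 L ^ 2))).
  { auto_derive; [split; [now exists (- Im u) | split; [now exists (Re u) | exact I]] |].
    rewrite_Derive Dr; rewrite_Derive Di. ring. }
  assert (B : is_derive (fun t => (g t ^ 2 + h t ^ 2) * q4 L ^ 2) b
     (2 * (r1 ^ 2 * (ith4 L b * - Im (dth4 L (Ci * RtoC b)%C)) + r4 ^ 2 * (ith1 L b * Re (dth1 L (Ci * RtoC b)%C))))).
  { apply (is_derive_ext (fun t => r1 ^ 2 * ith4 L t ^ 2 + r4 ^ 2 * ith1 L t ^ 2)).
    - intros t. symmetry. exact (th1_add_imag_sq L t x HL).
    - auto_derive; [split; [now exists (- Im (dth4 L (Ci * RtoC b)%C)) |
          split; [now exists (Re (dth1 L (Ci * RtoC b)%C)) | exact I]] |].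
      rewrite_Derive D4; rewrite_Derive D1. ring. }
  assert (U := is_derive_unique _ _ _ A). rewrite (is_derive_unique _ _ _ B) in U.
  change (Im (th1 L (RtoC x + Ci * RtoC b)%C)) with (h b).
  change (Re (th1 L (RtoC x + Ci * RtoC b)%C)) with (g b). lra.
Qed.

(* The real and imaginary parts of [conj(g) / t * exp(i l x)]. *)
Lemma rotating_pair_derive (g h t : R -> R) (l c x g' h' t' : R) :
  is_derive g x g' -> is_derive h x h' -> is_derive t x t' -> t x <> 0 ->
  let u := fun y => c * ((g y * cos (l * y) + h y * sin (l * y)) / t y) in
  let v := fun y => c * ((g y * sin (l * y) - h y * cos (l * y)) / t y) in
  exists u' v', is_derive u x u' /\ is_derive v x v' /\
    u x ^ 2 + v x ^ 2 = c ^ 2 * ((g x ^ 2 + h x ^ 2) / t x ^ 2) /\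
    u x * v' - u' * v x = c ^ 2 * ((h x * g' - g x * h' + l * (g x ^ 2 + h x ^ 2)) / t x ^ 2).
Proof.
  intros Dg Dh Dt Ht u v.
  assert (Hsc := sin2_cos2 (l * x)). unfold Rsqr in Hsc.
  set (S := sin (l * x)) in *. set (K := cos (l * x)) in *.
  assert (Du : is_derive (fun y => g y * cos (l * y) + h y * sin (l * y)) x
     (g' * K - g x * l * S + h' * S + h x * l * K)).
  { auto_derive; [split; [now exists g' | split; [now exists h' | exact I]] |].
    rewrite_Derive Dg; rewrite_Derive Dh.
    unfold S, K. ring. }
  assert (Dv : is_derive (fun y => g y * sin (l * y) - h y * cos (l * y)) x
     (g' * S + g x * l * K - h' * K + h x * l * S)).
  { auto_derive; [split; [now exists g' | split; [now exists h' | exact I]] |].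
    rewrite_Derive Dg; rewrite_Derive Dh.
    unfold S, K. ring. }
  eexists. eexists.
  split; [apply (is_derive_scal_div c _ t x _ _ Du Dt Ht) |].
  split; [apply (is_derive_scal_div c _ t x _ _ Dv Dt Ht) |].
  unfold u, v. fold S K. split.
  - transitivity (c ^ 2 * ((g x ^ 2 + h x ^ 2) * (S * S + K * K) / t x ^ 2)); [field; exact Ht |].
    rewrite Hsc. field. exact Ht.
  - transitivity (c ^ 2 * ((h x * g' - g x * h' + l * (g x ^ 2 + h x ^ 2)) * (S * S + K * K) / t x ^ 2)); [field; exact Ht |].
    rewrite Hsc. field. exact Ht.
Qed.

(** Here the choice of alpha is used: with the imaginary-axis sine equal to k' at b, the first ratio
    gives sn^2 the coefficient k^2 in |w|^2, and the second gives the factor sqrt(2 - k^2) of the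
    Wronskian. *)
Lemma ith_ratio_squares (L b : R) : 0 < L -> 0 < b < L / 2 -> theta_sn_im L b = comodulus L ->
  0 < ith1 L b / q4 L /\
  (ith4 L b / ith1 L b) ^ 2 = modulus L / comodulus L ^ 2 /\
  ith2 L b / ith1 L b * (ith3 L b / ith4 L b) * comodulus L ^ 2 = sqrt (2 - modulus L ^ 2).
Proof.
  intros HL Hb Ht. assert (Hm := modulus_bounds L HL). assert (Hc := comodulus_bounds L HL).
  assert (P2 := q2_pos L HL). assert (P3 := q3_pos L HL). assert (P4 := q4_neq_0 L HL).
  assert (I2 := ith2_pos L b HL). assert (I3 := ith3_pos L b HL).
  assert (Hr := ith4_ratio_pos L b HL ltac:(lra)).
  destruct (th_imag_squares L b HL) as [E1 E2].
  assert (Ec := comodulus_sq L HL). fold (comodulus L) in Ec.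
  assert (I4 := ith4_neq_0 L b HL ltac:(lra)).
  assert (A1 : ith1 L b / q4 L = comodulus L * ith2 L b / q3 L).
  { rewrite <- Ht. unfold theta_sn_im. field. lra. }
  assert (Pr : 0 < ith1 L b / q4 L).
  { rewrite A1. apply Rdiv_lt_0_compat; [apply Rmult_lt_0_compat; lra | lra]. }
  split; [exact Pr |].
  set (a := ith1 L b / q4 L) in *. set (d := ith4 L b / q4 L) in *.
  assert (Ea : ith1 L b = a * q4 L) by (unfold a; field; lra).
  assert (Ed : ith4 L b = d * q4 L) by (unfold d; field; lra).
  assert (Em : modulus L = q2 L ^ 2 / q3 L ^ 2) by (unfold modulus; field; lra).
  assert (Ek : comodulus L = q4 L ^ 2 / q3 L ^ 2) by (unfold comodulus; field; lra).
  set (k := modulus L) in *. set (k' := comodulus L) in *.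
  assert (Q2 : q2 L ^ 2 = k * q3 L ^ 2) by (rewrite Em; field; lra).
  assert (Q4 : q4 L ^ 2 = k' * q3 L ^ 2) by (rewrite Ek; field; lra).
  assert (N2 : ith2 L b = a * q3 L / k') by (rewrite A1; field; lra).
  assert (Hd2 : d ^ 2 * k' ^ 2 = k * a ^ 2).
  { rewrite Ea, Ed, N2 in E1.
    assert (F : (a * q3 L / k') ^ 2 * q4 L ^ 2 * (k' ^ 2 / (q4 L ^ 2 * q3 L ^ 2)) =
       ((d * q4 L) ^ 2 * q2 L ^ 2 + (a * q4 L) ^ 2 * q3 L ^ 2) * (k' ^ 2 / (q4 L ^ 2 * q3 L ^ 2))) by now rewrite E1.
    rewrite Q2 in F.
    replace ((a * q3 L / k') ^ 2 * q4 L ^ 2 * (k' ^ 2 / (q4 L ^ 2 * q3 L ^ 2))) with (a ^ 2) in F by (field; lra).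
    replace (((d * q4 L) ^ 2 * (k * q3 L ^ 2) + (a * q4 L) ^ 2 * q3 L ^ 2) * (k' ^ 2 / (q4 L ^ 2 * q3 L ^ 2)))
      with (d ^ 2 * k * k' ^ 2 + a ^ 2 * k' ^ 2) in F by (field; lra).
    apply Rmult_eq_reg_l with k; [| lra]. replace (k' ^ 2) with (1 - k ^ 2) in * by lra. lra. }
  split.
  - replace (ith4 L b / ith1 L b) with (d / a) by (rewrite Ea, Ed; field; lra).
    apply Rmult_eq_reg_r with (a ^ 2 * k' ^ 2); [| apply Rmult_integral_contrapositive_currified; apply pow_nonzero; lra].
    transitivity (d ^ 2 * k' ^ 2); [field; lra |]. rewrite Hd2. field. lra.
  (* Both sides are nonnegative, so squares are compared; the common value is 2 - k^2 = 1 + k'^2. *)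
  - apply Rsqr_inj.
    + apply Rmult_le_pos; [left | apply pow2_ge_0].
      replace (ith2 L b / ith1 L b * (ith3 L b / ith4 L b)) with (ith2 L b / a * (ith3 L b / d) / q4 L ^ 2).
      * apply Rdiv_lt_0_compat; [apply Rmult_lt_0_compat; apply Rdiv_lt_0_compat; lra | now apply pow2_gt_0].
      * rewrite Ea, Ed. field. lra.
    + apply sqrt_pos.
    + rewrite Rsqr_sqrt by nra. unfold Rsqr.
      transitivity ((ith2 L b ^ 2 * q4 L ^ 2) * (ith3 L b ^ 2 * q4 L ^ 2) * k' ^ 4 / (ith1 L b ^ 2 * ith4 L b ^ 2 * q4 L ^ 4)).
      { field. repeat split; try lra. rewrite Ea. apply Rmult_integral_contrapositive_currified; lra. }
      rewrite E2. rewrite Ea, Ed, N2.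
      transitivity (q3 L ^ 2 * (d ^ 2 * k' ^ 2 * q3 L ^ 2 + (k' ^ 2) * a ^ 2 * q2 L ^ 2) / (d ^ 2 * q4 L ^ 2 * q4 L ^ 2)).
      { field. repeat split; lra. }
      rewrite Q2, Q4.
      transitivity ((d ^ 2 * k' ^ 2 + (k * a ^ 2) * k' ^ 2) / (d ^ 2 * k' ^ 2)).
      { field. repeat split; lra. }
      rewrite <- Hd2.
      transitivity (1 + k' ^ 2); [field; repeat split; lra | lra].
Qed.

Lemma w_derive (k s : R) : 0 < k < 1 ->
  exists w1' w2', is_derive (w1 k) s w1' /\ is_derive (w2 k) s w2' /\
    w1 k s ^ 2 + w2 k s ^ 2 = 2 - k ^ 2 - dn s k ^ 2 /\
    w1 k s * w2' - w1' * w2 k s = sqrt (1 - k ^ 2) * sqrt (2 - k ^ 2).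
Proof.
  intros Hk. destruct (modulus_surjective k Hk) as (L & HL & <-).
  destruct (alpha_theta L HL) as (b & Hb & Et & Ea).
  assert (HP := period_pos L HL). assert (Hm := modulus_bounds L HL). assert (Hc := comodulus_bounds L HL).
  assert (P2 := q2_pos L HL). assert (P3 := q3_pos L HL). assert (P4 := q4_neq_0 L HL).
  assert (Ek : sqrt (1 - modulus L ^ 2) = comodulus L) by now apply comod_modulus.
  destruct (ith_ratio_squares L b HL Hb Et) as (Pr & R1 & R2).
  assert (I1 : ith1 L b <> 0) by (intros H; rewrite H in Pr; unfold Rdiv in Pr; lra).
  assert (I4 := ith4_neq_0 L b HL ltac:(lra)).
  set (g := fun x : R => Re (th1 L (RtoC x + Ci * RtoC b)%C)).
  set (h := fun x : R => Im (th1 L (RtoC x + Ci * RtoC b)%C)).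
  set (t := fun x : R => Re (th4 L (RtoC x))).
  set (l := phase_rate L b).
  (* This is k' / Im(w_+(0)), because Im(w_+(0)) = - ith1(b) / q4. *)
  set (c := - (comodulus L * q4 L / ith1 L b)).
  assert (Ew : forall z, w_complex (modulus L) z =
     (c * ((g (z / period L) * cos (l * (z / period L)) + h (z / period L) * sin (l * (z / period L))) / t (z / period L)),
      c * ((g (z / period L) * sin (l * (z / period L)) - h (z / period L) * cos (l * (z / period L))) / t (z / period L)))).
  { assert (Ep : forall z, w_plus (modulus L) z =
      ((g (z / period L) * cos (l * (z / period L)) + h (z / period L) * sin (l * (z / period L))) / t (z / period L),
       (g (z / period L) * sin (l * (z / period L)) - h (z / period L) * cos (l * (z / period L))) / t (z / period L))).
    { intros z. rewrite (w_plus_theta L b z HL ltac:(lra) Ea). rewrite th4_real, Cexp_Ci by exact HL.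
      assert (N := th4_Re_neq_0 L (z / period L) HL). fold l.
      change (Re (th4 L (RtoC (z / period L)))) with (t (z / period L)) in *.
      unfold g, h. destruct (th1 L (RtoC (z / period L) + Ci * RtoC b)%C) as [a d].
      unfold Cdiv. rewrite <- RtoC_inv by exact N. apply C_ext; simpl; field; exact N. }
    intros z. unfold w_complex. rewrite !Ep.
    assert (E0 : Im ((g (0 / period L) * cos (l * (0 / period L)) + h (0 / period L) * sin (l * (0 / period L))) / t (0 / period L),
       (g (0 / period L) * sin (l * (0 / period L)) - h (0 / period L) * cos (l * (0 / period L))) / t (0 / period L))
       = - (ith1 L b / q4 L)).
    { assert (Z0 : 0 / period L = 0) by (unfold Rdiv; ring).
      rewrite Z0. simpl Im. rewrite Rmult_0_r, sin_0, cos_0.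
      unfold g, h, t. rewrite Cplus_0_l, ith1_spec by exact HL. change (Re (th4 L (RtoC 0))) with (q4 L).
      simpl. field. lra. }
    rewrite E0, Ek. unfold c. apply C_ext; simpl; field; repeat split; try lra; try assumption;
      apply th4_Re_neq_0; exact HL. }
  set (x := s / period L).
  assert (Dg : is_derive g x (Re (dth1 L (RtoC x + Ci * RtoC b)%C))) by
    exact (proj1 (Cder_horizontal (th1 L) (dth1 L) (Ci * RtoC b)%C x (fun z => th1_Cder L z HL))).
  assert (Dh : is_derive h x (Im (dth1 L (RtoC x + Ci * RtoC b)%C))) by
    exact (proj2 (Cder_horizontal (th1 L) (dth1 L) (Ci * RtoC b)%C x (fun z => th1_Cder L z HL))).
  assert (Dt : is_derive t x (Re (dth4 L (RtoC x))))
    by exact (proj2 (proj2 (proj2 (th_real_derive L x HL)))).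
  assert (Nt : t x <> 0) by now apply th4_Re_neq_0.
  destruct (rotating_pair_derive g h t l c x _ _ _ Dg Dh Dt Nt) as (u' & v' & Du & Dv & Esq & Ecr).
  assert (Dx : is_derive (fun z => z / period L) s (/ period L)).
  { auto_derive; [exact I | field; lra]. }
  exists (/ period L * u'), (/ period L * v').
  split; [| split; [| split]].
  - apply (is_derive_ext (fun z => (fun y => c * ((g y * cos (l * y) + h y * sin (l * y)) / t y)) (z / period L))).
    + intros z. unfold w1. now rewrite Ew.
    + exact (is_derive_comp _ (fun z => z / period L) s _ _ Du Dx).
  - apply (is_derive_ext (fun z => (fun y => c * ((g y * sin (l * y) - h y * cos (l * y)) / t y)) (z / period L))).
    + intros z. unfold w2. now rewrite Ew.
    + exact (is_derive_comp _ (fun z => z / period L) s _ _ Dv Dx).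
  - unfold w1, w2. rewrite Ew. fold x. simpl Re. simpl Im. rewrite Esq.
    assert (Es : dn s (modulus L) = theta_dn L x).
    { rewrite <- dn_theta by exact HL. f_equal. unfold x. field. lra. }
    rewrite Es. destruct (theta_sn_cn_dn_squares L x HL) as [_ ->].
    assert (A := th1_add_imag_sq L b x HL).
    change (Re (th1 L (RtoC x + Ci * RtoC b)%C)) with (g x) in A.
    change (Im (th1 L (RtoC x + Ci * RtoC b)%C)) with (h x) in A.
    change (Re (th4 L (RtoC x))) with (t x) in A.
    transitivity (comodulus L ^ 2 / ith1 L b ^ 2 / t x ^ 2 * ((g x ^ 2 + h x ^ 2) * q4 L ^ 2)).
    { unfold c. field. split; assumption. }
    rewrite A.
    transitivity (comodulus L ^ 2 + comodulus L ^ 2 * (ith4 L b / ith1 L b) ^ 2 * (Re (th1 L (RtoC x)) / t x) ^ 2).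
    { field. split; assumption. }
    rewrite R1.
    assert (Ej : theta_sn L x ^ 2 * modulus L = (Re (th1 L (RtoC x)) / t x) ^ 2).
    { unfold theta_sn, modulus. fold (t x). field. lra. }
    rewrite <- Ej. assert (Ec := comodulus_sq L HL). fold (comodulus L) in Ec.
    transitivity (comodulus L ^ 2 + modulus L ^ 2 * theta_sn L x ^ 2); [field; lra | lra].
  - unfold w1, w2. rewrite Ew. fold x. simpl Re. simpl Im.
    transitivity (/ period L * (c * ((g x * cos (l * x) + h x * sin (l * x)) / t x) * v'
        - u' * (c * ((g x * sin (l * x) - h x * cos (l * x)) / t x)))); [ring |].
    rewrite Ecr, Ek.
    assert (A := th1_add_imag_sq L b x HL). assert (B := th1_add_imag_cross L b x HL).
    change (Re (th1 L (RtoC x + Ci * RtoC b)%C)) with (g x) in A, B.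
    change (Im (th1 L (RtoC x + Ci * RtoC b)%C)) with (h x) in A, B.
    change (Re (th4 L (RtoC x))) with (t x) in A, B.
    assert (W := th_imag_wronskian L b HL).
    set (dg := dth1 L (RtoC x + Ci * RtoC b)%C) in *.
    set (r1 := Re (th1 L (RtoC x))) in *.
    set (m1 := Re (dth1 L (Ci * RtoC b)%C)) in *.
    assert (El : l = Im (dth4 L (Ci * RtoC b)%C) / ith4 L b) by reflexivity.
    set (m4 := Im (dth4 L (Ci * RtoC b)%C)) in *.
    (* The phase rate l is exactly such that the two terms with r1^2 cancel. What remains is
       proportional to t(x)^2, hence constant after division by it. *)
    assert (X : (h x * Re dg - g x * Im dg + l * (g x ^ 2 + h x ^ 2)) * q4 L ^ 2 =
       t x ^ 2 * ith1 L b * (m1 * ith4 L b + ith1 L b * m4) / ith4 L b).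
    { transitivity ((h x * Re dg - g x * Im dg) * q4 L ^ 2 + l * ((g x ^ 2 + h x ^ 2) * q4 L ^ 2)); [ring |].
      rewrite A, B, El. field. exact I4. }
    transitivity (/ period L * (comodulus L ^ 2 / ith1 L b ^ 2 / t x ^ 2 *
       ((h x * Re dg - g x * Im dg + l * (g x ^ 2 + h x ^ 2)) * q4 L ^ 2))).
    { unfold c. field. repeat split; try assumption; lra. }
    rewrite X.
    transitivity (/ period L * (comodulus L ^ 2 / (ith1 L b * ith4 L b * (q2 L * q3 L)) * ((m1 * ith4 L b + ith1 L b * m4) * (q2 L * q3 L)))).
    { field. repeat split; try assumption; lra. }
    rewrite W, <- R2.
    assert (E4 : comodulus L = q4 L ^ 2 / q3 L ^ 2) by (unfold comodulus; field; lra).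
    assert (Pe : e1 L <> 0).
    { intros H. unfold period in HP. rewrite H in HP. unfold Rdiv in HP. lra. }
    rewrite E4. unfold period. field. repeat split; try assumption; lra.
Qed.

(** * Shift and differential equations of dn *)

Lemma dn_pos (k u : R) : 0 < k < 1 -> 0 < dn u k.
Proof.
  intros Hk. destruct (modulus_surjective k Hk) as (L & HL & <-).
  assert (HP := period_pos L HL).
  replace u with (period L * (u / period L)) by (field; lra). rewrite dn_theta by exact HL. now apply theta_dn_pos.
Qed.

Lemma dn_add_ellK (k u : R) : 0 < k < 1 -> dn (u + ellK k) k * dn u k = sqrt (1 - k ^ 2).
Proof.
  intros Hk. destruct (modulus_surjective k Hk) as (L & HL & <-).
  assert (HP := period_pos L HL).
  rewrite ellK_theta by exact HL.
  replace (u + period L * (PI / 2)) with (period L * (u / period L + PI / 2)) by (field; lra).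
  replace (dn u (modulus L)) with (dn (period L * (u / period L)) (modulus L)) by (f_equal; field; lra).
  rewrite !dn_theta, theta_dn_shift by exact HL. symmetry. now apply comod_modulus.
Qed.

Lemma theta_dn_derive (L x : R) : 0 < L ->
  is_derive (theta_dn L) x (- (modulus L ^ 2 * period L * (theta_sn L x * theta_cn L x))).
Proof.
  intros HL. assert (Hd := theta_dn_pos L x HL). assert (Ds := theta_sn_derive L x HL).
  apply (is_derive_ext (fun y => sqrt (1 - modulus L ^ 2 * theta_sn L y ^ 2))).
  - intros y. destruct (theta_sn_cn_dn_squares L y HL) as [_ <-].
    apply sqrt_pow2. left. now apply theta_dn_pos.
  - destruct (theta_sn_cn_dn_squares L x HL) as [_ E].
    assert (E' : 1 + - (modulus L ^ 2 * theta_sn L x ^ 2) = theta_dn L x ^ 2) by lra.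
    auto_derive.
    + split; [eexists; exact Ds | split; [| exact I]].
      replace (1 + - (modulus L * (modulus L * 1) * (theta_sn L x * (theta_sn L x * 1)))) with (theta_dn L x ^ 2) by (rewrite E; ring).
      now apply pow_lt.
    + rewrite_Derive Ds.
      replace (1 + - (modulus L * (modulus L * 1) * (theta_sn L x * (theta_sn L x * 1)))) with (theta_dn L x ^ 2) by (rewrite E; ring).
      rewrite sqrt_pow2 by lra. field. lra.
Qed.

Lemma dn_derive (k : R) : 0 < k < 1 ->
  exists dn', forall u, is_derive (fun v => dn v k) u (dn' u) /\
    is_derive dn' u ((2 - k ^ 2) * dn u k - 2 * dn u k ^ 3) /\
    dn' u ^ 2 = - (1 - k ^ 2) + (2 - k ^ 2) * dn u k ^ 2 - dn u k ^ 4.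
Proof.
  intros Hk. destruct (modulus_surjective k Hk) as (L & HL & <-).
  assert (HP := period_pos L HL).
  (* The derivative - k^2 sn cn is given as an explicit function because it is differentiated once
     more. *)
  exists (fun u => - (modulus L ^ 2 * (theta_sn L (u / period L) * theta_cn L (u / period L)))).
  intros u. set (x := u / period L).
  assert (Ed : forall v, theta_dn L (v / period L) = dn v (modulus L)).
  { intros v. rewrite <- dn_theta by exact HL. f_equal. field. lra. }
  assert (Dx : is_derive (fun z => z / period L) u (/ period L)) by (auto_derive; [exact I | field; lra]).
  assert (Ds := theta_sn_derive L x HL). assert (Dc := theta_cn_derive L x HL). assert (Dd := theta_dn_derive L x HL).
  destruct (theta_sn_cn_dn_squares L x HL) as [E1 E2].
  rewrite <- Ed. fold x. set (m := modulus L) in *.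
  split; [| split].
  - apply (is_derive_ext (fun v => theta_dn L (v / period L))); [exact Ed |].
    evar_last; [exact (is_derive_comp (theta_dn L) (fun z => z / period L) u _ _ Dd Dx) |].
    change scal with Rmult. match goal with |- @eq _ ?a ?b => change (@eq R a b) end. field. lra.
  - assert (D : is_derive (fun y => - (m ^ 2 * (theta_sn L y * theta_cn L y))) x
       (period L * ((2 - m ^ 2) * theta_dn L x - 2 * theta_dn L x ^ 3))).
    { auto_derive; [split; [eexists; exact Ds | split; [eexists; exact Dc | exact I]] |].
      rewrite_Derive Ds; rewrite_Derive Dc.
      assert (Ec : theta_cn L x ^ 2 = 1 - theta_sn L x ^ 2) by lra.
      replace (theta_dn L x ^ 3) with (theta_dn L x * theta_dn L x ^ 2) by ring. rewrite E2.
      transitivity (- (m ^ 2 * period L * theta_dn L x * (theta_cn L x ^ 2 - theta_sn L x ^ 2))); [ring |].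
      rewrite Ec. ring. }
    evar_last; [exact (is_derive_comp (fun y => - (m ^ 2 * (theta_sn L y * theta_cn L y))) (fun z => z / period L) u _ _ D Dx) |].
    change scal with Rmult. match goal with |- @eq _ ?a ?b => change (@eq R a b) end. field. lra.
  - replace (theta_dn L x ^ 4) with (theta_dn L x ^ 2 * theta_dn L x ^ 2) by ring. rewrite E2.
    transitivity (m ^ 4 * theta_sn L x ^ 2 * theta_cn L x ^ 2); [ring |].
    replace (theta_cn L x ^ 2) with (1 - theta_sn L x ^ 2) by lra. ring.
Qed.

(** * The curvature and the functions W_1, W_2 *)

(* All that the geometric part needs to know about [kappa], [W_1] and [W_2]. *)
Record frame (mu : R) (kap kap' V1 V2 V1' V2' : R -> R) : Prop := {
  frame_kap_pos : forall s, 0 < kap s;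
  frame_kap_derive : forall s, is_derive kap s (kap' s);
  frame_kap'_derive : forall s, is_derive kap' s (kap s - kap s ^ 3 / 2);
  frame_kap'_sq : forall s, kap' s ^ 2 = kap s ^ 2 - kap s ^ 4 / 4 - mu;
  frame_V1_derive : forall s, is_derive V1 s (V1' s);
  frame_V2_derive : forall s, is_derive V2 s (V2' s);
  frame_norm : forall s, V1 s ^ 2 + V2 s ^ 2 = 1 - mu / kap s ^ 2;
  frame_wronskian : forall s, V1 s * V2' s - V1' s * V2 s = sqrt mu / 2 }.

Arguments frame_kap_pos {mu kap kap' V1 V2 V1' V2'}.
Arguments frame_kap_derive {mu kap kap' V1 V2 V1' V2'}.
Arguments frame_kap'_derive {mu kap kap' V1 V2 V1' V2'}.
Arguments frame_kap'_sq {mu kap kap' V1 V2 V1' V2'}.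
Arguments frame_V1_derive {mu kap kap' V1 V2 V1' V2'}.
Arguments frame_V2_derive {mu kap kap' V1 V2 V1' V2'}.
Arguments frame_norm {mu kap kap' V1 V2 V1' V2'}.
Arguments frame_wronskian {mu kap kap' V1 V2 V1' V2'}.

Lemma mu_pos (k : R) : 0 < k < 1 -> 0 < mu k.
Proof.
  intros Hk. unfold mu. apply Rdiv_lt_0_compat; [nra |]. apply pow_lt. nra.
Qed.

(** Scaling by r = sqrt(2 - k^2) brings [w_derive] and [dn_derive] to the normal form of [frame].
    The shift by -K in [W1], [W2] produces dn(u - K)^2, which [dn_add_ellK] rewrites as (1 - k^2) /
    dn(u)^2, giving the term mu / kappa^2. *)
Lemma kappa_W_frame (k sstar : R) : 0 < k < 1 ->
  frame (mu k) (kappa k sstar) (Derive (kappa k sstar))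
    (W1 k sstar) (W2 k sstar) (Derive (W1 k sstar)) (Derive (W2 k sstar)).
Proof.
  intros Hk.
  set (r := sqrt (2 - k ^ 2)).
  assert (Hr2 : r ^ 2 = 2 - k ^ 2) by (apply pow2_sqrt; nra).
  assert (Hr : 0 < r) by (apply sqrt_lt_R0; nra).
  assert (Hmu : mu k = 4 * (1 - k ^ 2) / r ^ 4).
  { unfold mu. replace (r ^ 4) with ((r ^ 2) ^ 2) by ring. now rewrite Hr2. }
  destruct (dn_derive k Hk) as (dn' & Hdn).
  assert (Dv : forall s, is_derive (fun z => (z + sstar) / r) s (/ r)).
  { intros s. auto_derive; [exact I | field; lra]. }
  assert (Ekap : forall s, kappa k sstar s = 2 / r * dn ((s + sstar) / r) k) by reflexivity.
  assert (Dkap : forall s, is_derive (kappa k sstar) s (2 / r ^ 2 * dn' ((s + sstar) / r))).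
  { intros s. destruct (Hdn ((s + sstar) / r)) as (D & _ & _).
    assert (D' := is_derive_comp (fun v => dn v k) (fun z => (z + sstar) / r) s _ _ D (Dv s)).
    apply (is_derive_scal _ _ (2 / r)) in D'.
    evar_last; [exact D' |].
    change scal with Rmult. match goal with |- @eq _ ?a ?b => change (@eq R a b) end. field. lra. }
  assert (EDk : forall s, Derive (kappa k sstar) s = 2 / r ^ 2 * dn' ((s + sstar) / r)).
  { intros s. apply is_derive_unique, Dkap. }
  assert (HW : forall s, exists w1' w2', is_derive (W1 k sstar) s (/ r * (/ r * w1')) /\
      is_derive (W2 k sstar) s (/ r * (/ r * w2')) /\
      W1 k sstar s ^ 2 + W2 k sstar s ^ 2 = (2 - k ^ 2 - dn (- ellK k + (s + sstar) / r) k ^ 2) / r ^ 2 /\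
      W1 k sstar s * (/ r * (/ r * w2')) - (/ r * (/ r * w1')) * W2 k sstar s = sqrt (1 - k ^ 2) * r / r ^ 3).
  { intros s. set (u := - ellK k + (s + sstar) / r).
    destruct (w_derive k u Hk) as (w1' & w2' & D1 & D2 & E1 & E2).
    assert (Du : is_derive (fun z => - ellK k + (z + sstar) / r) s (/ r)).
    { auto_derive; [exact I | field; lra]. }
    exists w1', w2'. split; [| split; [| split]].
    - apply (is_derive_scal (fun z => w1 k (- ellK k + (z + sstar) / r)) s (/ r)).
      exact (is_derive_comp (w1 k) (fun z => - ellK k + (z + sstar) / r) s _ _ D1 Du).
    - apply (is_derive_scal (fun z => w2 k (- ellK k + (z + sstar) / r)) s (/ r)).
      exact (is_derive_comp (w2 k) (fun z => - ellK k + (z + sstar) / r) s _ _ D2 Du).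
    - rewrite <- E1. unfold W1, W2. fold r u. field. lra.
    - fold r in E2. rewrite <- E2. unfold W1, W2. fold r u. field. lra. }
  split.
  - intros s. rewrite Ekap. apply Rmult_lt_0_compat; [apply Rdiv_lt_0_compat; lra | now apply dn_pos].
  - intros s. rewrite EDk. apply Dkap.
  - intros s. apply (is_derive_ext (fun z => 2 / r ^ 2 * dn' ((z + sstar) / r))); [intros; now rewrite EDk |].
    destruct (Hdn ((s + sstar) / r)) as (_ & D & _).
    assert (D' := is_derive_comp dn' (fun z => (z + sstar) / r) s _ _ D (Dv s)).
    apply (is_derive_scal _ _ (2 / r ^ 2)) in D'.
    evar_last; [exact D' |].
    change scal with Rmult. match goal with |- @eq _ ?a ?b => change (@eq R a b) end.
    rewrite Ekap, <- Hr2. field. lra.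
  - intros s. rewrite EDk, Ekap, Hmu. destruct (Hdn ((s + sstar) / r)) as (_ & _ & E).
    transitivity (4 / r ^ 4 * dn' ((s + sstar) / r) ^ 2); [field; lra |].
    rewrite E, <- Hr2. replace (1 - k ^ 2) with (r ^ 2 - 1) by lra. field. lra.
  - intros s. destruct (HW s) as (w1' & w2' & D1 & _). apply Derive_correct. eexists. exact D1.
  - intros s. destruct (HW s) as (w1' & w2' & _ & D2 & _). apply Derive_correct. eexists. exact D2.
  - intros s. destruct (HW s) as (w1' & w2' & _ & _ & E & _). rewrite E, Ekap, Hmu, <- Hr2.
    assert (A := dn_add_ellK k (- ellK k + (s + sstar) / r) Hk).
    replace (- ellK k + (s + sstar) / r + ellK k) with ((s + sstar) / r) in A by ring.
    assert (P := dn_pos k ((s + sstar) / r) Hk).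
    assert (A2 : (1 - k ^ 2) = dn ((s + sstar) / r) k ^ 2 * dn (- ellK k + (s + sstar) / r) k ^ 2).
    { rewrite <- Rpow_mult_distr, A. symmetry. apply pow2_sqrt. nra. }
    rewrite A2. field. lra.
  - intros s. destruct (HW s) as (w1' & w2' & D1 & D2 & _ & E).
    rewrite (is_derive_unique _ _ _ D1), (is_derive_unique _ _ _ D2), E.
    assert (Es : sqrt (mu k) = 2 * sqrt (1 - k ^ 2) / r ^ 2).
    { rewrite Hmu. assert (Hs := sqrt_pos (1 - k ^ 2)).
      assert (Hs2 : sqrt (1 - k ^ 2) ^ 2 = 1 - k ^ 2) by (apply pow2_sqrt; nra).
      rewrite <- (sqrt_pow2 (2 * sqrt (1 - k ^ 2) / r ^ 2)).
      - f_equal. transitivity (4 * sqrt (1 - k ^ 2) ^ 2 / r ^ 4); [now rewrite Hs2 | field; lra].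
      - apply Rmult_le_pos; [lra |]. left. apply Rinv_0_lt_compat, pow_lt. exact Hr. }
    rewrite Es. field. lra.
Qed.

(** * Smoothness *)

(** Iterated derivatives are carried as witnesses, so closure under sums, products and inverses is
    an induction on n for all functions at once. *)
Fixpoint diffn (n : nat) (f : R -> R) : Prop :=
  match n with
  | O => True
  | S n => exists g, (forall x, is_derive f x (g x)) /\ diffn n g
  end.

Lemma diffn_ext (n : nat) (f g : R -> R) : (forall x, f x = g x) -> diffn n f -> diffn n g.
Proof.
  destruct n as [|n]; [easy |]. intros E (f' & D & H). exists f'. split; [| exact H].
  intros x. apply (is_derive_ext f g x (f' x) E (D x)).
Qed.

Lemma diffn_smooth (f : R -> R) : (forall n, diffn n f) -> smooth f.
Proof.
  intros H n x.
  assert (K : forall n f, diffn n f -> forall x, ex_derive_n f n x).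
  { clear. induction n as [|n IH]; [easy |]. intros f (g & D & Hg) x.
    destruct n as [|n]; [now exists (g x) |].
    apply (ex_derive_ext (Derive_n g n)); [| exact (IH g Hg x)].
    intros y. rewrite <- (Nat.add_1_r n), <- (Derive_n_comp f n 1).
    apply Derive_n_ext. intros t. symmetry. apply is_derive_unique, D. }
  apply K, H.
Qed.

Lemma diffn_pred (n : nat) (f : R -> R) : diffn (S n) f -> diffn n f.
Proof.
  revert f. induction n as [|n IH]; [easy |]. intros f (g & D & Hg). exists g. split; [exact D |].
  now apply IH.
Qed.

Lemma diffn_const (n : nat) (c : R) : diffn n (fun _ => c).
Proof.
  revert c. induction n as [|n IH]; [easy |]. intros c. exists (fun _ => 0). split; [| apply IH].
  intros x. apply (is_derive_const (K := R_AbsRing) (V := R_NormedModule)).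
Qed.

Lemma diffn_plus (n : nat) (f g : R -> R) : diffn n f -> diffn n g -> diffn n (fun x => f x + g x).
Proof.
  revert f g. induction n as [|n IH]; [easy |]. intros f g (f' & Df & Hf) (g' & Dg & Hg).
  exists (fun x => f' x + g' x). split; [| now apply IH].
  intros x. apply (is_derive_plus (K := R_AbsRing) (V := R_NormedModule) f g); auto.
Qed.

Lemma diffn_mult (n : nat) (f g : R -> R) : diffn n f -> diffn n g -> diffn n (fun x => f x * g x).
Proof.
  revert f g. induction n as [|n IH]; [easy |]. intros f g Hf Hg.
  assert (Hf0 := diffn_pred n f Hf). assert (Hg0 := diffn_pred n g Hg).
  destruct Hf as (f' & Df & Hf). destruct Hg as (g' & Dg & Hg).
  exists (fun x => f' x * g x + f x * g' x). split.
  - intros x. apply (is_derive_mult (K := R_AbsRing) f g); auto. exact Rmult_comm.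
  - apply diffn_plus; now apply IH.
Qed.

Lemma diffn_inv (n : nat) (f : R -> R) : (forall x, f x <> 0) -> diffn n f -> diffn n (fun x => / f x).
Proof.
  intros H0. induction n as [|n IH]; [easy |]. intros Hf.
  assert (Hi := IH (diffn_pred n f Hf)). destruct Hf as (f' & Df & Hf).
  exists (fun x => (-1) * f' x * (/ f x * / f x)). split.
  - intros x. evar_last; [apply (is_derive_inv f x _ (Df x) (H0 x)) |]. simpl. field. apply H0.
  - apply diffn_mult; [apply diffn_mult; [apply diffn_const | exact Hf] | now apply diffn_mult].
Qed.

(** * Curves with curvature kappa *)

Lemma unit_vector_angle (c s : R) : c ^ 2 + s ^ 2 = 1 -> exists p, c = cos p /\ s = sin p.
Proof.
  intros H. assert (Hc : -1 <= c <= 1) by nra.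
  assert (Hs : sqrt (1 - Rsqr c) = Rabs s).
  { rewrite <- sqrt_Rsqr_abs. f_equal. unfold Rsqr. lra. }
  destruct (Rle_dec 0 s) as [H0|H0].
  - exists (acos c). rewrite cos_acos, sin_acos, Hs, Rabs_pos_eq by lra. now split.
  - exists (- acos c). rewrite cos_neg, sin_neg, cos_acos, sin_acos, Hs, Rabs_left by lra. split; ring.
Qed.

(** The angle is the integral of the angular velocity, started at an angle of the unit vector at
    0. *)
Lemma angle_lift (w c s : R -> R) :
  (forall x, continuous w x) ->
  (forall x, is_derive c x (- (w x * s x))) -> (forall x, is_derive s x (w x * c x)) ->
  (forall x, c x ^ 2 + s x ^ 2 = 1) ->
  exists p, (forall x, is_derive p x (w x)) /\ forall x, cos (p x) = c x /\ sin (p x) = s x.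
Proof.
  intros Hw Hc Hs Hcs.
  destruct (unit_vector_angle (c 0) (s 0) (Hcs 0)) as (p0 & Ec & Es).
  set (I := (fun x => RInt w 0 x) : R -> R).
  assert (HI : forall x, is_derive I x (w x)).
  { intros x. apply (is_derive_RInt w I 0 x); [| apply Hw].
    apply filter_forall. intros y. apply (RInt_correct (V := R_CompleteNormedModule)).
    apply (ex_RInt_continuous (V := R_CompleteNormedModule)). intros z _. apply Hw. }
  assert (Hp : forall x, is_derive (fun x => p0 + I x) x (w x)).
  { intros x. assert (D := HI x). auto_derive; [now exists (w x) |].
    rewrite_Derive D. ring. }
  exists (fun x => p0 + I x). split; [exact Hp |].
  assert (HI0 : I 0 = 0) by exact (RInt_point (V := R_CompleteNormedModule) 0 w).
  apply (rotation_unique w c s); try assumption; cbv beta; now rewrite HI0, Rplus_0_r.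
Qed.

(* [V' = (rho' / 2 + i sqrt mu / 2) V / rho] for [V = V1 + i V2], [rho = |V|^2]. *)
Lemma frame_derive_formula {mu : R} {kap kap' V1 V2 V1' V2' : R -> R} (s : R) :
  frame mu kap kap' V1 V2 V1' V2' ->
  (kap s ^ 2 - mu) * V1' s = mu * kap' s / kap s * V1 s - sqrt mu / 2 * kap s ^ 2 * V2 s /\
  (kap s ^ 2 - mu) * V2' s = mu * kap' s / kap s * V2 s + sqrt mu / 2 * kap s ^ 2 * V1 s.
Proof.
  intros [Hpos Dk _ _ D1 D2 Hn Hw].
  assert (P := Hpos s). assert (Dks := Dk s). assert (D1s := D1 s). assert (D2s := D2 s).
  assert (N := Hn s). assert (W := Hw s).
  assert (E : V1 s * V1' s + V2 s * V2' s = mu * kap' s / kap s ^ 3).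
  { assert (A : is_derive (fun x => V1 x ^ 2 + V2 x ^ 2) s (2 * (V1 s * V1' s + V2 s * V2' s))).
    { auto_derive; [split; [now exists (V1' s) | split; [now exists (V2' s) | exact I]] |].
      rewrite_Derive D1s; rewrite_Derive D2s. ring. }
    assert (B : is_derive (fun x => V1 x ^ 2 + V2 x ^ 2) s (2 * (mu * kap' s / kap s ^ 3))).
    { apply (is_derive_ext (fun x => 1 - mu / kap x ^ 2)); [intros x; symmetry; apply Hn |].
      auto_derive.
      - split; [now exists (kap' s) | split; [| exact I]]. apply Rgt_not_eq. nra.
      - rewrite_Derive Dks. field. lra. }
    assert (U := is_derive_unique _ _ _ A). rewrite (is_derive_unique _ _ _ B) in U. lra. }
  assert (R : kap s ^ 2 - mu = kap s ^ 2 * (V1 s ^ 2 + V2 s ^ 2)) by (rewrite N; field; lra).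
  rewrite R. split.
  - transitivity (kap s ^ 2 * (V1 s * (V1 s * V1' s + V2 s * V2' s) - V2 s * (V1 s * V2' s - V1' s * V2 s))); [ring |].
    rewrite E, W. field. lra.
  - transitivity (kap s ^ 2 * (V2 s * (V1 s * V1' s + V2 s * V2' s) + V1 s * (V1 s * V2' s - V1' s * V2 s))); [ring |].
    rewrite E, W. field. lra.
Qed.

Lemma frame_kap_sq_gt {mu : R} {kap kap' V1 V2 V1' V2' : R -> R} (s : R) :
  frame mu kap kap' V1 V2 V1' V2' -> 0 < kap s ^ 2 - mu.
Proof.
  intros [Hpos _ _ Hsq _ _ _ _]. specialize (Hpos s). specialize (Hsq s).
  assert (H4 : 0 < kap s ^ 4) by now apply pow_lt. assert (H := pow2_ge_0 (kap' s)). lra.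
Qed.

(* [P + i Q = (a1 - i a2) (V1 + i V2)]. *)
Lemma frame_rotate {mu : R} {kap kap' V1 V2 V1' V2' : R -> R} (a1 a2 a3 : R) :
  frame mu kap kap' V1 V2 V1' V2' -> a3 ^ 2 = a1 ^ 2 + a2 ^ 2 ->
  let P := fun s => a1 * V1 s + a2 * V2 s in
  let Q := fun s => a1 * V2 s - a2 * V1 s in
  let P' := fun s => a1 * V1' s + a2 * V2' s in
  let Q' := fun s => a1 * V2' s - a2 * V1' s in
  forall s, is_derive P s (P' s) /\ is_derive Q s (Q' s) /\
    kap s ^ 2 * (P s ^ 2 + Q s ^ 2) = a3 ^ 2 * (kap s ^ 2 - mu) /\
    (kap s ^ 2 - mu) * P' s = mu * kap' s / kap s * P s - sqrt mu / 2 * kap s ^ 2 * Q s /\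
    (kap s ^ 2 - mu) * Q' s = mu * kap' s / kap s * Q s + sqrt mu / 2 * kap s ^ 2 * P s.
Proof.
  intros F Ha P Q P' Q' s.
  destruct (frame_derive_formula s F) as [E1 E2].
  assert (D1 := frame_V1_derive F s). assert (D2 := frame_V2_derive F s).
  assert (N := frame_norm F s). assert (K := frame_kap_pos F s).
  unfold P, Q, P', Q'. split; [| split; [| split; [| split]]].
  - auto_derive; [split; [now exists (V1' s) | split; [now exists (V2' s) | exact I]] |].
    rewrite_Derive D1; rewrite_Derive D2. ring.
  - auto_derive; [split; [now exists (V2' s) | split; [now exists (V1' s) | exact I]] |].
    rewrite_Derive D1; rewrite_Derive D2. ring.
  - transitivity (kap s ^ 2 * ((a1 ^ 2 + a2 ^ 2) * (V1 s ^ 2 + V2 s ^ 2))); [ring |].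
    rewrite N, <- Ha. field. lra.
  - transitivity (a1 * ((kap s ^ 2 - mu) * V1' s) + a2 * ((kap s ^ 2 - mu) * V2' s)); [ring |].
    rewrite E1, E2. field. lra.
  - transitivity (a1 * ((kap s ^ 2 - mu) * V2' s) - a2 * ((kap s ^ 2 - mu) * V1' s)); [ring |].
    rewrite E1, E2. field. lra.
Qed.

(* The cosine and sine of the angle of the curve, obtained by solving the two formulas
   for [gamma_1], [gamma_2] at the end of the theorem. *)
Definition rot_sin (mu k k' X Y : R) : R := (k' * X + k ^ 2 / 2 * Y) / (k ^ 2 - mu).
Definition rot_cos (mu k k' X Y : R) : R := (k' * Y - k ^ 2 / 2 * X) / (k ^ 2 - mu).

(** (X, Y) is the image of (sin, cos) under a rotation combined with a scaling, with entries k' and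
    k^2 / 2. Its determinant k'^2 + k^4 / 4 equals k^2 - mu by the first integral of the curvature
    equation. *)
Lemma rot_inverse (mu k k' X Y : R) :
  0 < k ^ 2 - mu -> k' ^ 2 = k ^ 2 - k ^ 4 / 4 - mu ->
  X = k' * rot_sin mu k k' X Y - k ^ 2 / 2 * rot_cos mu k k' X Y /\
  Y = k ^ 2 / 2 * rot_sin mu k k' X Y + k' * rot_cos mu k k' X Y.
Proof.
  intros H E. unfold rot_sin, rot_cos. split.
  - transitivity (X * (k' ^ 2 + k ^ 4 / 4) / (k ^ 2 - mu)); [rewrite E; field; lra | field; lra].
  - transitivity (Y * (k' ^ 2 + k ^ 4 / 4) / (k ^ 2 - mu)); [rewrite E; field; lra | field; lra].
Qed.

(** k^2 P^2 <= a^2 (k^2 - mu) < a^2 k^2, so |P| < a and the denominator of the parametrization stays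
    positive. *)
Lemma curve_position (mu k a P Q : R) :
  0 < a -> 0 < mu -> 0 < k -> 0 < k ^ 2 - mu ->
  k ^ 2 * (P ^ 2 + Q ^ 2) = a ^ 2 * (k ^ 2 - mu) -> 0 < P + a.
Proof.
  intros Ha Hm Hk Hkm H.
  assert (k ^ 2 * P ^ 2 < k ^ 2 * a ^ 2).
  { assert (0 <= k ^ 2 * Q ^ 2) by (apply Rmult_le_pos; apply pow2_ge_0).
    assert (0 < a ^ 2 * mu) by (apply Rmult_lt_0_compat; [now apply pow_lt | exact Hm]). lra. }
  assert (P ^ 2 < a ^ 2) by (apply Rmult_lt_reg_l with (k ^ 2); [now apply pow_lt | assumption]).
  nra.
Qed.

(** X^2 + Y^2 equals k^2 - mu, the squared scaling factor of the similarity in [rot_inverse], so the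
    preimage of (X, Y) is a unit vector. *)
Lemma rot_unit (mu k k' a P Q : R) :
  0 < a -> 0 < mu -> 0 < k -> 0 < k ^ 2 - mu -> k' ^ 2 = k ^ 2 - k ^ 4 / 4 - mu ->
  k ^ 2 * (P ^ 2 + Q ^ 2) = a ^ 2 * (k ^ 2 - mu) ->
  let X := a * mu / (k * (P + a)) - k in
  let Y := sqrt mu * Q / (P + a) in
  rot_cos mu k k' X Y ^ 2 + rot_sin mu k k' X Y ^ 2 = 1.
Proof.
  intros Ha Hm Hk Hkm Ek EPQ X Y.
  assert (HD := curve_position mu k a P Q Ha Hm Hk Hkm EPQ).
  assert (Hnu : sqrt mu ^ 2 = mu) by (apply pow2_sqrt; lra).
  assert (EX : X = - (k ^ 2 * P + a * (k ^ 2 - mu)) / (k * (P + a))) by (unfold X; field; lra).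
  assert (EXY : X ^ 2 + Y ^ 2 = k ^ 2 - mu).
  { rewrite EX. unfold Y.
    transitivity (((k ^ 2 * P + a * (k ^ 2 - mu)) ^ 2 + sqrt mu ^ 2 * (k ^ 2 * Q ^ 2)) / (k ^ 2 * (P + a) ^ 2)); [field; lra |].
    rewrite Hnu. replace (k ^ 2 * Q ^ 2) with (a ^ 2 * (k ^ 2 - mu) - k ^ 2 * P ^ 2) by lra. field. lra. }
  unfold rot_cos, rot_sin.
  transitivity ((k' ^ 2 + k ^ 4 / 4) * (X ^ 2 + Y ^ 2) / (k ^ 2 - mu) ^ 2); [field; lra |].
  rewrite Ek, EXY. field. lra.
Qed.

Lemma curve_velocity (mu k k' a P Q P' Q' : R) :
  0 < a -> 0 < mu -> 0 < k -> 0 < k ^ 2 - mu -> 0 < P + a ->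
  (k ^ 2 - mu) * P' = mu * k' / k * P - sqrt mu / 2 * k ^ 2 * Q ->
  (k ^ 2 - mu) * Q' = mu * k' / k * Q + sqrt mu / 2 * k ^ 2 * P ->
  let X := a * mu / (k * (P + a)) - k in
  let Y := sqrt mu * Q / (P + a) in
  P' = - (P + a) * (rot_sin mu k k' X Y + k' / k) /\
  Q' = sqrt mu * ((P + a) * rot_cos mu k k' X Y / k - a / 2).
Proof.
  intros Ha Hm Hk Hkm HD E1 E2 X Y.
  assert (Hnu0 : 0 < sqrt mu) by now apply sqrt_lt_R0.
  assert (Hnu : sqrt mu ^ 2 = mu) by (apply pow2_sqrt; lra).
  (* Writing mu as nu^2 leaves rational identities in nu, within reach of [field]. *)
  unfold rot_sin, rot_cos, X, Y. clear X Y. set (nu := sqrt mu) in *. rewrite <- Hnu in *. clear Hnu.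
  split.
  - apply Rmult_eq_reg_l with (k ^ 2 - nu ^ 2); [| lra]. rewrite E1. field. repeat split; lra.
  - apply Rmult_eq_reg_l with (k ^ 2 - nu ^ 2); [| lra]. rewrite E2. field. repeat split; lra.
Qed.

(** The unit vector (C, S) turns with angular velocity k - C. This is the curvature equation phi' +
    cos phi = kappa. *)
Lemma rot_derive (mu : R) (k k' X Y : R -> R) (x : R) :
  0 < k x ^ 2 - mu -> k' x ^ 2 = k x ^ 2 - k x ^ 4 / 4 - mu ->
  let S := rot_sin mu (k x) (k' x) (X x) (Y x) in
  let C := rot_cos mu (k x) (k' x) (X x) (Y x) in
  C ^ 2 + S ^ 2 = 1 ->
  is_derive k x (k' x) -> is_derive k' x (k x - k x ^ 3 / 2) ->
  is_derive X x ((X x + k x) * S - k' x) -> is_derive Y x ((X x + k x) * C) ->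
  is_derive (fun x => rot_sin mu (k x) (k' x) (X x) (Y x)) x ((k x - C) * C) /\
  is_derive (fun x => rot_cos mu (k x) (k' x) (X x) (Y x)) x (- ((k x - C) * S)).
Proof.
  intros HR Ek S C HSC Dk Dk' DX DY.
  destruct (rot_inverse mu (k x) (k' x) (X x) (Y x) HR Ek) as [EX EY].
  fold S C in EX, EY.
  assert (ES : k' x * X x + k x ^ 2 / 2 * Y x = S * (k x ^ 2 - mu)) by (unfold S, rot_sin; field; lra).
  assert (EC : k' x * Y x - k x ^ 2 / 2 * X x = C * (k x ^ 2 - mu)) by (unfold C, rot_cos; field; lra).
  assert (ER : k x ^ 2 - mu = k' x ^ 2 + k x ^ 4 / 4) by lra.
  set (rho := k x ^ 2 - mu) in *.
  assert (DR : is_derive (fun x => k x ^ 2 - mu) x (2 * k x * k' x)).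
  { auto_derive; [now exists (k' x) |].
    rewrite_Derive Dk. ring. }
  assert (HR0 : k x ^ 2 - mu <> 0) by (fold rho; lra).
  assert (Quot : forall f f', is_derive f x f' ->
    is_derive (fun x => f x / (k x ^ 2 - mu)) x ((f' * rho - f x * (2 * k x * k' x)) / rho ^ 2)).
  { intros f f' Df. exact (is_derive_div f (fun x => k x ^ 2 - mu) x _ _ Df DR HR0). }
  split; unfold rot_sin, rot_cos.
  - assert (DN : is_derive (fun x => k' x * X x + k x ^ 2 / 2 * Y x) x
      ((k x - k x ^ 3 / 2) * X x + k' x * ((X x + k x) * S - k' x) + k x * k' x * Y x + k x ^ 2 / 2 * ((X x + k x) * C))).
    { auto_derive.
      - repeat split; eexists; eassumption.
      - rewrite_Derive Dk; rewrite_Derive Dk'; rewrite_Derive DX; rewrite_Derive DY. field. }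
    evar_last; [exact (Quot _ _ DN) |]. cbv beta. rewrite ES.
    set (N := _ + k x ^ 2 / 2 * ((X x + k x) * C)).
    (* After X and Y are expressed by S and C, the two sides differ by a multiple of C^2 + S^2 -
       1. *)
    assert (EN : N - 2 * k x * k' x * S = (k x - C) * C * rho).
    { unfold N. rewrite EX, EY, ER.
      apply Rminus_diag_uniq. transitivity (k' x ^ 2 * (C ^ 2 + S ^ 2 - 1)); [field | rewrite HSC; ring]. }
    match goal with |- @eq _ ?a ?b => change (@eq R a b) end.
    transitivity ((N - 2 * k x * k' x * S) / rho); [field; lra |]. rewrite EN. field. lra.
  - assert (DN : is_derive (fun x => k' x * Y x - k x ^ 2 / 2 * X x) x
      ((k x - k x ^ 3 / 2) * Y x + k' x * ((X x + k x) * C) - k x * k' x * X x - k x ^ 2 / 2 * ((X x + k x) * S - k' x))).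
    { auto_derive.
      - repeat split; eexists; eassumption.
      - rewrite_Derive Dk; rewrite_Derive Dk'; rewrite_Derive DX; rewrite_Derive DY. field. }
    evar_last; [exact (Quot _ _ DN) |]. cbv beta. rewrite EC.
    set (N := _ - k x ^ 2 / 2 * ((X x + k x) * S - k' x)).
    assert (EN : N - 2 * k x * k' x * C = - ((k x - C) * S) * rho).
    { unfold N. rewrite EX, EY, ER.
      apply Rminus_diag_uniq. transitivity (k x ^ 2 * k' x / 2 * (1 - (C ^ 2 + S ^ 2))); [field | rewrite HSC; ring]. }
    match goal with |- @eq _ ?a ?b => change (@eq R a b) end.
    transitivity ((N - 2 * k x * k' x * C) / rho); [field; lra |]. rewrite EN. field. lra.
Qed.

(** The derivatives of the four functions are rational expressions in the functions themselves, with
    denominators that never vanish, so each order of differentiability yields the next. *)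
Lemma frame_diffn {mu : R} {kap kap' V1 V2 V1' V2' : R -> R} :
  frame mu kap kap' V1 V2 V1' V2' ->
  forall n, diffn n kap /\ diffn n kap' /\ diffn n V1 /\ diffn n V2.
Proof.
  intros F.
  assert (Hk : forall n, diffn n kap /\ diffn n kap').
  { induction n as [|n [IH1 IH2]]; [easy |]. split.
    - exists kap'. split; [apply (frame_kap_derive F) | exact IH2].
    - eexists. split; [apply (frame_kap'_derive F) |].
      apply (diffn_ext n (fun x => kap x + (- (1 / 2)) * (kap x * (kap x * kap x)))).
      + intros x. field.
      + apply diffn_plus; [exact IH1 |]. apply diffn_mult; [apply diffn_const |].
        repeat apply diffn_mult; exact IH1. }
  assert (Hm : forall n, diffn n (fun x => mu * kap' x * / kap x) /\ diffn n (fun x => sqrt mu / 2 * (kap x * kap x)) /\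
     diffn n (fun x => / (kap x * kap x + - mu))).
  { intros n. destruct (Hk n) as [H1 H2]. split; [| split].
    - apply diffn_mult; [apply diffn_mult; [apply diffn_const | exact H2] |].
      apply diffn_inv; [| exact H1]. intros x. apply Rgt_not_eq, (frame_kap_pos F).
    - apply diffn_mult; [apply diffn_const | now apply diffn_mult].
    - apply (diffn_inv n (fun x => kap x * kap x + - mu)).
      + intros x. assert (H := frame_kap_sq_gt x F). lra.
      + apply diffn_plus; [now apply diffn_mult | apply diffn_const]. }
  induction n as [|n (IHk & IHk' & IH1 & IH2)]; [easy |].
  destruct (Hk (S n)) as [H1 H2]. split; [exact H1 | split; [exact H2 |]].
  destruct (Hm n) as (M1 & M2 & M3). split.
  - exists V1'. split; [apply (frame_V1_derive F) |].
    apply (diffn_ext n (fun x => (mu * kap' x * / kap x * V1 x + (-1) * (sqrt mu / 2 * (kap x * kap x) * V2 x))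
       * / (kap x * kap x + - mu))).
    + intros x. assert (Hr := frame_kap_sq_gt x F).
      destruct (frame_derive_formula x F) as [E _].
      apply Rmult_eq_reg_l with (kap x ^ 2 - mu); [| lra]. rewrite E. field.
      split; [apply Rgt_not_eq, (frame_kap_pos F) | lra].
    + apply diffn_mult; [| exact M3]. apply diffn_plus; [now apply diffn_mult |].
      apply diffn_mult; [apply diffn_const | now apply diffn_mult].
  - exists V2'. split; [apply (frame_V2_derive F) |].
    apply (diffn_ext n (fun x => (mu * kap' x * / kap x * V2 x + (sqrt mu / 2 * (kap x * kap x) * V1 x))
       * / (kap x * kap x + - mu))).
    + intros x. assert (Hr := frame_kap_sq_gt x F).
      destruct (frame_derive_formula x F) as [_ E].
      apply Rmult_eq_reg_l with (kap x ^ 2 - mu); [| lra]. rewrite E. field.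
      split; [apply Rgt_not_eq, (frame_kap_pos F) | lra].
    + apply diffn_mult; [| exact M3]. apply diffn_plus; now apply diffn_mult.
Qed.

(* [c] and [s] will be the cosine and sine of the angle function. *)
Lemma frame_curve {mu : R} {kap kap' V1 V2 V1' V2' : R -> R} (a1 a2 a3 beta : R) :
  frame mu kap kap' V1 V2 V1' V2' -> 0 < mu -> 0 < a3 -> a3 ^ 2 = a1 ^ 2 + a2 ^ 2 ->
  let P := fun x => a1 * V1 x + a2 * V2 x in
  let Q := fun x => a1 * V2 x - a2 * V1 x in
  let g1 := fun x => beta + Q x / (sqrt mu * a3 * (P x + a3)) in
  let g2 := fun x => / (kap x * (P x + a3)) in
  let X := fun x => a3 * mu / (kap x * (P x + a3)) - kap x in
  let Y := fun x => sqrt mu * Q x / (P x + a3) in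
  let s := fun x => rot_sin mu (kap x) (kap' x) (X x) (Y x) in
  let c := fun x => rot_cos mu (kap x) (kap' x) (X x) (Y x) in
  forall x, 0 < P x + a3 /\ c x ^ 2 + s x ^ 2 = 1 /\
    is_derive g1 x (g2 x * c x) /\ is_derive g2 x (g2 x * s x) /\
    is_derive c x (- ((kap x - c x) * s x)) /\ is_derive s x ((kap x - c x) * c x) /\
    X x = kap' x * s x - kap x ^ 2 / 2 * c x /\ Y x = kap x ^ 2 / 2 * s x + kap' x * c x /\
    a1 * V1' x + a2 * V2' x = - (P x + a3) * (s x + kap' x / kap x).
Proof.
  intros F Hmu Ha3 Ha P Q g1 g2 X Y s c.
  assert (Hnu : 0 < sqrt mu) by now apply sqrt_lt_R0.
  assert (Hnu2 : sqrt mu ^ 2 = mu) by (apply pow2_sqrt; lra).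
  assert (H : forall x, 0 < P x + a3 /\ c x ^ 2 + s x ^ 2 = 1 /\
    is_derive g1 x (g2 x * c x) /\ is_derive g2 x (g2 x * s x) /\
    X x = kap' x * s x - kap x ^ 2 / 2 * c x /\ Y x = kap x ^ 2 / 2 * s x + kap' x * c x /\
    a1 * V1' x + a2 * V2' x = - (P x + a3) * (s x + kap' x / kap x)).
  { intros x.
    destruct (frame_rotate a1 a2 a3 F Ha x) as (DP & DQ & EPQ & EP & EQ).
    cbv beta zeta in DP, DQ, EPQ, EP, EQ. fold P in DP. fold Q in DQ.
    change (a1 * V1 x + a2 * V2 x) with (P x) in *.
    change (a1 * V2 x - a2 * V1 x) with (Q x) in *.
    assert (Hk := frame_kap_pos F x).
    assert (Hr := frame_kap_sq_gt x F).
    assert (Ek := frame_kap'_sq F x).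
    assert (Dk := frame_kap_derive F x).
    assert (HD := curve_position mu (kap x) a3 (P x) (Q x) Ha3 Hmu Hk Hr EPQ).
    assert (HU := rot_unit mu (kap x) (kap' x) a3 (P x) (Q x) Ha3 Hmu Hk Hr Ek EPQ).
    destruct (curve_velocity mu (kap x) (kap' x) a3 (P x) (Q x) _ _ Ha3 Hmu Hk Hr HD EP EQ) as [EP' EQ'].
    cbv zeta in HU, EP', EQ'. fold (X x) (Y x) in HU, EP', EQ'. fold (s x) (c x) in HU, EP', EQ'.
    destruct (rot_inverse mu (kap x) (kap' x) (X x) (Y x) Hr Ek) as [EX EY]. fold (s x) (c x) in EX, EY.
    set (P' := a1 * V1' x + a2 * V2' x) in *. set (Q' := a1 * V2' x - a2 * V1' x) in *.
    repeat (split; [assumption |]).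
    (* The Wronskian of the rotated pair is that of the frame, sqrt mu / 2, times a3^2. *)
    assert (EW : P x * Q' - Q x * P' = sqrt mu * a3 ^ 2 / 2).
    { apply Rmult_eq_reg_l with (kap x ^ 2 - mu); [| lra].
      transitivity (P x * ((kap x ^ 2 - mu) * Q') - Q x * ((kap x ^ 2 - mu) * P')); [ring |].
      rewrite EP, EQ. transitivity (sqrt mu / 2 * (kap x ^ 2 * (P x ^ 2 + Q x ^ 2))); [ring |].
      rewrite EPQ. field. }
    split; [| split; [| repeat split; assumption]].
    - unfold g1. auto_derive.
      + split; [now exists Q' | split; [now exists P' | split; [| exact I]]].
        apply Rgt_not_eq. apply Rmult_lt_0_compat; [now apply Rmult_lt_0_compat | exact HD].
      + rewrite_Derive DP; rewrite_Derive DQ.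
        unfold g2.
        transitivity ((P x * Q' - Q x * P' + a3 * Q') / (sqrt mu * a3 * (P x + a3) ^ 2)); [field; repeat split; lra |].
        rewrite EW, EQ'. field. repeat split; lra.
    - unfold g2. auto_derive.
      + split; [now exists (kap' x) | split; [now exists P' | split; [| exact I]]].
        apply Rgt_not_eq. now apply Rmult_lt_0_compat.
      + rewrite_Derive DP; rewrite_Derive Dk.
        rewrite EP'. field. repeat split; lra. }
  intros x. destruct (H x) as (HD & HU & D1 & D2 & EX & EY & EP').
  assert (Hk := frame_kap_pos F x).
  assert (Dk := frame_kap_derive F x).
  assert (Dk' := frame_kap'_derive F x).
  (* X + kap is a constant multiple of g2 and Y of g1 - beta, so the derivatives of X and Y follow
     from those of the curve. *)
  assert (EX2 : forall y, a3 * mu * g2 y - kap y = X y).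
  { intros y. unfold X, g2. reflexivity. }
  assert (EY2 : forall y, mu * a3 * (g1 y - beta) = Y y).
  { intros y. destruct (H y) as (HDy & _). unfold Y, g1. rewrite <- Hnu2 at 1. field. repeat split; lra. }
  assert (DX : is_derive X x ((X x + kap x) * s x - kap' x)).
  { apply (is_derive_ext _ _ _ _ EX2). auto_derive.
    - split; [now exists (g2 x * s x) | split; [now exists (kap' x) | exact I]].
    - rewrite_Derive D2; rewrite_Derive Dk.
      rewrite <- EX2. ring. }
  assert (DY : is_derive Y x ((X x + kap x) * c x)).
  { apply (is_derive_ext _ _ _ _ EY2). auto_derive.
    - now exists (g2 x * c x).
    - rewrite_Derive D1. rewrite <- EX2. ring. }
  destruct (rot_derive mu kap kap' X Y x (frame_kap_sq_gt x F)
    (frame_kap'_sq F x) HU Dk Dk' DX DY) as [DS DC].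
  repeat (split; [assumption |]). assumption.
Qed.

(** As complex functions P + i Q and V1 + i V2 solve the same linear equation, so their quotient a1
    - i a2 is constant. A1 and - A2 are its real and imaginary parts, since kap^2 / (kap^2 - mu) is
    1 / |V|^2. *)
Lemma frame_ratio_const (mu : R) (kap kap' V1 V2 V1' V2' P Q P' Q' : R -> R) :
  frame mu kap kap' V1 V2 V1' V2' ->
  (forall x, is_derive P x (P' x)) -> (forall x, is_derive Q x (Q' x)) ->
  (forall x, (kap x ^ 2 - mu) * P' x = mu * kap' x / kap x * P x - sqrt mu / 2 * kap x ^ 2 * Q x) ->
  (forall x, (kap x ^ 2 - mu) * Q' x = mu * kap' x / kap x * Q x + sqrt mu / 2 * kap x ^ 2 * P x) ->
  exists a1 a2, forall x, P x = a1 * V1 x + a2 * V2 x /\ Q x = a1 * V2 x - a2 * V1 x.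
Proof.
  intros F DP DQ EP EQ.
  set (A1 := fun x => (P x * V1 x + Q x * V2 x) * (kap x ^ 2 / (kap x ^ 2 - mu))).
  set (A2 := fun x => (P x * V2 x - Q x * V1 x) * (kap x ^ 2 / (kap x ^ 2 - mu))).
  assert (D0 : forall x, is_derive A1 x 0 /\ is_derive A2 x 0).
  { intros x.
    assert (Hk := frame_kap_pos F x). assert (Hr := frame_kap_sq_gt x F).
    assert (Dk := frame_kap_derive F x).
    assert (D1 := frame_V1_derive F x). assert (D2 := frame_V2_derive F x).
    assert (DPx := DP x). assert (DQx := DQ x).
    destruct (frame_derive_formula x F) as [E1 E2].
    assert (Solve : forall u v, (kap x ^ 2 - mu) * u = v -> u = v / (kap x ^ 2 - mu)).
    { intros u v <-. field. lra. }
    assert (EPx := Solve _ _ (EP x)). assert (EQx := Solve _ _ (EQ x)).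
    apply Solve in E1. apply Solve in E2.
    assert (DF : is_derive (fun x => kap x ^ 2 / (kap x ^ 2 - mu)) x (- 2 * mu * kap x * kap' x / (kap x ^ 2 - mu) ^ 2)).
    { auto_derive.
      - simpl in Hr. repeat split; first [now exists (kap' x) | lra].
      - rewrite_Derive Dk. field. simpl in Hr. lra. }
    split.
    - evar_last.
      + apply (is_derive_mult (K := R_AbsRing) (fun x => P x * V1 x + Q x * V2 x) (fun x => kap x ^ 2 / (kap x ^ 2 - mu)) x
          (P' x * V1 x + P x * V1' x + (Q' x * V2 x + Q x * V2' x))
          (- 2 * mu * kap x * kap' x / (kap x ^ 2 - mu) ^ 2)); [| exact DF | exact Rmult_comm].
        auto_derive; [repeat split; eexists; eassumption |].
        rewrite_Derive DPx; rewrite_Derive DQx; rewrite_Derive D1; rewrite_Derive D2. ring.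
      + cbv beta. change plus with Rplus. change mult with Rmult.
        match goal with |- @eq _ ?a ?b => change (@eq R a b) end.
        rewrite EPx, EQx, E1, E2. field. lra.
    - evar_last.
      + apply (is_derive_mult (K := R_AbsRing) (fun x => P x * V2 x - Q x * V1 x) (fun x => kap x ^ 2 / (kap x ^ 2 - mu)) x
          (P' x * V2 x + P x * V2' x - (Q' x * V1 x + Q x * V1' x))
          (- 2 * mu * kap x * kap' x / (kap x ^ 2 - mu) ^ 2)); [| exact DF | exact Rmult_comm].
        auto_derive; [repeat split; eexists; eassumption |].
        rewrite_Derive DPx; rewrite_Derive DQx; rewrite_Derive D1; rewrite_Derive D2. ring.
      + cbv beta. change plus with Rplus. change mult with Rmult.
        match goal with |- @eq _ ?a ?b => change (@eq R a b) end.
        rewrite EPx, EQx, E1, E2. field. lra. }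
  exists (A1 0), (A2 0). intros x.
  assert (C1 := is_derive_zero_const A1 (fun x => proj1 (D0 x)) 0 x).
  assert (C2 := is_derive_zero_const A2 (fun x => proj2 (D0 x)) 0 x).
  rewrite C1, C2. unfold A1, A2.
  assert (Hk := frame_kap_pos F x). assert (Hr := frame_kap_sq_gt x F).
  assert (N := frame_norm F x).
  split.
  - transitivity (P x * (V1 x ^ 2 + V2 x ^ 2) * (kap x ^ 2 / (kap x ^ 2 - mu))); [rewrite N; field; lra | ring].
  - transitivity (Q x * (V1 x ^ 2 + V2 x ^ 2) * (kap x ^ 2 / (kap x ^ 2 - mu))); [rewrite N; field; lra | ring].
Qed.

(** X + kap and g2 have the same logarithmic derivative sin phi, so their ratio is constant. With
    that ratio equal to mu a3, the derivative of Y is mu a3 g1', which gives the second constant. *)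
Lemma elastica_parameters (mu : R) (kap kap' V1 V2 V1' V2' g1 g2 phi : R -> R) :
  frame mu kap kap' V1 V2 V1' V2' -> 0 < mu -> (forall x, 0 < g2 x) ->
  (forall x, is_derive g1 x (g2 x * cos (phi x))) ->
  (forall x, is_derive g2 x (g2 x * sin (phi x))) ->
  (forall x, is_derive phi x (kap x - cos (phi x))) ->
  exists a1 a2 a3 beta, 0 < a3 /\ a3 ^ 2 = a1 ^ 2 + a2 ^ 2 /\
    forall x, g1 x = beta + (a1 * V2 x - a2 * V1 x) / (sqrt mu * a3 * (a1 * V1 x + a2 * V2 x + a3)) /\
      g2 x = / (kap x * (a1 * V1 x + a2 * V2 x + a3)).
Proof.
  intros F Hmu Hg2 D1 D2 Dphi.
  assert (Hnu : 0 < sqrt mu) by now apply sqrt_lt_R0.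
  assert (Hnu2 : sqrt mu ^ 2 = mu) by (apply pow2_sqrt; lra).
  set (s := fun x => sin (phi x)). set (c := fun x => cos (phi x)).
  assert (Hsc : forall x, c x ^ 2 + s x ^ 2 = 1).
  { intros x. assert (H := sin2_cos2 (phi x)). unfold Rsqr in H. unfold c, s. lra. }
  set (X := fun x => kap' x * s x - kap x ^ 2 / 2 * c x).
  set (Y := fun x => kap x ^ 2 / 2 * s x + kap' x * c x).
  assert (Dk := frame_kap_derive F).
  assert (Dk' := frame_kap'_derive F).
  assert (DX : forall x, is_derive X x ((X x + kap x) * s x - kap' x)).
  { intros x. unfold X, s, c. auto_derive.
    - repeat split; eexists; first [exact (Dk x) | exact (Dk' x) | exact (Dphi x)].
    - rewrite_Derive (Dk x); rewrite_Derive (Dk' x); rewrite_Derive (Dphi x).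
      fold (s x) (c x). apply Rminus_diag_uniq.
      transitivity (kap' x * (1 - (c x ^ 2 + s x ^ 2))); [field | rewrite Hsc; ring]. }
  assert (DY : forall x, is_derive Y x ((X x + kap x) * c x)).
  { intros x. unfold X, Y, s, c. auto_derive.
    - repeat split; eexists; first [exact (Dk x) | exact (Dk' x) | exact (Dphi x)].
    - rewrite_Derive (Dk x); rewrite_Derive (Dk' x); rewrite_Derive (Dphi x). field. }
  assert (EXY : forall x, kap' x * X x + kap x ^ 2 / 2 * Y x = (kap x ^ 2 - mu) * s x /\
     kap' x * Y x - kap x ^ 2 / 2 * X x = (kap x ^ 2 - mu) * c x).
  { intros x. assert (Ek := frame_kap'_sq F x). unfold X, Y. split.
    - transitivity ((kap' x ^ 2 + kap x ^ 4 / 4) * s x); [field | rewrite Ek; field].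
    - transitivity ((kap' x ^ 2 + kap x ^ 4 / 4) * c x); [field | rewrite Ek; field]. }
  assert (NXY : forall x, X x ^ 2 + Y x ^ 2 = kap x ^ 2 - mu).
  { intros x. assert (Ek := frame_kap'_sq F x). unfold X, Y.
    transitivity ((kap' x ^ 2 + kap x ^ 4 / 4) * (c x ^ 2 + s x ^ 2)); [field | rewrite Ek, Hsc; field]. }
  (* X^2 <= kap^2 - mu < kap^2, so |X| < kap. *)
  assert (HXk : forall x, 0 < X x + kap x).
  { intros x. specialize (NXY x). assert (Hk := frame_kap_pos F x).
    assert (H := pow2_ge_0 (Y x)). nra. }
  set (a3 := (X 0 + kap 0) / (mu * g2 0)).
  assert (Ha3 : 0 < a3) by (apply Rdiv_lt_0_compat; [apply HXk | now apply Rmult_lt_0_compat]).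
  assert (E3 : forall x, X x + kap x = mu * a3 * g2 x).
  { intros x. set (f := fun x => (X x + kap x) / (mu * g2 x)).
    assert (E : f x = f 0).
    { apply is_derive_zero_const. intros y. unfold f.
      assert (H2 := Hg2 y). assert (Hk := Dk y). assert (HX := DX y). assert (HD2 := D2 y).
      auto_derive.
      - repeat split; try (eexists; eassumption). apply Rgt_not_eq. now apply Rmult_lt_0_compat.
      - rewrite_Derive Hk; rewrite_Derive HX; rewrite_Derive HD2. fold (s y). field. lra. }
    change (f 0) with a3 in E. rewrite <- E. unfold f. specialize (Hg2 x). field. lra. }
  set (beta := g1 0 - Y 0 / (mu * a3)).
  assert (E1 : forall x, g1 x = beta + Y x / (mu * a3)).
  { intros x. set (f := fun x => g1 x - Y x / (mu * a3)).
    assert (E : f x = f 0).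
    { apply is_derive_zero_const. intros y. unfold f.
      assert (HY := DY y). assert (HD1 := D1 y).
      auto_derive.
      - repeat split; try (eexists; eassumption).
      - rewrite_Derive HY; rewrite_Derive HD1.
        rewrite E3. fold (c y). field. lra. }
    change (f 0) with beta in E. rewrite <- E. unfold f. ring. }
  (* In the parametrization this is the denominator P + a3; the rotated partner Q is recovered as Y
     D / sqrt mu. *)
  set (D := fun x => / (kap x * g2 x)).
  assert (Hk := frame_kap_pos F).
  assert (HD : forall x, 0 < D x).
  { intros x. apply Rinv_0_lt_compat. apply Rmult_lt_0_compat; [apply Hk | apply Hg2]. }
  assert (EDa : forall x, a3 = (X x + kap x) * kap x * D x / mu).
  { intros x. rewrite E3. unfold D. assert (H1 := Hk x). assert (H2 := Hg2 x). field. lra. }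
  assert (DD : forall x, is_derive D x (- D x * (s x + kap' x / kap x))).
  { intros x. unfold D. assert (H1 := Hk x). assert (H2 := Hg2 x).
    assert (Hdk := Dk x). assert (HD2 := D2 x). auto_derive.
    - repeat split; try (eexists; eassumption). apply Rgt_not_eq. now apply Rmult_lt_0_compat.
    - rewrite_Derive Hdk; rewrite_Derive HD2.
      fold (s x). field. lra. }
  destruct (frame_ratio_const mu kap kap' V1 V2 V1' V2' (fun x => D x - a3) (fun x => Y x * D x / sqrt mu)
    (fun x => - D x * (s x + kap' x / kap x))
    (fun x => D x / sqrt mu * ((X x + kap x) * c x - Y x * (s x + kap' x / kap x)))) as (a1 & a2 & E12).
  - exact F.
  - intros x. assert (H := DD x). auto_derive; [eexists; eassumption |].
    rewrite_Derive H. ring.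
  - intros x. assert (H := DD x). assert (H' := DY x). auto_derive; [repeat split; eexists; eassumption |].
    rewrite_Derive H; rewrite_Derive H'. field.
    specialize (Hk x). lra.
  - intros x. cbv beta. rewrite (EDa x) at 1.
    assert (H1 := Hk x). destruct (EXY x) as [ES _].
    transitivity (- D x * ((kap x ^ 2 - mu) * s x + (kap x ^ 2 - mu) * kap' x / kap x)); [field; lra |].
    rewrite <- ES. field. lra.
  - intros x. cbv beta. rewrite (EDa x).
    assert (H1 := Hk x). destruct (EXY x) as [ES EC].
    transitivity (D x / sqrt mu * ((X x + kap x) * ((kap x ^ 2 - mu) * c x)
      - Y x * ((kap x ^ 2 - mu) * s x + (kap x ^ 2 - mu) * kap' x / kap x))); [field; lra |].
    rewrite <- ES, <- EC.
    apply Rminus_diag_uniq.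
    transitivity (D x / (2 * sqrt mu) * kap x ^ 2 * (- (X x ^ 2 + Y x ^ 2) - X x * kap x
       - (sqrt mu ^ 2 / mu) * (mu - (X x + kap x) * kap x))).
    { field. repeat split; lra. }
    rewrite NXY, Hnu2. field. lra.
  - assert (EP : forall x, a1 * V1 x + a2 * V2 x = D x - a3) by (intros x; symmetry; apply E12).
    assert (EQ : forall x, a1 * V2 x - a2 * V1 x = Y x * D x / sqrt mu) by (intros x; symmetry; apply E12).
    exists a1, a2, a3, beta. split; [exact Ha3 |]. split.
    (* |P + i Q|^2 at the point 0 is computed twice: from the curve it is a3^2 |V|^2, from the
       constants (a1^2 + a2^2) |V|^2. *)
    + assert (N := frame_norm F 0). assert (H1 := Hk 0).
      assert (Hr := frame_kap_sq_gt 0 F).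
      apply Rmult_eq_reg_r with (kap 0 ^ 2 - mu); [| lra].
      transitivity (kap 0 ^ 2 * ((a1 * V1 0 + a2 * V2 0) ^ 2 + (a1 * V2 0 - a2 * V1 0) ^ 2)).
      * rewrite EP, EQ.
        transitivity (kap 0 ^ 2 * ((D 0 - a3) ^ 2 + Y 0 ^ 2 * D 0 ^ 2 / sqrt mu ^ 2)); [| field; lra].
        rewrite Hnu2. replace (Y 0 ^ 2) with (kap 0 ^ 2 - mu - X 0 ^ 2) by (rewrite <- NXY; ring).
        rewrite (EDa 0). field. lra.
      * transitivity (kap 0 ^ 2 * ((a1 ^ 2 + a2 ^ 2) * (V1 0 ^ 2 + V2 0 ^ 2))); [ring |].
        rewrite N. field. lra.
    + intros x. rewrite EP, EQ. assert (H1 := Hk x). assert (H2 := Hg2 x). assert (H3 := HD x). split.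
      * rewrite E1. f_equal. transitivity (Y x / (sqrt mu ^ 2 * a3)); [now rewrite Hnu2 | field; repeat split; lra].
      * unfold D. field. repeat split; lra.
Qed.

(** * The two implications and the final formulas *)

Lemma inv2_mulmv2 (p q r t x y : R) :
  det2 ((p, q), (r, t)) <> 0 ->
  mulmv2 (inv2 ((p, q), (r, t))) (p * x + q * y, r * x + t * y) = (x, y).
Proof. intros H. unfold mulmv2, inv2. simpl in *. f_equal; field; exact H. Qed.

(** Admissibility says that (b1, b2, b3) is b3 / a3 times (a1, a2, a3) plus a multiple of (-a2, a1,
    0); the first part contributes a constant to the quotient. *)
Lemma admissible_numerator (k a1 a2 a3 b1 b2 b3 v1 v2 : R) :
  0 < mu k -> admissible k a1 a2 a3 b1 b2 b3 -> 0 < a1 * v1 + a2 * v2 + a3 ->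
  (b1 * v1 + b2 * v2 + b3) / (a1 * v1 + a2 * v2 + a3) =
  b3 / a3 + (a1 * v2 - a2 * v1) / (sqrt (mu k) * a3 * (a1 * v1 + a2 * v2 + a3)).
Proof.
  intros Hmu (_ & Ha & -> & ->) HD. assert (0 < sqrt (mu k)) by now apply sqrt_lt_R0.
  field. repeat split; lra.
Qed.

Lemma sqrt_sum_sq (a1 a2 a3 : R) : a3 = sqrt (a1 ^ 2 + a2 ^ 2) -> a3 ^ 2 = a1 ^ 2 + a2 ^ 2.
Proof. intros ->. apply pow2_sqrt. assert (H1 := pow2_ge_0 a1). assert (H2 := pow2_ge_0 a2). lra. Qed.

Lemma elastica_is_parametrized (k sstar : R) (gamma : R -> Hyp) : 0 < k < 1 ->
  orbitlike_elastica k sstar gamma ->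
  exists a1 a2 a3 b1 b2 b3, admissible k a1 a2 a3 b1 b2 b3 /\ parametrized k sstar gamma a1 a2 a3 b1 b2 b3.
Proof.
  intros Hk [(S1 & S2 & _) (phi & (Sphi & Hphi) & Hkap)].
  assert (Hmu := mu_pos k Hk). assert (F := kappa_W_frame k sstar Hk).
  assert (Hs : 0 < sqrt (mu k)) by now apply sqrt_lt_R0.
  destruct (elastica_parameters (mu k) _ _ _ _ _ _ (coord1 gamma) (coord2 gamma) phi F Hmu)
    as (a1 & a2 & a3 & beta & Ha3 & Ea & E).
  - intros x. exact (proj2_sig (gamma x)).
  - intros x. rewrite <- (proj1 (Hphi x)). apply Derive_correct. exact (S1 1%nat x).
  - intros x. rewrite <- (proj2 (Hphi x)). apply Derive_correct. exact (S2 1%nat x).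
  - intros x. replace (kappa k sstar x - cos (phi x)) with (Derive phi x) by (rewrite Hkap; ring).
    apply Derive_correct. exact (Sphi 1%nat x).
  (* The constant beta plays the role of b3 / a3. *)
  - assert (Adm : admissible k a1 a2 a3 (beta * a1 + 1 / (sqrt (mu k) * a3) * (- a2))
        (beta * a2 + 1 / (sqrt (mu k) * a3) * a1) (beta * a3)).
    { split; [rewrite <- Ea; symmetry; apply sqrt_pow2; lra |].
      split; [exact Ha3 |]. split; field; lra. }
    do 6 eexists. split; [exact Adm |]. intros x. destruct (E x) as [Eg1 Eg2].
    destruct (frame_curve a1 a2 a3 beta F Hmu Ha3 Ea x) as (HD & _). cbv beta zeta in HD.
    split.
    + rewrite (admissible_numerator k a1 a2 a3 _ _ _ _ _ Hmu Adm HD), Eg1.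
      f_equal. field. lra.
    + rewrite Eg2. unfold Rdiv. ring.
Qed.

Lemma coord2_pos (gamma : R -> Hyp) (x : R) : 0 < coord2 gamma x.
Proof. exact (proj2_sig (gamma x)). Qed.

Lemma parametrized_is_elastica (k sstar : R) (gamma : R -> Hyp) (a1 a2 a3 b1 b2 b3 : R) : 0 < k < 1 ->
  admissible k a1 a2 a3 b1 b2 b3 -> parametrized k sstar gamma a1 a2 a3 b1 b2 b3 ->
  orbitlike_elastica k sstar gamma.
Proof.
  intros Hk Adm Par.
  assert (Hmu := mu_pos k Hk). assert (F := kappa_W_frame k sstar Hk).
  assert (Hs : 0 < sqrt (mu k)) by now apply sqrt_lt_R0.
  assert (Adm' := Adm). destruct Adm' as (Ea' & Ha3 & _). assert (Ea := sqrt_sum_sq _ _ _ Ea').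
  assert (HC := frame_curve a1 a2 a3 (b3 / a3) F Hmu Ha3 Ea). cbv beta zeta in HC.
  set (D := fun x => a1 * W1 k sstar x + a2 * W2 k sstar x + a3) in *.
  set (Q := fun x => a1 * W2 k sstar x - a2 * W1 k sstar x) in *.
  set (X := fun x => a3 * mu k / (kappa k sstar x * D x) - kappa k sstar x).
  set (Y := fun x => sqrt (mu k) * Q x / D x).
  set (s := fun x => rot_sin (mu k) (kappa k sstar x) (Derive (kappa k sstar) x) (X x) (Y x)).
  set (c := fun x => rot_cos (mu k) (kappa k sstar x) (Derive (kappa k sstar) x) (X x) (Y x)).
  assert (HD : forall x, 0 < D x) by (intros x; exact (proj1 (HC x))).
  assert (Hkap := frame_kap_pos F).
  assert (E1 : forall x, b3 / a3 + Q x / (sqrt (mu k) * a3 * D x) = coord1 gamma x).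
  { intros x. rewrite (proj1 (Par x)). symmetry. apply admissible_numerator; [exact Hmu | exact Adm | apply HD]. }
  assert (E2 : forall x, / (kappa k sstar x * D x) = coord2 gamma x).
  { intros x. rewrite (proj2 (Par x)). unfold Rdiv. fold (D x). ring. }
  assert (D1 : forall x, is_derive (coord1 gamma) x (coord2 gamma x * c x)).
  { intros x. rewrite <- E2. apply (is_derive_ext _ _ _ _ E1). destruct (HC x) as (A1 & A2 & A3 & A4 & A5 & A6 & _). exact A3. }
  assert (D2 : forall x, is_derive (coord2 gamma) x (coord2 gamma x * s x)).
  { intros x. rewrite <- E2. apply (is_derive_ext _ _ _ _ E2). destruct (HC x) as (A1 & A2 & A3 & A4 & A5 & A6 & _). exact A4. }
  assert (Hcs : forall x, c x ^ 2 + s x ^ 2 = 1) by (intros x; destruct (HC x) as (A1 & A2 & A3 & A4 & A5 & A6 & _); exact A2).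
  assert (Dc : forall x, is_derive c x (- ((kappa k sstar x - c x) * s x))) by (intros x; destruct (HC x) as (A1 & A2 & A3 & A4 & A5 & A6 & _); exact A5).
  assert (Ds : forall x, is_derive s x ((kappa k sstar x - c x) * c x)) by (intros x; destruct (HC x) as (A1 & A2 & A3 & A4 & A5 & A6 & _); exact A6).
  assert (Sm := frame_diffn F).
  assert (SD : forall n, diffn n D).
  { intros n. destruct (Sm n) as (_ & _ & H1 & H2).
    apply diffn_plus; [apply diffn_plus; apply diffn_mult; try apply diffn_const; assumption | apply diffn_const]. }
  assert (SQ : forall n, diffn n Q).
  { intros n. destruct (Sm n) as (_ & _ & H1 & H2).
    apply (diffn_ext n (fun x => a1 * W2 k sstar x + (- a2) * W1 k sstar x)); [intros x; unfold Q; ring |].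
    apply diffn_plus; apply diffn_mult; try apply diffn_const; assumption. }
  assert (Sg2 : forall n, diffn n (coord2 gamma)).
  { intros n. destruct (Sm n) as (H0 & _). apply (diffn_ext n _ _ E2).
    apply (diffn_inv n (fun x => kappa k sstar x * D x)).
    - intros x. apply Rgt_not_eq, Rmult_lt_0_compat; [apply Hkap | apply HD].
    - now apply diffn_mult. }
  assert (Sg1 : forall n, diffn n (coord1 gamma)).
  { intros n. apply (diffn_ext n (fun x => b3 / a3 + / (sqrt (mu k) * a3) * (Q x * / D x))).
    - intros x. rewrite <- E1. specialize (HD x). field. repeat split; lra.
    - apply diffn_plus; [apply diffn_const |]. apply diffn_mult; [apply diffn_const |].
      apply diffn_mult; [apply SQ |]. apply diffn_inv; [| apply SD]. intros x. apply Rgt_not_eq, HD. }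
  (* c is the derivative of the first coordinate divided by the second, so it inherits smoothness
     from the curve. *)
  assert (Sc : forall n, diffn n c).
  { intros n. assert (H := Sg1 (S n)). destruct H as (h & Dh & Hh).
    apply (diffn_ext n (fun x => h x * / coord2 gamma x)).
    - intros x. assert (U := is_derive_unique _ _ _ (Dh x)). rewrite (is_derive_unique _ _ _ (D1 x)) in U.
      rewrite <- U. assert (H := coord2_pos gamma x). field. lra.
    - apply diffn_mult; [exact Hh |]. apply diffn_inv; [| apply Sg2].
      intros x. apply Rgt_not_eq, coord2_pos. }
  destruct (angle_lift (fun x => kappa k sstar x - c x) c s) as (phi & Dphi & Ephi).
  - intros x. apply (continuous_minus (V := R_NormedModule) (kappa k sstar) c).
    + apply (ex_derive_continuous (kappa k sstar)). eexists. apply (frame_kap_derive F).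
    + apply (ex_derive_continuous c). eexists. apply Dc.
  - exact Dc.
  - exact Ds.
  - exact Hcs.
  - split; [split; [| split] |].
    + apply diffn_smooth, Sg1.
    + apply diffn_smooth, Sg2.
    + intros x. rewrite (is_derive_unique _ _ _ (D1 x)), (is_derive_unique _ _ _ (D2 x)).
      transitivity (coord2 gamma x ^ 2 * (c x ^ 2 + s x ^ 2)); [ring | rewrite Hcs; ring].
    + exists phi. split; [split |].
      (* The derivative of phi is kappa - c, already known to be smooth. *)
      * apply diffn_smooth. intros [|n]; [exact I |].
        exists (fun x => kappa k sstar x - c x). split; [exact Dphi |].
        apply (diffn_ext n (fun x => kappa k sstar x + (-1) * c x)); [intros x; ring |].
        destruct (Sm n) as (H0 & _). apply diffn_plus; [exact H0 |].
        apply diffn_mult; [apply diffn_const | apply Sc].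
      * intros x. destruct (Ephi x) as [-> ->].
        split; apply is_derive_unique; [apply D1 | apply D2].
      * intros x. rewrite (is_derive_unique _ _ _ (Dphi x)). destruct (Ephi x) as [-> _]. ring.
Qed.

Theorem theorem4 (k sstar : R) (hk : 0 < k < 1) (gamma : R -> Hyp) :
  (orbitlike_elastica k sstar gamma <->
   exists a1 a2 a3 b1 b2 b3 : R,
     admissible k a1 a2 a3 b1 b2 b3 /\
     parametrized k sstar gamma a1 a2 a3 b1 b2 b3) /\
  (forall (a1 a2 a3 b1 b2 b3 : R) (phi : R -> R),
     admissible k a1 a2 a3 b1 b2 b3 ->
     parametrized k sstar gamma a1 a2 a3 b1 b2 b3 ->
     angle_function gamma phi ->
     forall s : R,
       (coord2 gamma s * a1, coord2 gamma s * a2) = xi1 k sstar phi s /\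
       (coord2 gamma s * b1, coord2 gamma s * b2) =
         (coord1 gamma s * fst (xi1 k sstar phi s)
            + coord2 gamma s * fst (xi3 k sstar phi s),
          coord1 gamma s * snd (xi1 k sstar phi s)
            + coord2 gamma s * snd (xi3 k sstar phi s)) /\
       coord1 gamma s =
         b3 / a3 + 1 / (2 * mu k * a3)
           * (kappa k sstar s ^ 2 * sin (phi s)
              + 2 * Derive (kappa k sstar) s * cos (phi s)) /\
       coord2 gamma s =
         kappa k sstar s / (mu k * a3) + 1 / (2 * mu k * a3)
           * (2 * Derive (kappa k sstar) s * sin (phi s)
              - kappa k sstar s ^ 2 * cos (phi s))).
Proof.
  split.
  { split.
    - now apply elastica_is_parametrized.
    - intros (a1 & a2 & a3 & b1 & b2 & b3 & Adm & Par).
      now apply (parametrized_is_elastica k sstar gamma a1 a2 a3 b1 b2 b3). }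
  intros a1 a2 a3 b1 b2 b3 phi Adm Par (_ & Hphi) x.
  assert (Hmu := mu_pos k hk). assert (F := kappa_W_frame k sstar hk).
  assert (Hs : 0 < sqrt (mu k)) by now apply sqrt_lt_R0.
  assert (Hs2 : sqrt (mu k) ^ 2 = mu k) by (apply pow2_sqrt; lra).
  assert (Adm' := Adm). destruct Adm' as (Ea' & Ha3 & Eb1 & Eb2). assert (Ea := sqrt_sum_sq _ _ _ Ea').
  assert (HC := frame_curve a1 a2 a3 (b3 / a3) F Hmu Ha3 Ea). cbv beta zeta in HC.
  assert (HD : forall y, 0 < a1 * W1 k sstar y + a2 * W2 k sstar y + a3) by (intros y; exact (proj1 (HC y))).
  assert (E1 : forall y, b3 / a3 + (a1 * W2 k sstar y - a2 * W1 k sstar y)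
      / (sqrt (mu k) * a3 * (a1 * W1 k sstar y + a2 * W2 k sstar y + a3)) = coord1 gamma y).
  { intros y. rewrite (proj1 (Par y)). symmetry. apply admissible_numerator; [exact Hmu | exact Adm | apply HD]. }
  assert (E2 : forall y, / (kappa k sstar y * (a1 * W1 k sstar y + a2 * W2 k sstar y + a3)) = coord2 gamma y).
  { intros y. rewrite (proj2 (Par y)). unfold Rdiv. ring. }
  destruct (HC x) as (HDx & _ & D1 & D2 & _ & _ & EX & EY & EP').
  assert (Hg := coord2_pos gamma x).
  assert (Hk := frame_kap_pos F x).
  assert (HW := frame_wronskian F x).
  apply (is_derive_ext _ _ _ _ E1) in D1. apply (is_derive_ext _ _ _ _ E2) in D2.
  assert (E1x := E1 x). assert (E2x := E2 x). rewrite E2x in D1, D2.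
  destruct (Hphi x) as [P1 P2].
  (* Two expressions for the velocity, divided by the positive second coordinate, identify the
     explicit unit vector with (cos phi, sin phi) for the given angle function. *)
  rewrite (is_derive_unique _ _ _ D1) in P1. rewrite (is_derive_unique _ _ _ D2) in P2.
  apply Rmult_eq_reg_l in P1; [| lra]. apply Rmult_eq_reg_l in P2; [| lra].
  rewrite P1, P2 in EX, EY. rewrite P2 in EP'. rewrite P1 in D1. clear P1 P2 D2 HC Hphi.
  (* Clearing the denominator of gamma_1 and differentiating gives the second row of the linear
     system for (b1, b2). *)
  assert (EN : forall y, b1 * W1 k sstar y + b2 * W2 k sstar y + b3 =
      coord1 gamma y * (a1 * W1 k sstar y + a2 * W2 k sstar y + a3)).
  { intros y. rewrite (proj1 (Par y)). specialize (HD y). field. lra. }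
  assert (EB' : b1 * Derive (W1 k sstar) x + b2 * Derive (W2 k sstar) x =
      coord2 gamma x * cos (phi x) * (a1 * W1 k sstar x + a2 * W2 k sstar x + a3)
      + coord1 gamma x * (a1 * Derive (W1 k sstar) x + a2 * Derive (W2 k sstar) x)).
  { assert (DW1 := frame_V1_derive F x). assert (DW2 := frame_V2_derive F x).
    assert (A : is_derive (fun y => b1 * W1 k sstar y + b2 * W2 k sstar y + b3) x
      (b1 * Derive (W1 k sstar) x + b2 * Derive (W2 k sstar) x)).
    { auto_derive; [repeat split; eexists; eassumption |].
      rewrite_Derive DW1; rewrite_Derive DW2. ring. }
    assert (B : is_derive (fun y => coord1 gamma y * (a1 * W1 k sstar y + a2 * W2 k sstar y + a3)) x
      (coord2 gamma x * cos (phi x) * (a1 * W1 k sstar x + a2 * W2 k sstar x + a3)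
      + coord1 gamma x * (a1 * Derive (W1 k sstar) x + a2 * Derive (W2 k sstar) x))).
    { auto_derive; [repeat split; eexists; eassumption |].
      rewrite_Derive D1; rewrite_Derive DW1; rewrite_Derive DW2. ring. }
    apply (is_derive_ext _ _ _ _ EN) in A.
    rewrite <- (is_derive_unique _ _ _ A). exact (is_derive_unique _ _ _ B). }
  assert (ENx := EN x).
  set (D := a1 * W1 k sstar x + a2 * W2 k sstar x + a3) in *.
  set (Q := a1 * W2 k sstar x - a2 * W1 k sstar x) in *.
  set (kap := kappa k sstar x) in *. set (kap' := Derive (kappa k sstar) x) in *.
  set (W1' := Derive (W1 k sstar) x) in *. set (W2' := Derive (W2 k sstar) x) in *.
  assert (EPD : a1 * W1 k sstar x + a2 * W2 k sstar x = D - a3) by (unfold D; ring).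
  assert (EDg : D = / (kap * coord2 gamma x)) by (rewrite <- E2x; field; lra).
  assert (EQg : Q = sqrt (mu k) * a3 * D * (coord1 gamma x - b3 / a3)) by (rewrite <- E1x; field; lra).
  assert (F2 : mu k * a3 * coord2 gamma x - kap = kap' * sin (phi x) - kap ^ 2 / 2 * cos (phi x)).
  { rewrite <- EX, <- E2x. field. lra. }
  assert (F1 : mu k * a3 * (coord1 gamma x - b3 / a3) = kap ^ 2 / 2 * sin (phi x) + kap' * cos (phi x)).
  { rewrite <- EY, EQg. rewrite <- Hs2 at 1. field. lra. }
  assert (Hdet : det2 ((W1 k sstar x, W2 k sstar x), (W1', W2')) <> 0).
  { simpl. rewrite Rmult_comm in HW. lra. }
  (* The inverse matrix is removed by checking that the fundamental matrix maps gamma_2 (a1, a2) to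
     the vector in the definition of [xi1]. *)
  assert (X1 : xi1 k sstar phi x = (coord2 gamma x * a1, coord2 gamma x * a2)).
  { unfold xi1, fundamental_matrix. fold kap kap' W1' W2'.
    rewrite <- (inv2_mulmv2 _ _ _ _ (coord2 gamma x * a1) (coord2 gamma x * a2) Hdet). do 2 f_equal.
    - transitivity (1 / kap - (kap' * sin (phi x) - kap ^ 2 / 2 * cos (phi x) + kap) / mu k); [field; lra |].
      rewrite <- F2. transitivity (coord2 gamma x * (D - a3)); [rewrite EDg; field; lra | rewrite <- EPD; ring].
    - transitivity (coord2 gamma x * (- D * (sin (phi x) + kap' / kap))); [rewrite EDg; field; lra |].
      rewrite <- EP'. ring. }
  (* xi^3 is b - gamma_1 a, so multiplying by gamma_2 and inserting xi^1 = gamma_2 a gives the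
     formula for gamma_2 b. *)
  assert (X3 : xi3 k sstar phi x = (b1 - coord1 gamma x * a1, b2 - coord1 gamma x * a2)).
  { unfold xi3, fundamental_matrix. fold kap kap' W1' W2'.
    rewrite <- (inv2_mulmv2 _ _ _ _ (b1 - coord1 gamma x * a1) (b2 - coord1 gamma x * a2) Hdet). do 2 f_equal.
    - transitivity ((kap ^ 2 / 2 * sin (phi x) + kap' * cos (phi x)) / mu k); [field; lra |].
      rewrite <- F1.
      transitivity (coord1 gamma x * D - b3 - coord1 gamma x * (D - a3)); [field; lra |].
      rewrite <- ENx, <- EPD. ring.
    - transitivity (coord2 gamma x * cos (phi x) * D); [rewrite EDg; field; lra |].
      transitivity (b1 * W1' + b2 * W2' - coord1 gamma x * (a1 * W1' + a2 * W2')); [rewrite EB' | ]; ring. }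
  rewrite X1, X3. simpl fst. simpl snd.
  split; [reflexivity |]. split; [f_equal; ring |]. split.
  - transitivity (b3 / a3 + (kap ^ 2 / 2 * sin (phi x) + kap' * cos (phi x)) / (mu k * a3)); [| field; lra].
    rewrite <- F1. field. lra.
  - transitivity ((kap' * sin (phi x) - kap ^ 2 / 2 * cos (phi x) + kap) / (mu k * a3)); [| field; lra].
    rewrite <- F2. field. lra.
Qed.
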